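(* Let $\mathsf C$ be a braided monoidal category in which coequalizers exist and are preserved by the monoidal product, in which the composite of regular epimorphisms is a regular epimorphism, and in which idempotent morphisms split. Let $(t_1,t_2,t_3,t_4,e_1,e_2,j)$ be a regular weak multiplier bimonoid in $\mathsf C$ with underlying object $A$, whose multiplication $m=(j1).t_1$ is a regular epimorphism and non-degenerate with respect to some class $\mathcal Y$ of objects which contains $A$, the monoidal unit $I$ and the base object $L$, and which is closed under the monoidal product. Assume that $n_1\colon LA\to A$ is non-degenerate on the right with respect to $\mathcal Y$ (equivalently, that $n_2\colon AL\to A$ is non-degenerate on the left with respect to $\mathcal Y$), and that the morphisms $\hat d_1\colon A^3\to A\circ A$ and $\hat d_2\colon A^3\to A\bullet A$ are regular epimorphisms. Then there is a monoidal structure on the category of $A$-modules for which the functor $U$ from the category of $A$-modules to the monoidal category of $L$-bicomodules (equipping an $A$-module $V$ with the coactions $\tau_V$, $\overline\tau_V$ described in the context, and acting on morphisms as the identity) is strict monoidal.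
   Context: Notation. Composition is written $g.f$ (first $f$, then $g$); identity morphisms are written $1$; the monoidal product is juxtaposition (of objects and of morphisms), $A^n$ is the $n$-fold monoidal power, $I$ is the monoidal unit, $c$ is the braiding; associativity and unit isomorphisms are suppressed. Reversed/inverse categories. $\mathsf C^{\mathsf{rev}}$ is $\mathsf C$ with the reversed monoidal product $X\otimes^{\mathsf{rev}}Y=YX$ and the same braiding; identities stated in $\mathsf C^{\mathsf{rev}}$ arise from those in $\mathsf C$ by reversing the order of every monoidal product ($t1\leftrightarrow 1t$, $1c\leftrightarrow c1$, $j1\leftrightarrow 1j$, etc.). $\overline{\mathsf C}$ is the same monoidal category with the inverse braiding (interchange $c$ and $c^{-1}$). $\overline{\mathsf C}^{\mathsf{rev}}$ has both changes. Non-degeneracy. A morphism $v\colon ZV\to W$ is non-degenerate on the left with respect to a class $\mathcal Y$ of objects if for any object $X$ and any $Y\in\mathcal Y$ the map $\mathsf C(X,VY)\to\mathsf C(ZX,WY)$, $g\mapsto (v1).(1g)$ is injective. It is non-degenerate on the right with respect to $\mathcal Y$ if $v.c\colon VZ\to W$ is non-degenerate on the left with respect to $\mathcal Y$. A multiplication $m\colon A^2\to A$ is non-degenerate with respect to $\mathcal Y$ if it is so both on the left and on the right. Convention on the class $\mathcal Y$. Non-degeneracy with respect to an object is inherited by its retracts; so, without any loss of generality, the class $\mathcal Y$ is taken to be closed under retracts. This is a normalization of $\mathcal Y$ and not a further restriction on the bimonoid. Weakly counital fusion morphism. In a braided monoidal category this is an object $A$ with morphisms $t,e\colon A^2\to A^2$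 and $j\colon A\to I$ such that, with $m:=(j1).t$: (I) $(t1).(c^{-1}1).(1t).(c1).(1t)=(1t).(t1)$; (II) $e.e=e$; (III) $e.t=t$; (IV) $(m1).(1c).(t1).(1c^{-1}).(1e)=(m1).(1c).(t1).(1c^{-1})$; (V) $(e1).(1t)=(1t).(e1)$; (VI) $(t1).(1c).(e1).(1c^{-1})=(1e).(t1)$; (VII) $m.(1j1).(t1)=m.(11j).(1e).(1c)$; (VIII) $(j1).(m1).(1c).(t1)=m.(1j1).(1e).(1c)$. Such an $m$ is automatically associative. Regular weak multiplier bimonoid. It consists of an object $A$ and morphisms $t_1,t_2,t_3,t_4,e_1,e_2\colon A^2\to A^2$, $j\colon A\to I$ such that, with $m:=(j1).t_1$: (a) $m$ is non-degenerate with respect to some class containing $I,A,A^2$; (b) $(m1).(1t_1)=(1m).(t_21)$; $(1m).(1c^{-1}).(t_11)=(1m).(t_31).(1c^{-1})$; $(m1).(c^{-1}1).(1t_1)=(1m).(t_41)$; $(1m).(1c^{-1}).(t_21)=(m1).(1t_3)$; $(m1).(c^{-1}1).(1t_2)=(m1).(1t_4).(c^{-1}1)$; $(m1).(c^{-1}1).(1t_3)=(1m).(1c^{-1}).(t_41)$; (c) $(t_k1).(1t_l)=(1t_l).(t_k1)$ for $k\in\{2,4\}$, $l\in\{1,3\}$; (d) $m=(j1).t_1=(1j).t_2=(j1).t_3.c=(1j).t_4.c$; (e) $(mm).(1c1).(11e_1)=(mm).(1c1).(e_211)$ as morphisms $A^4\to A^2$; (f) $(t_1,e_1,j)$, $(t_2,e_2,j)$,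 $(t_3,e_2,j)$, $(t_4,e_1,j)$ are weakly counital fusion morphisms in $\mathsf C$, $\mathsf C^{\mathsf{rev}}$, $\overline{\mathsf C}$, $\overline{\mathsf C}^{\mathsf{rev}}$, respectively (these four requirements are equivalent given the others). Base object. $p\colon A\to L$ is the coequalizer of $(j1).e_1$ and $(1j).e_1\colon A^2\to A$; $L$ is called the base object. There are unique morphisms $n_1\colon LA\to A$ and $n_2\colon AL\to A$ with $n_1.(p1)=(j1).e_1$ and $n_2.(1p)=(j1).t_4.c$. Comonoid $L$. Under the stated assumptions there are unique morphisms $\mu\colon L^2\to L$, $\delta\colon L\to L^2$, $\varepsilon\colon L\to I$ with $\mu.(1p)=p.n_1$, $\delta.p.m=(pp).t_1$, $\varepsilon.p=j$; $(L,\delta,\varepsilon)$ is a comonoid, $\mu$ is associative, $\mu.\delta=1$ and $(\mu1).(1\delta)=\delta.\mu=(1\mu).(\delta1)$. Modules. A module over the semigroup $(A,m)$ is an object $V$ in $\mathcal Y$ with a morphism $v\colon AV\to V$ which is associative ($v.(1v)=v.(m1)$), is a regular epimorphism, and is non-degenerate on the left with respect to $\mathcal Y$. A morphism of modules $(V,v)\to(V',v')$ is $f\colon V\to V'$ with $f.v=v'.(1f)$. $L$-bicomodules. An $L$-bicomodule is an object with a left coaction $\tau\colon V\to LV$ and a right coaction $\overline\tau\colon V\to VL$, coassociative and counital, with $(1\overline\tau).\tau=(\tau1).\overline\tau$. The category of $L$-bicomodules is monoidal: the unit is $L$ with both coactions $\delta$; the monoidal product $V\circ W$ is obtained by splitting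 the idempotent $s:=(1\varepsilon1).(1\mu1).(\overline\tau\tau)\colon VW\to VW$ as $VW\xrightarrow{\hat s}V\circ W\xrightarrow{\check s}VW$. The functor $U$. The object $A$ is an $L$-bicomodule via the unique coactions $\tau_A$, $\overline\tau_A$ with $\tau_A.m=(p1).t_1$ and $\overline\tau_A.m=(1p).t_4.c$. Each $A$-module $(V,v)$ is an $L$-bicomodule via the unique coactions with $\tau_V.v=(1v).(\tau_A1)$ and $\overline\tau_V.v=(v1).(1c_{L,V}).(\overline\tau_A1)$, and module morphisms are bicomodule morphisms; this defines $U$. The morphisms $\hat d_1,\hat d_2$. Put $d_1:=(m1).(1c).(t_11).(1c^{-1})$ and $d_2:=(1m).(c1).(1t_2).(c^{-1}1)$, morphisms $A^3\to A^2$; they satisfy $e_1.d_1=d_1$, $e_2.d_2=d_2$. Split the idempotents as $e_1=\check e_1.\hat e_1$ through $A\circ A$ and $e_2=\check e_2.\hat e_2$ through $A\bullet A$ (with $\hat e_i.\check e_i=1$), and let $\hat d_i:=\hat e_i.d_i$, i.e. the unique morphism with $\check e_i.\hat d_i=d_i$. *)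

(* Defs.v *)
From Stdlib Require Import List ProofIrrelevance.
From Corelib Require Import ssreflect ssrfun ssrbool.
Import ListNotations.

Set Implicit Arguments.
Unset Strict Implicit.
Unset Printing Implicit Defensive.

Declare Scope cat_scope.
Delimit Scope cat_scope with cat.
Local Open Scope cat_scope.

Record category := Category {
  ob :> Type;
  hom : ob -> ob -> Type;
  idm : forall X, hom X X;
  comp : forall X Y Z, hom Y Z -> hom X Y -> hom X Z;
  comp1m : forall X Y (f : hom X Y), comp (idm Y) f = f;
  compm1 : forall X Y (f : hom X Y), comp f (idm X) = f;
  compA : forall X Y Z W (h : hom Z W) (g : hom Y Z) (f : hom X Y),
    comp h (comp g f) = comp (comp h g) f }.

Arguments hom {c} X Y.
Arguments idm {c} X.
Arguments comp {c X Y Z} g f.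
Arguments comp1m {c X Y} f.
Arguments compm1 {c X Y} f.
Arguments compA {c X Y Z W} h g f.

Notation "g · f" := (comp g f) (at level 40, left associativity) : cat_scope.

Record functor (C D : category) := Functor {
  fob :> C -> D;
  fmap : forall X Y, hom X Y -> hom (fob X) (fob Y);
  fmap1 : forall X, fmap (idm X) = idm (fob X);
  fmapM : forall X Y Z (g : hom Y Z) (f : hom X Y),
    fmap (g · f) = fmap g · fmap f }.

Arguments fmap {C D} F {X Y} f : rename.

Definition eq_hom {C : category} {X Y : C} (e : X = Y) : hom X Y :=
  match e in _ = Z return hom X Z with eq_refl => idm X end.

Definition is_coequalizer {C : category} {X Y Q : C}
    (f g : hom X Y) (q : hom Y Q) : Prop :=
  q · f = q · g /\
  forall (Z : C) (h : hom Y Z), h · f = h · g ->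
    exists! k : hom Q Z, k · q = h.

Definition regular_epi {C : category} {Y Q : C} (q : hom Y Q) : Prop :=
  exists (X : C) (f g : hom X Y), is_coequalizer f g q.

Definition has_coequalizers (C : category) : Prop :=
  forall (X Y : C) (f g : hom X Y),
    exists (Q : C) (q : hom Y Q), is_coequalizer f g q.

Definition regular_epis_compose (C : category) : Prop :=
  forall (X Y Z : C) (f : hom X Y) (g : hom Y Z),
    regular_epi f -> regular_epi g -> regular_epi (g · f).

Record splitting {C : category} {X : C} (e : hom X X) := Splitting {
  split_ob : C;
  split_in : hom split_ob X;
  split_out : hom X split_ob;
  split_in_out : split_in · split_out = e;
  split_out_in : split_out · split_in = idm split_ob }.

(* Splittings are given as a choice function, so that the chosen splittings
   determine a monoidal product of bicomodules on the nose. *)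
Definition idempotent_splitting (C : category) : Type :=
  forall (X : C) (e : hom X X), e · e = e -> splitting e.

Record monoidal (C : category) := Monoidal {
  tens : C -> C -> C;
  tensm : forall X X' Y Y', hom X X' -> hom Y Y' ->
    hom (tens X Y) (tens X' Y');
  munit : C;
  assoc : forall X Y Z, hom (tens (tens X Y) Z) (tens X (tens Y Z));
  assocV : forall X Y Z, hom (tens X (tens Y Z)) (tens (tens X Y) Z);
  lun : forall X, hom (tens munit X) X;
  lunV : forall X, hom X (tens munit X);
  run : forall X, hom (tens X munit) X;
  runV : forall X, hom X (tens X munit);
  tensm1 : forall X Y, tensm (idm X) (idm Y) = idm (tens X Y);
  tensmM : forall X X' X'' Y Y' Y'' (f' : hom X' X'') (f : hom X X')
      (g' : hom Y' Y'') (g : hom Y Y'),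
    tensm (f' · f) (g' · g) = tensm f' g' · tensm f g;
  assocK : forall X Y Z, assocV X Y Z · assoc X Y Z = idm _;
  assocVK : forall X Y Z, assoc X Y Z · assocV X Y Z = idm _;
  lunK : forall X, lunV X · lun X = idm _;
  lunVK : forall X, lun X · lunV X = idm _;
  runK : forall X, runV X · run X = idm _;
  runVK : forall X, run X · runV X = idm _;
  assoc_nat : forall X X' Y Y' Z Z' (f : hom X X') (g : hom Y Y')
      (h : hom Z Z'),
    assoc X' Y' Z' · tensm (tensm f g) h
    = tensm f (tensm g h) · assoc X Y Z;
  lun_nat : forall X X' (f : hom X X'),
    lun X' · tensm (idm munit) f = f · lun X;
  run_nat : forall X X' (f : hom X X'),
    run X' · tensm f (idm munit) = f · run X;
  triangle : forall X Y,
    tensm (idm X) (lun Y) · assoc X munit Y = tensm (run X) (idm Y);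
  pentagon : forall X Y Z W,
    assoc X Y (tens Z W) · assoc (tens X Y) Z W
    = tensm (idm X) (assoc Y Z W) · assoc X (tens Y Z) W
        · tensm (assoc X Y Z) (idm W) }.

Arguments tens {C} m X Y.
Arguments tensm {C} m {X X' Y Y'} f g.
Arguments munit {C} m.

Definition tensor_preserves_coequalizers {C : category} (M : monoidal C) :
    Prop :=
  forall (X Y Q : C) (f g : hom X Y) (q : hom Y Q),
    is_coequalizer f g q ->
    forall Z : C,
      is_coequalizer (tensm M (idm Z) f) (tensm M (idm Z) g)
        (tensm M (idm Z) q) /\
      is_coequalizer (tensm M f (idm Z)) (tensm M g (idm Z))
        (tensm M q (idm Z)).

(* A functor is strict monoidal when identities are monoidal structure
   morphisms for it: objects are preserved up to equality, and the resulting
   identity morphisms are natural and compatible with the associativity and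
   unit isomorphisms. *)
Definition strict_monoidal {C D : category} (MC : monoidal C)
    (MD : monoidal D) (F : functor C D) : Prop :=
  exists (e0 : munit MD = F (munit MC))
         (e2 : forall X Y, tens MD (F X) (F Y) = F (tens MC X Y)),
    [/\ forall X X' Y Y' (f : hom X X') (g : hom Y Y'),
          fmap F (tensm MC f g) · eq_hom (e2 X Y)
          = eq_hom (e2 X' Y') · tensm MD (fmap F f) (fmap F g),
        forall X Y Z,
          fmap F (assoc MC X Y Z) · eq_hom (e2 (tens MC X Y) Z)
            · tensm MD (eq_hom (e2 X Y)) (idm (F Z))
          = eq_hom (e2 X (tens MC Y Z))
            · tensm MD (idm (F X)) (eq_hom (e2 Y Z))
            · assoc MD (F X) (F Y) (F Z),
        forall X,
          fmap F (lun MC X) · eq_hom (e2 (munit MC) X)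
            · tensm MD (eq_hom e0) (idm (F X))
          = lun MD (F X)
      & forall X,
          fmap F (run MC X) · eq_hom (e2 X (munit MC))
            · tensm MD (idm (F X)) (eq_hom e0)
          = run MD (F X)].

Record braided {C : category} (M : monoidal C) := Braided {
  braid : forall X Y, hom (tens M X Y) (tens M Y X);
  braidV : forall X Y, hom (tens M Y X) (tens M X Y);
  braidK : forall X Y, braidV X Y · braid X Y = idm _;
  braidVK : forall X Y, braid X Y · braidV X Y = idm _;
  braid_nat : forall X X' Y Y' (f : hom X X') (g : hom Y Y'),
    braid X' Y' · tensm M f g = tensm M g f · braid X Y;
  hexagon1 : forall X Y Z,
    assoc M Y Z X · braid X (tens M Y Z) · assoc M X Y Z
    = tensm M (idm Y) (braid X Z) · assoc M Y X Z
        · tensm M (braid X Y) (idm Z);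
  hexagon2 : forall X Y Z,
    assocV M Z X Y · braid (tens M X Y) Z · assocV M X Y Z
    = tensm M (braid X Z) (idm Y) · assocV M X Z Y
        · tensm M (idm X) (braid Y Z) }.

Record bmcat := Bmcat {
  bcat :> category;
  bmon : monoidal bcat;
  bbraid : braided bmon }.

Arguments bmon : clear implicits.
Arguments bbraid : clear implicits.

Section Inverses.
Variable C : category.

Lemma epi_split (X Y Z : C) (f : hom X Y) (fi : hom Y X) (g h : hom Y Z) :
  f · fi = idm _ -> g · f = h · f -> g = h.
Proof.
by move=> fK e; rewrite -(compm1 g) -(compm1 h) -fK !compA e.
Qed.

Lemma mono_split (X Y Z : C) (f : hom Y Z) (fi : hom Z Y) (g h : hom X Y) :
  fi · f = idm _ -> f · g = f · h -> g = h.
Proof.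
by move=> fK e; rewrite -(comp1m g) -(comp1m h) -fK -!compA e.
Qed.

Lemma inv_unique (X Y : C) (f g : hom X Y) (fi gi : hom Y X) :
  fi · f = idm _ -> g · gi = idm _ -> f = g -> fi = gi.
Proof.
by move=> h1 h2 e; rewrite -(compm1 fi) -h2 -e compA h1 comp1m.
Qed.

Lemma inv_comp (X Y Z : C) (f : hom X Y) (fi : hom Y X) (g : hom Y Z)
    (gi : hom Z Y) :
  fi · f = idm _ -> gi · g = idm _ -> (fi · gi) · (g · f) = idm _.
Proof. by move=> h1 h2; rewrite compA -(compA fi) h2 compm1. Qed.

Lemma inv_comp3 (X Y Z W : C) (f : hom X Y) (fi : hom Y X) (g : hom Y Z)
    (gi : hom Z Y) (h : hom Z W) (hi : hom W Z) :
  fi · f = idm _ -> gi · g = idm _ -> hi · h = idm _ ->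
  (fi · gi · hi) · (h · g · f) = idm _.
Proof.
move=> h1 h2 h3; rewrite -(compA fi); apply: inv_comp => //.
exact: inv_comp.
Qed.

End Inverses.

Section MonoidalTheory.
Variables (C : category) (M : monoidal C).

Lemma inv_tens (X Y X' Y' : C) (f : hom X Y) (fi : hom Y X)
   (g : hom X' Y') (gi : hom Y' X') :
  fi · f = idm _ -> gi · g = idm _ ->
  tensm M fi gi · tensm M f g = idm _.
Proof. by move=> h1 h2; rewrite -tensmM h1 h2 tensm1. Qed.

Lemma assocV_nat X X' Y Y' Z Z' (f : hom X X') (g : hom Y Y') (h : hom Z Z') :
  assocV M X' Y' Z' · tensm M f (tensm M g h)
  = tensm M (tensm M f g) h · assocV M X Y Z.
Proof.
apply: (epi_split (assocVK M X Y Z)); rewrite -!compA assocK compm1.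
by rewrite -assoc_nat compA assocK comp1m.
Qed.

Lemma pentagonV X Y Z W :
  assocV M (tens M X Y) Z W · assocV M X Y (tens M Z W)
  = tensm M (assocV M X Y Z) (idm W) · assocV M X (tens M Y Z) W
      · tensm M (idm X) (assocV M Y Z W).
Proof.
apply: (inv_unique _ _ (pentagon M X Y Z W)).
  by apply: inv_comp; apply: assocK.
rewrite -(compA (tensm M (assocV M X Y Z) (idm W))).
apply: inv_comp; last by rewrite -tensmM comp1m assocVK tensm1.
by apply: inv_comp; rewrite ?assocVK // -tensmM comp1m assocVK tensm1.
Qed.

Lemma triangleV X Y :
  tensm M (run M X) (idm Y) · assocV M X (munit M) Y
  = tensm M (idm X) (lun M Y).
Proof. by rewrite -triangle -compA assocVK compm1. Qed.

Lemma tens_unit_inj (X Y : C) (f g : hom X Y) :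
  tensm M (idm (munit M)) f = tensm M (idm (munit M)) g -> f = g.
Proof.
move=> e; apply: (epi_split (lunVK M X)).
by rewrite -!lun_nat e.
Qed.

Lemma lun_tens X Y :
  lun M (tens M X Y) · assoc M (munit M) X Y = tensm M (lun M X) (idm Y).
Proof.
set I := munit M.
apply: tens_unit_inj.
have iso : (assoc M I (tens M I X) Y · tensm M (assoc M I I X) (idm Y)) ·
  (tensm M (assocV M I I X) (idm Y) · assocV M I (tens M I X) Y) = idm _.
  by apply: inv_comp; rewrite ?assocVK // -tensmM assocVK comp1m tensm1.
apply: (epi_split iso).
rewrite -{1}(comp1m (idm I)) tensmM -compA.
rewrite (compA (tensm M _ (assoc M _ _ _))) -pentagon.
rewrite (compA (tensm M (idm I) (lun M _))).
rewrite triangle -(tensm1 M X Y) -assoc_nat -triangle.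
rewrite -{1}(comp1m (idm Y)) tensmM.
by rewrite !compA assoc_nat.
Qed.

End MonoidalTheory.

Section Rev.
Variables (C : category) (M : monoidal C).

(* The unit and associativity isomorphisms of the reversed product are those
   of M with left and right interchanged, respectively inverted. *)
Definition rev_monoidal : monoidal C.
Proof.
refine (@Monoidal C (fun X Y => tens M Y X)
  (fun _ _ _ _ f g => tensm M g f) (munit M)
  (fun X Y Z => assocV M Z Y X) (fun X Y Z => assoc M Z Y X)
  (run M) (runV M) (lun M) (lunV M) _ _ _ _ _ _ _ _ _ _ _ _ _).
- by move=> *; apply: tensm1.
- by move=> *; apply: tensmM.
- by move=> *; apply: assocVK.
- by move=> *; apply: assocK.
- exact: runK.
- exact: runVK.
- exact: lunK.
- exact: lunVK.
- by move=> *; apply: assocV_nat.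
- exact: run_nat.
- exact: lun_nat.
- by move=> *; apply: triangleV.
- by move=> *; apply: pentagonV.
Defined.

Variable B : braided M.

Definition rev_braided : braided rev_monoidal.
Proof.
refine (@Braided C rev_monoidal (fun X Y => braid B Y X)
  (fun X Y => braidV B Y X) _ _ _ _ _).
- by move=> X Y; exact (braidK B Y X).
- by move=> X Y; exact (braidVK B Y X).
- by move=> X X' Y Y' f g; exact (braid_nat B g f).
- by move=> X Y Z; exact (hexagon2 B Z Y X).
- by move=> X Y Z; exact (hexagon1 B Z Y X).
Defined.

Lemma braidV_nat X X' Y Y' (f : hom X X') (g : hom Y Y') :
  braidV B X' Y' · tensm M g f = tensm M f g · braidV B X Y.
Proof.
apply: (epi_split (braidVK B X Y)).
by rewrite -!compA braidK compm1 -braid_nat compA braidK comp1m.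
Qed.

Lemma hexagon1V X Y Z :
  assoc M Y Z X · braidV B (tens M Y Z) X · assoc M X Y Z
  = tensm M (idm Y) (braidV B Z X) · assoc M Y X Z
      · tensm M (braidV B Y X) (idm Z).
Proof.
apply: (inv_unique _ _ (hexagon2 B Y Z X)).
  by apply: inv_comp3; rewrite ?assocVK ?braidK.
by apply: inv_comp3; rewrite ?assocVK ?assocK // -tensmM braidVK comp1m tensm1.
Qed.

Lemma hexagon2V X Y Z :
  assocV M Z X Y · braidV B Z (tens M X Y) · assocV M X Y Z
  = tensm M (braidV B Z X) (idm Y) · assocV M X Z Y
      · tensm M (idm X) (braidV B Z Y).
Proof.
apply: (inv_unique _ _ (hexagon1 B Z X Y)).
  by apply: inv_comp3; rewrite ?assocK ?braidK.
by apply: inv_comp3; rewrite ?assocVK ?assocK // -tensmM braidVK comp1m tensm1.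
Qed.

Definition inv_braided : braided M :=
  @Braided C M (fun X Y => braidV B Y X) (fun X Y => braid B Y X)
    (fun X Y => braidVK B Y X) (fun X Y => braidK B Y X)
    (fun _ _ _ _ f g => braidV_nat g f) hexagon1V hexagon2V.

End Rev.

Definition rev_cat (B : bmcat) : bmcat :=
  @Bmcat B (rev_monoidal (bmon B)) (rev_braided (bbraid B)).

Definition inv_cat (B : bmcat) : bmcat :=
  @Bmcat B (bmon B) (inv_braided (bbraid B)).

(* A word [X1; ...; Xn] denotes the monoidal product X1 (X2 (... Xn)), the
   empty word denotes the monoidal unit, and [u ~> v] is the type of morphisms
   between the objects denoted by u and v.  The monoidal product f ⊗ g of
   morphisms between words goes between concatenated words, by conjugating
   with the canonical isomorphisms phi.  As concatenations of explicit words
   compute, formulas can be written with the associativity and unit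
   isomorphisms suppressed. *)

Section Words.
Variables (C : category) (M : monoidal C).

Fixpoint wob1 (X : C) (u : list C) : C :=
  match u with
  | [] => X
  | Y :: u' => tens M X (wob1 Y u')
  end.

Definition wob (u : list C) : C :=
  match u with
  | [] => munit M
  | X :: u' => wob1 X u'
  end.

Fixpoint phi1 (X : C) (u v : list C) :
    hom (tens M (wob1 X u) (wob v)) (wob1 X (u ++ v)) :=
  match u with
  | [] =>
      match v return hom (tens M X (wob v)) (wob1 X v) with
      | [] => run M X
      | Y :: v' => idm _
      end
  | Y :: u' =>
      tensm M (idm X) (phi1 Y u' v) · assoc M X (wob1 Y u') (wob v)
  end.

Definition phi (u v : list C) :
    hom (tens M (wob u) (wob v)) (wob (u ++ v)) :=
  match u with
  | [] => lun M (wob v)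
  | X :: u' => phi1 X u' v
  end.

Fixpoint phi1V (X : C) (u v : list C) :
    hom (wob1 X (u ++ v)) (tens M (wob1 X u) (wob v)) :=
  match u with
  | [] =>
      match v return hom (wob1 X v) (tens M X (wob v)) with
      | [] => runV M X
      | Y :: v' => idm _
      end
  | Y :: u' =>
      assocV M X (wob1 Y u') (wob v) · tensm M (idm X) (phi1V Y u' v)
  end.

Definition phiV (u v : list C) :
    hom (wob (u ++ v)) (tens M (wob u) (wob v)) :=
  match u with
  | [] => lunV M (wob v)
  | X :: u' => phi1V X u' v
  end.

Definition whom (u v : list C) : Type := hom (wob u) (wob v).

Definition wid (u : list C) : whom u u := idm (wob u).

Definition wcomp (u v w : list C) (g : whom v w) (f : whom u v) : whom u w :=
  comp g f.

Fact wtens_key : unit. Proof. exact tt. Qed.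

Definition wtens (u u' v v' : list C) (f : whom u u') (g : whom v v') :
    whom (u ++ v) (u' ++ v') :=
  locked_with wtens_key (phi u' v' · tensm M f g · phiV u v).

Lemma wtensE u u' v v' (f : whom u u') (g : whom v v') :
  wtens f g = phi u' v' · tensm M f g · phiV u v.
Proof. by rewrite /wtens unlock. Qed.

End Words.

Arguments whom {C} M u v.
Arguments wid {C} M u.
Arguments wcomp {C M u v w} g f.
Arguments wtens {C M u u' v v'} f g.

Notation "g ∘ f" := (wcomp g f) (at level 40, left associativity) : cat_scope.
Notation "f ⊗ g" := (wtens f g) (at level 30, right associativity) : cat_scope.

Section WordTheory.
Variables (C : category) (M : monoidal C).

Lemma phiK u v : phiV M u v · phi M u v = idm _.
Proof.
case: u => [|X u] /=; first exact: lunK.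
elim: u X => [|Y u IH] X /=; first by case: v => [|Z v] /=; rewrite ?runK ?comp1m.
by apply: inv_comp; [apply: assocK | rewrite -tensmM IH comp1m tensm1].
Qed.

Lemma phiVK u v : phi M u v · phiV M u v = idm _.
Proof.
case: u => [|X u] /=; first exact: lunVK.
elim: u X => [|Y u IH] X /=; first by case: v => [|Z v] /=; rewrite ?runVK ?comp1m.
by apply: inv_comp; [rewrite -tensmM IH comp1m tensm1 | apply: assocVK].
Qed.

Lemma wtens1 u v : wtens (wid M u) (wid M v) = wid M (u ++ v).
Proof. by rewrite wtensE tensm1 compm1 phiVK. Qed.

Lemma wtensM u u' u'' v v' v'' (f' : whom M u' u'') (f : whom M u u')
    (g' : whom M v' v'') (g : whom M v v') :
  (f' ∘ f) ⊗ (g' ∘ g) = (f' ⊗ g') ∘ (f ⊗ g).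
Proof.
rewrite !wtensE /wcomp tensmM -!compA; congr (_ · (_ · _)).
by rewrite !compA phiK comp1m.
Qed.

Lemma wcompA u v w x (h : whom M w x) (g : whom M v w) (f : whom M u v) :
  h ∘ (g ∘ f) = h ∘ g ∘ f.
Proof. exact: compA. Qed.

Lemma wcomp1m u v (f : whom M u v) : wid M v ∘ f = f.
Proof. exact: comp1m. Qed.

Lemma wcompm1 u v (f : whom M u v) : f ∘ wid M u = f.
Proof. exact: compm1. Qed.

Definition wcast u v (e : u = v) : whom M u v :=
  match e in _ = w return whom M u w with eq_refl => wid M u end.

Lemma wcast_cons X Y u v (e : Y :: u = Y :: v) (e' : X :: Y :: u = X :: Y :: v) :
  wcast e' = tensm M (idm X) (wcast e).
Proof.
have e0 : u = v by case: e.
move: e e'; rewrite -{}e0 => e e'.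
by rewrite (proof_irrelevance _ e eq_refl) (proof_irrelevance _ e' eq_refl) /=
   tensm1.
Qed.

Lemma phi_assoc u v w (e : u ++ (v ++ w) = (u ++ v) ++ w) :
  wcast e · phi M u (v ++ w) · tensm M (idm (wob M u)) (phi M v w)
    · assoc M (wob M u) (wob M v) (wob M w)
  = phi M (u ++ v) w · tensm M (phi M u v) (idm (wob M w)).
Proof.
case: u e => [|X u] e.
  rewrite (proof_irrelevance _ e eq_refl) /= comp1m.
  by rewrite lun_nat -compA lun_tens.
elim: u X e => [|Y u IH] X e.
  rewrite (proof_irrelevance _ e eq_refl) comp1m.
  case: v e => [|Z v] e.
    rewrite /=.
    case: w e => [|W w] e /=; last by rewrite comp1m triangle comp1m.
    by rewrite -triangle compA.
  by rewrite /= comp1m tensm1 compm1.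
have e1 : (Y :: u) ++ (v ++ w) = ((Y :: u) ++ v) ++ w.
  exact: (f_equal (@tl _) e).
rewrite (wcast_cons e1 e) /=.
have := IH Y e1; rewrite /= => {}IH.
rewrite -(tensm1 M X (wob1 M Y u)) !compA -tensmM comp1m.
rewrite -(compA _ (assoc M X _ _)) assoc_nat compA -tensmM comp1m.
rewrite -(compA _ (assoc M _ _ _)) pentagon !compA -tensmM comp1m IH.
rewrite -{1}(comp1m (idm X)) tensmM.
rewrite -(compA _ (tensm M _ (tensm _ _ _))) -assoc_nat.
rewrite !compA -compA; congr (_ · _).
by rewrite -tensmM comp1m.
Qed.

Lemma wtens_phi u u' v v' (f : whom M u u') (g : whom M v v') :
  f ⊗ g · phi M u v = phi M u' v' · tensm M f g.
Proof. by rewrite wtensE -compA phiK compm1. Qed.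

Lemma wtensA u u' v v' w w' (f : whom M u u') (g : whom M v v')
    (h : whom M w w') (e : u ++ (v ++ w) = (u ++ v) ++ w)
    (e' : u' ++ (v' ++ w') = (u' ++ v') ++ w') :
  ((f ⊗ g) ⊗ h) ∘ wcast e = wcast e' ∘ (f ⊗ (g ⊗ h)).
Proof.
have iso : (phi M u (v ++ w) · tensm M (idm _) (phi M v w) · assoc M _ _ _) ·
  (assocV M _ _ _ · tensm M (idm _) (phiV M v w) · phiV M u (v ++ w)) = idm _.
  apply: inv_comp3; rewrite ?phiVK ?assocVK //.
  by rewrite -tensmM phiVK comp1m tensm1.
apply: (epi_split iso).
have E1 := phi_assoc e; have E2 := phi_assoc e'; rewrite /wcomp.
have := wtens_phi (f ⊗ g) h; have := wtens_phi f (g ⊗ h).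
move: ((f ⊗ g) ⊗ h) (f ⊗ (g ⊗ h)) => F G.
have := wtens_phi f g; have := wtens_phi g h.
move: (f ⊗ g) (g ⊗ h) => fg gh Egh Efg EG EF.
rewrite -(compA F) !compA -!compA in E1 *; rewrite E1.
rewrite (compA F) EF -compA -tensmM Efg compm1 -{1}(comp1m h) tensmM compA.
rewrite -E2 -!compA; congr (_ · _).
rewrite (compA G) EG -!compA; congr (_ · _).
rewrite (compA (tensm M f gh)) -tensmM Egh compm1 assoc_nat compA -tensmM.
by rewrite comp1m.
Qed.

Lemma wtensA_eq u u' v v' w w' (f : whom M u u') (g : whom M v v')
    (h : whom M w w') (e : u ++ (v ++ w) = (u ++ v) ++ w)
    (e' : u' ++ (v' ++ w') = (u' ++ v') ++ w') :
  (f ⊗ g) ⊗ h =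
  eq_rect _ (fun x => whom M x ((u' ++ v') ++ w'))
    (eq_rect _ (fun y => whom M (u ++ (v ++ w)) y) (f ⊗ (g ⊗ h)) _ e') _ e.
Proof.
have := wtensA f g h e e'.
move: ((f ⊗ g) ⊗ h) (f ⊗ (g ⊗ h)).
by case: _ / e; case: _ / e' => F G; rewrite /= wcompm1 wcomp1m.
Qed.

Lemma run_tens X Y :
  run M (tens M X Y) = tensm M (idm X) (run M Y) · assoc M X Y (munit M).
Proof.
have /= <- := lun_tens (rev_monoidal M) Y X.
by rewrite -compA assocK compm1.
Qed.

Lemma phi_nil u (e : u = u ++ []) : phi M u [] = wcast e · run M (wob M u).
Proof.
case: u e => [|X u] e.
  rewrite (proof_irrelevance _ e eq_refl) /= comp1m.
  set I := munit M.
  have h : tensm M (lun M I) (idm I) = tensm M (run M I) (idm I).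
    rewrite -lun_tens -triangle; congr (_ · _).
    by apply: (mono_split (lunK M I)); rewrite lun_nat.
  by apply: (epi_split (runVK M (tens M I I))); rewrite -!run_nat h.
elim: u X e => [|Y u IH] X e.
  by rewrite (proof_irrelevance _ e eq_refl) /= comp1m.
have e1 : Y :: u = (Y :: u) ++ [] by exact: (f_equal (@tl _) e).
rewrite (wcast_cons e1 e) /=.
have := IH Y e1; rewrite /= => ->.
by rewrite run_tens compA -tensmM comp1m.
Qed.

Lemma wtens_nil_eq u v (f : whom M u v) (e : u = u ++ []) (e' : v = v ++ []) :
  f ⊗ wid M [] =
  eq_rect _ (fun x => whom M x (v ++ []))
    (eq_rect _ (fun y => whom M u y) f _ e') _ e.
Proof.
have h : (f ⊗ wid M []) ∘ wcast e = wcast e' ∘ f.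
  apply: (epi_split (runVK M (wob M u))).
  have E1 := phi_nil e; have E2 := phi_nil e'; rewrite /wcomp.
  have := wtens_phi f (wid M []); move: (f ⊗ wid M []) => F EF.
  rewrite -compA -E1 EF E2 -!compA; congr (_ · _).
  exact: run_nat.
move: (f ⊗ wid M []) h.
by case: _ / e; case: _ / e' => F; rewrite /= wcompm1 wcomp1m.
Qed.

Lemma wnil_tens u v (f : whom M u v) : wid M [] ⊗ f = f.
Proof.
rewrite wtensE /wid /=.
have := lun_nat M f; rewrite -/(whom M _ _) => ->.
by rewrite -compA lunVK compm1.
Qed.

End WordTheory.

Section Slides.
Variables (C : category) (M : monoidal C).

Lemma wtensL u u' v v' (f : whom M u u') (g : whom M v v') :
  f ⊗ g = (f ⊗ wid M v') ∘ (wid M u ⊗ g).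
Proof. by rewrite -wtensM wcompm1 wcomp1m. Qed.

Lemma wtensR u u' v v' (f : whom M u u') (g : whom M v v') :
  f ⊗ g = (wid M u' ⊗ g) ∘ (f ⊗ wid M v).
Proof. by rewrite -wtensM wcompm1 wcomp1m. Qed.

Lemma wslide u u' v v' (f : whom M u u') (g : whom M v v') :
  (f ⊗ wid M v') ∘ (wid M u ⊗ g) = (wid M u' ⊗ g) ∘ (f ⊗ wid M v).
Proof. by rewrite -wtensL wtensR. Qed.

Lemma wlM u v v' v'' (g : whom M v' v'') (f : whom M v v') :
  wid M u ⊗ (g ∘ f) = (wid M u ⊗ g) ∘ (wid M u ⊗ f).
Proof. by rewrite -wtensM wcompm1. Qed.

Lemma wrM u v v' v'' (g : whom M v' v'') (f : whom M v v') :
  (g ∘ f) ⊗ wid M u = (g ⊗ wid M u) ∘ (f ⊗ wid M u).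
Proof. by rewrite -wtensM wcompm1. Qed.

Lemma wcompK u v w x (a : whom M v w) (b : whom M u v) (k : whom M u w)
   (y : whom M x u) : a ∘ b = k -> a ∘ (b ∘ y) = k ∘ y.
Proof. by move=> <-; rewrite wcompA. Qed.

Lemma wcompK3 u v w x z (a : whom M v w) (b : whom M u v) (c : whom M x u)
   (k : whom M x w) (y : whom M z x) :
  a ∘ (b ∘ c) = k -> a ∘ (b ∘ (c ∘ y)) = k ∘ y.
Proof. by move=> <-; rewrite !wcompA. Qed.

End Slides.

Ltac wnorm :=
  repeat match goal with
  | |- context [@wcomp _ _ _ _ _ (@wcomp _ _ _ _ _ ?h ?g) ?f] =>
      rewrite -(wcompA h g f)
  end.
Ltac wnorm_in H :=
  repeat match type of H with
  | context [@wcomp _ _ _ _ _ (@wcomp _ _ _ _ _ ?h ?g) ?f] =>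
      rewrite -(wcompA h g f) in H
  end.
Ltac wstep E :=
  let H := fresh in
  pose proof E as H; cbn [app eq_rect] in H; wnorm_in H;
  first [rewrite H | rewrite (wcompK _ H) | rewrite (wcompK3 _ H)];
  cbn [app]; wnorm; clear H.
Ltac wback E :=
  let H := fresh in
  pose proof E as H; symmetry in H; wstep H; clear H.
Ltac wassoc f g h := wstep (wtensA_eq f g h eq_refl eq_refl).
Ltac wunassoc f g h := wback (wtensA_eq f g h eq_refl eq_refl).
Ltac wnil f := wstep (wtens_nil_eq f eq_refl eq_refl).

Notation "⟨ X ⟩" := (wid _ (@cons (ob _) X nil)) (at level 0, X at level 99, format "⟨ X ⟩")
  : cat_scope.

(* A comonoid with a compatible associative, not necessarily unital,
   multiplication: the structure carried by the base object. *)
Record sf_comonoid {C : category} (M : monoidal C) (L : C) := SfComonoid {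
  comul : whom M [L] [L; L];
  counit : whom M [L] [];
  cmult : whom M [L; L] [L];
  comulA : (comul ⊗ ⟨L⟩) ∘ comul = (⟨L⟩ ⊗ comul) ∘ comul;
  counitl : (counit ⊗ ⟨L⟩) ∘ comul = ⟨L⟩;
  counitr : (⟨L⟩ ⊗ counit) ∘ comul = ⟨L⟩;
  cmultA : cmult ∘ (cmult ⊗ ⟨L⟩) = cmult ∘ (⟨L⟩ ⊗ cmult);
  cmultK : cmult ∘ comul = ⟨L⟩;
  frobl : (cmult ⊗ ⟨L⟩) ∘ (⟨L⟩ ⊗ comul) = comul ∘ cmult;
  frobr : (⟨L⟩ ⊗ cmult) ∘ (comul ⊗ ⟨L⟩) = comul ∘ cmult }.

Arguments sf_comonoid {C} M L.

Section Bicomodules.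
Variables (C : category) (M : monoidal C) (L : C) (K : sf_comonoid M L).
Let δ : whom M [L] [L; L] := comul K.
Let ε : whom M [L] [] := counit K.
Let μ : whom M [L; L] [L] := cmult K.

Definition left_act (W : C) (τ : whom M [W] [L; W]) : whom M [L; W] [W] :=
  (ε ⊗ ⟨W⟩) ∘ (μ ⊗ ⟨W⟩) ∘ (⟨L⟩ ⊗ τ).

Lemma wid2l X Y v v' (f : whom M v v') :
  wid M [X; Y] ⊗ f = ⟨X⟩ ⊗ (⟨Y⟩ ⊗ f).
Proof. by wunassoc (wid M [X]) (wid M [Y]) f; rewrite wtens1. Qed.

Section LeftAct.
Variables (W : C) (τ : whom M [W] [L; W]).
Hypothesis cA : (δ ⊗ ⟨W⟩) ∘ τ = (⟨L⟩ ⊗ τ) ∘ τ.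
Hypothesis c1 : (ε ⊗ ⟨W⟩) ∘ τ = ⟨W⟩.

Lemma left_actK : left_act τ ∘ τ = ⟨W⟩.
Proof.
rewrite /left_act -!wcompA; cbn [app]; rewrite -cA.
wback (wrM [W] μ δ). wstep (cmultK K). by rewrite wtens1 wcomp1m.
Qed.

Lemma left_act_co1 : τ ∘ left_act τ = (μ ⊗ ⟨W⟩) ∘ (⟨L⟩ ⊗ τ).
Proof.
rewrite /left_act -!wcompA -{1}(wnil_tens τ); cbn [app].
wback (wslide ε τ).
wback (wslide μ τ). rewrite wid2l. wback (wlM [L] (⟨L⟩ ⊗ τ) τ). rewrite -cA.
wstep (wlM [L] (δ ⊗ ⟨W⟩) τ).
wunassoc (wid M [L]) δ (wid M [W]).
rewrite -(wtens1 M [L] [W]); cbn [app].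
wunassoc μ (wid M [L]) (wid M [W]).
wunassoc ε (wid M [L]) (wid M [W]).
wback (wrM [W] (μ ⊗ ⟨L⟩) (⟨L⟩ ⊗ δ)).
wstep (frobl K). wstep (wrM [W] δ μ).
wback (wrM [W] (ε ⊗ ⟨L⟩) δ).
wstep (counitl K). by rewrite wtens1 wcomp1m.
Qed.

Lemma left_act_co : τ ∘ left_act τ = (⟨L⟩ ⊗ left_act τ) ∘ (δ ⊗ ⟨W⟩).
Proof.
rewrite left_act_co1 /left_act -!wcompA; cbn [app].
wstep (wlM [L] (ε ⊗ ⟨W⟩) (μ ⊗ ⟨W⟩ ∘ ⟨L⟩ ⊗ τ)).
wstep (wlM [L] (μ ⊗ ⟨W⟩) (⟨L⟩ ⊗ τ)).
rewrite -wid2l. wback (wslide δ τ).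
rewrite -(wtens1 M [L] [W]); cbn [app].
wunassoc δ (wid M [L]) (wid M [W]).
wunassoc (wid M [L]) μ (wid M [W]).
wback (wrM [W] (⟨L⟩ ⊗ μ) (δ ⊗ ⟨L⟩)). wstep (frobr K).
wstep (wrM [W] δ μ).
wunassoc (wid M [L]) ε (wid M [W]).
wback (wrM [W] (⟨L⟩ ⊗ ε) δ).
wstep (counitr K). by rewrite wtens1 wcomp1m.
Qed.

End LeftAct.

Definition right_act (V : C) (τ : whom M [V] [V; L]) : whom M [V; L] [V] :=
  (⟨V⟩ ⊗ ε) ∘ (⟨V⟩ ⊗ μ) ∘ (τ ⊗ ⟨L⟩).

Section RightAct.
Variables (V : C) (τ : whom M [V] [V; L]).
Hypothesis cA : (⟨V⟩ ⊗ δ) ∘ τ = (τ ⊗ ⟨L⟩) ∘ τ.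
Hypothesis c1 : (⟨V⟩ ⊗ ε) ∘ τ = ⟨V⟩.

Lemma right_actK : right_act τ ∘ τ = ⟨V⟩.
Proof.
rewrite /right_act -!wcompA; cbn [app]; rewrite -cA.
wback (wlM [V] μ δ). wstep (cmultK K). by rewrite wtens1 wcomp1m.
Qed.

Lemma right_act_co1 : τ ∘ right_act τ = (⟨V⟩ ⊗ μ) ∘ (τ ⊗ ⟨L⟩).
Proof.
rewrite /right_act -!wcompA; cbn [app].
have {1}-> : τ = τ ⊗ wid M [] by wnil τ.
wstep (wslide τ ε).
wstep (wslide τ μ). rewrite -(wtens1 M [L] [L]); cbn [app].
wunassoc τ (wid M [L]) (wid M [L]).
wback (wrM [L] (τ ⊗ ⟨L⟩) τ). rewrite -cA.
wstep (wrM [L] (⟨V⟩ ⊗ δ) τ).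
wassoc (wid M [V]) δ (wid M [L]).
rewrite !wid2l.
wback (wlM [V] (⟨L⟩ ⊗ μ) (δ ⊗ ⟨L⟩)).
wstep (frobr K). wstep (wlM [V] δ μ).
wback (wlM [V] (⟨L⟩ ⊗ ε) δ).
wstep (counitr K). by rewrite wtens1 wcomp1m.
Qed.

Lemma right_act_co : τ ∘ right_act τ = (right_act τ ⊗ ⟨L⟩) ∘ (⟨V⟩ ⊗ δ).
Proof.
rewrite right_act_co1 /right_act -!wcompA; cbn [app].
wstep (wrM [L] (⟨V⟩ ⊗ ε) (⟨V⟩ ⊗ μ ∘ τ ⊗ ⟨L⟩)).
wstep (wrM [L] (⟨V⟩ ⊗ μ) (τ ⊗ ⟨L⟩)).
wassoc τ (wid M [L]) (wid M [L]).
rewrite wtens1. wstep (wslide τ δ). rewrite wid2l.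
wassoc (wid M [V]) μ (wid M [L]).
wback (wlM [V] (μ ⊗ ⟨L⟩) (⟨L⟩ ⊗ δ)). wstep (frobl K).
wstep (wlM [V] δ μ).
wassoc (wid M [V]) ε (wid M [L]).
wback (wlM [V] (ε ⊗ ⟨L⟩) δ).
wstep (counitl K). by rewrite wtens1 wcomp1m.
Qed.

End RightAct.

Record is_bicomodule (V : C) (τ : whom M [V] [L; V])
    (τ' : whom M [V] [V; L]) : Prop := IsBicomodule {
  lcoA : (δ ⊗ ⟨V⟩) ∘ τ = (⟨L⟩ ⊗ τ) ∘ τ;
  lco1 : (ε ⊗ ⟨V⟩) ∘ τ = ⟨V⟩;
  rcoA : (⟨V⟩ ⊗ δ) ∘ τ' = (τ' ⊗ ⟨L⟩) ∘ τ';
  rco1 : (⟨V⟩ ⊗ ε) ∘ τ' = ⟨V⟩;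
  lrco : (⟨L⟩ ⊗ τ') ∘ τ = (τ ⊗ ⟨L⟩) ∘ τ' }.

Record bicomodule := Bicomodule {
  bic_ob :> C;
  lco : whom M [bic_ob] [L; bic_ob];
  rco : whom M [bic_ob] [bic_ob; L];
  bicP : is_bicomodule lco rco }.

Definition is_bicomodule_map (V W : C) (τV : whom M [V] [L; V])
    (τV' : whom M [V] [V; L]) (τW : whom M [W] [L; W])
    (τW' : whom M [W] [W; L]) (f : whom M [V] [W]) : Prop :=
  τW ∘ f = (⟨L⟩ ⊗ f) ∘ τV /\ τW' ∘ f = (f ⊗ ⟨L⟩) ∘ τV'.

Record bicomodule_map (V W : bicomodule) := BicomoduleMap {
  bic_map :> whom M [bic_ob V] [bic_ob W];
  bic_mapP : is_bicomodule_map (lco V) (rco V) (lco W) (rco W) bic_map }.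

Lemma bicomodule_map_eq (V W : bicomodule) (f g : bicomodule_map V W) :
  bic_map f = bic_map g -> f = g.
Proof.
case: f g => [f fP] [g gP] /= e; move: gP; rewrite -e => gP.
by rewrite (proof_irrelevance _ fP gP).
Qed.

Lemma bic_mapl (V W : bicomodule) (f : bicomodule_map V W) :
  lco W ∘ f = (⟨L⟩ ⊗ f) ∘ lco V.
Proof. by case: (bic_mapP f). Qed.

Lemma bic_mapr (V W : bicomodule) (f : bicomodule_map V W) :
  rco W ∘ f = (f ⊗ ⟨L⟩) ∘ rco V.
Proof. by case: (bic_mapP f). Qed.

Lemma bicomodule_idP (V : bicomodule) :
  is_bicomodule_map (lco V) (rco V) (lco V) (rco V) ⟨V⟩.
Proof. by split; rewrite wtens1 wcompm1 wcomp1m. Qed.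

Lemma bicomodule_compP (V W Z : bicomodule) (g : bicomodule_map W Z)
    (f : bicomodule_map V W) :
  is_bicomodule_map (lco V) (rco V) (lco Z) (rco Z) (g ∘ f).
Proof.
split.
  rewrite wcompA bic_mapl -wcompA bic_mapl.
  by rewrite (wlM [L] g f) wcompA.
rewrite wcompA bic_mapr -wcompA bic_mapr.
by rewrite (wrM [L] g f) wcompA.
Qed.

Definition bicomodule_id V := BicomoduleMap (bicomodule_idP V).
Definition bicomodule_comp V W Z (g : bicomodule_map W Z)
    (f : bicomodule_map V W) := BicomoduleMap (bicomodule_compP g f).

Definition bicomodule_cat : category.
Proof.
refine (@Category bicomodule bicomodule_map bicomodule_id bicomodule_comp
  _ _ _).
- by move=> V W f; apply: bicomodule_map_eq; apply: wcomp1m.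
- by move=> V W f; apply: bicomodule_map_eq; apply: wcompm1.
- by move=> V W Z X h g f; apply: bicomodule_map_eq; apply: wcompA.
Defined.

(* The idempotent s on VW whose splitting is the product of bicomodules; this
   splitting is the cotensor product over L. *)
Definition cot_idem (V W : bicomodule) : whom M [bic_ob V; bic_ob W] [bic_ob V; bic_ob W] :=
  (⟨V⟩ ⊗ ε ⊗ ⟨W⟩) ∘ (⟨V⟩ ⊗ μ ⊗ ⟨W⟩) ∘ (rco V ⊗ lco W).

Notation a W := (left_act (lco W)).
Notation b W := (right_act (rco W)).
Notation s := cot_idem.

Lemma cot_idem_l (V W : bicomodule) : s V W = (⟨V⟩ ⊗ a W) ∘ (rco V ⊗ ⟨W⟩).
Proof.
rewrite /s /left_act -!wcompA; cbn [app].
wstep (wlM [bic_ob V] (ε ⊗ ⟨W⟩) (μ ⊗ ⟨W⟩ ∘ ⟨L⟩ ⊗ lco W)).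
wstep (wlM [bic_ob V] (μ ⊗ ⟨W⟩) (⟨L⟩ ⊗ lco W)).
by rewrite -wid2l; wback (wtensR (rco V) (lco W)).
Qed.

Lemma cot_idem_r (V W : bicomodule) : s V W = (b V ⊗ ⟨W⟩) ∘ (⟨V⟩ ⊗ lco W).
Proof.
rewrite /s /right_act -!wcompA; cbn [app].
wstep (wrM [bic_ob W] (⟨V⟩ ⊗ ε) (⟨V⟩ ⊗ μ ∘ rco V ⊗ ⟨L⟩)).
wstep (wrM [bic_ob W] (⟨V⟩ ⊗ μ) (rco V ⊗ ⟨L⟩)).
wassoc (wid M [bic_ob V]) ε (wid M [bic_ob W]).
wassoc (wid M [bic_ob V]) μ (wid M [bic_ob W]).
wassoc (rco V) (wid M [L]) (wid M [bic_ob W]). rewrite wtens1.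
by wback (wtensL (rco V) (lco W)).
Qed.

Lemma cot_idem_lco (V W : bicomodule) : (⟨V⟩ ⊗ lco W) ∘ s V W = (rco V ⊗ ⟨W⟩) ∘ s V W.
Proof.
rewrite cot_idem_l; cbn [app].
have [A1 c1 _ _ _] := bicP W; have [_ _ A2 _ _] := bicP V.
wback (wlM [bic_ob V] (lco W) (a W)). rewrite (left_act_co A1); cbn [app].
wstep (wlM [bic_ob V] (⟨L⟩ ⊗ a W) (δ ⊗ ⟨W⟩)).
wunassoc (wid M [bic_ob V]) δ (wid M [bic_ob W]).
wback (wrM [bic_ob W] (⟨V⟩ ⊗ δ) (rco V)). rewrite A2; cbn [app].
wstep (wrM [bic_ob W] (rco V ⊗ ⟨L⟩) (rco V)).
wassoc (rco V) (wid M [L]) (wid M [bic_ob W]). rewrite wtens1 -wid2l.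
by wback (wslide (rco V) (a W)).
Qed.

Lemma cot_idemK (V W : bicomodule) : s V W ∘ s V W = s V W.
Proof.
have [A1 c1 _ _ _] := bicP W.
rewrite {1}cot_idem_l -wcompA -cot_idem_lco wcompA.
wback (wlM [bic_ob V] (a W) (lco W)).
by rewrite (left_actK A1 c1) wtens1 wcomp1m.
Qed.

Lemma cot_idem_lcoV (V W : bicomodule) :
  (lco V ⊗ ⟨W⟩) ∘ s V W = (⟨L⟩ ⊗ s V W) ∘ (lco V ⊗ ⟨W⟩).
Proof.
have [_ _ _ _ E] := bicP V.
rewrite cot_idem_l; cbn [app].
wstep (wslide (lco V) (a W)). rewrite wid2l.
rewrite -(wtens1 M [L] [bic_ob W]); cbn [app].
wunassoc (lco V) (wid M [L]) (wid M [bic_ob W]).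
wback (wrM [bic_ob W] (lco V ⊗ ⟨L⟩) (rco V)). rewrite -E; cbn [app].
wstep (wrM [bic_ob W] (⟨L⟩ ⊗ rco V) (lco V)).
wassoc (wid M [L]) (rco V) (wid M [bic_ob W]).
by wback (wlM [L] (⟨V⟩ ⊗ a W) (rco V ⊗ ⟨W⟩)).
Qed.

Lemma cot_idem_rcoW (V W : bicomodule) :
  (⟨V⟩ ⊗ rco W) ∘ s V W = (s V W ⊗ ⟨L⟩) ∘ (⟨V⟩ ⊗ rco W).
Proof.
have [_ _ _ _ E] := bicP W.
rewrite cot_idem_r; cbn [app].
wback (wslide (b V) (rco W)). rewrite wid2l.
wback (wlM [bic_ob V] (⟨L⟩ ⊗ rco W) (lco W)). rewrite E; cbn [app].
wstep (wlM [bic_ob V] (lco W ⊗ ⟨L⟩) (rco W)).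
wunassoc (wid M [bic_ob V]) (lco W) (wid M [L]).
rewrite -(wtens1 M [bic_ob W] [L]); cbn [app].
wunassoc (b V) (wid M [bic_ob W]) (wid M [L]).
by wback (wrM [L] (b V ⊗ ⟨W⟩) (⟨V⟩ ⊗ lco W)).
Qed.

Lemma left_act_nat (W W' : bicomodule) (g : bicomodule_map W W') :
  a W' ∘ (⟨L⟩ ⊗ g) = g ∘ a W.
Proof.
rewrite /left_act -!wcompA; cbn [app].
wback (wlM [L] (lco W') g). rewrite bic_mapl; cbn [app].
wstep (wlM [L] (⟨L⟩ ⊗ g) (lco W)). rewrite -wid2l.
wstep (wslide μ g). wstep (wslide ε g). by rewrite wnil_tens.
Qed.

Lemma cot_idem_nat (V V' W W' : bicomodule) (f : bicomodule_map V V')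
    (g : bicomodule_map W W') :
  s V' W' ∘ (f ⊗ g) = (f ⊗ g) ∘ s V W.
Proof.
rewrite !cot_idem_l -!wcompA; cbn [app].
wback (wtensM (rco V') f (wid M [bic_ob W']) g).
rewrite wcomp1m bic_mapr -{1}(wcompm1 g); cbn [app].
wstep (wtensM (f ⊗ ⟨L⟩) (rco V) g ⟨W⟩).
wassoc (bic_map f) (wid M [L]) (bic_map g).
wback (wtensM ⟨V'⟩ f (a W') (⟨L⟩ ⊗ g)).
rewrite wcomp1m left_act_nat -{1}(wcompm1 f).
by wstep (wtensM f ⟨V⟩ g (a W)).
Qed.

Variable split : idempotent_splitting C.

Section Cot.
Variables V W : bicomodule.

Let S : splitting (C := C) (s V W) := split (cot_idemK V W).

Definition cot_ob : C := split_ob S.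
Definition cot_in : whom M [cot_ob] [bic_ob V; bic_ob W] := split_in S.
Definition cot_out : whom M [bic_ob V; bic_ob W] [cot_ob] := split_out S.

Lemma cot_in_out : cot_in ∘ cot_out = s V W.
Proof. exact: split_in_out. Qed.

Lemma cot_out_in : cot_out ∘ cot_in = ⟨cot_ob⟩.
Proof. exact: split_out_in. Qed.

Lemma cot_idem_in : s V W ∘ cot_in = cot_in.
Proof. by rewrite -cot_in_out -wcompA cot_out_in wcompm1. Qed.

Lemma cot_out_idem : cot_out ∘ s V W = cot_out.
Proof. by rewrite -cot_in_out wcompA cot_out_in wcomp1m. Qed.

Lemma cot_in_mono u (f g : whom M u [cot_ob]) :
  cot_in ∘ f = cot_in ∘ g -> f = g.
Proof. by move=> e; rewrite -(wcomp1m f) -(wcomp1m g) -cot_out_in -!wcompA e. Qed.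

Definition cot_lco : whom M [cot_ob] [L; cot_ob] :=
  (⟨L⟩ ⊗ cot_out) ∘ (lco V ⊗ ⟨W⟩) ∘ cot_in.

Definition cot_rco : whom M [cot_ob] [cot_ob; L] :=
  (cot_out ⊗ ⟨L⟩) ∘ (⟨V⟩ ⊗ rco W) ∘ cot_in.

Lemma cot_in_lco : (⟨L⟩ ⊗ cot_in) ∘ cot_lco = (lco V ⊗ ⟨W⟩) ∘ cot_in.
Proof.
rewrite /cot_lco -!wcompA; cbn [app].
wback (wlM [L] cot_in cot_out). rewrite cot_in_out.
by wback (cot_idem_lcoV V W); rewrite cot_idem_in.
Qed.

Lemma cot_in_rco : (cot_in ⊗ ⟨L⟩) ∘ cot_rco = (⟨V⟩ ⊗ rco W) ∘ cot_in.
Proof.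
rewrite /cot_rco -!wcompA; cbn [app].
wback (wrM [L] cot_in cot_out). rewrite cot_in_out.
by wback (cot_idem_rcoW V W); rewrite cot_idem_in.
Qed.

Lemma wl_cot_in_mono x u v (f g : whom M u (x ++ [cot_ob] ++ v)) :
  (wid M x ⊗ cot_in ⊗ wid M v) ∘ f = (wid M x ⊗ cot_in ⊗ wid M v) ∘ g ->
  f = g.
Proof.
have E : (wid M x ⊗ cot_out ⊗ wid M v) ∘ (wid M x ⊗ cot_in ⊗ wid M v) = wid M _.
  by rewrite -wlM -wrM cot_out_in !wtens1.
by move=> e; rewrite -(wcomp1m f) -(wcomp1m g) -E -!wcompA e.
Qed.

Lemma cotP : is_bicomodule cot_lco cot_rco.
Proof.
have [A1 c1 A2 c2 E] := bicP V; have [A1' c1' A2' c2' E'] := bicP W.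
split.
- apply: (@wl_cot_in_mono [L; L] _ []); cbn [app].
  wnil cot_in.
  wback (wslide δ cot_in). rewrite cot_in_lco; cbn [app].
  rewrite wid2l. wback (wlM [L] (⟨L⟩ ⊗ cot_in) cot_lco).
  rewrite cot_in_lco; cbn [app].
  wstep (wlM [L] (lco V ⊗ ⟨W⟩) cot_in). wstep cot_in_lco.
  rewrite -(wtens1 M [bic_ob V] [bic_ob W]); cbn [app].
  wunassoc δ (wid M [bic_ob V]) (wid M [bic_ob W]).
  wback (wrM [bic_ob W] (δ ⊗ ⟨V⟩) (lco V)). rewrite A1; cbn [app].
  wstep (wrM [bic_ob W] (⟨L⟩ ⊗ lco V) (lco V)).
  by wassoc (wid M [L]) (lco V) (wid M [bic_ob W]).
- apply: cot_in_mono; rewrite wcompm1 -{1}(wnil_tens cot_in).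
  wback (wslide ε cot_in). rewrite cot_in_lco; cbn [app].
  rewrite -(wtens1 M [bic_ob V] [bic_ob W]); cbn [app].
  wunassoc ε (wid M [bic_ob V]) (wid M [bic_ob W]).
  wback (wrM [bic_ob W] (ε ⊗ ⟨V⟩) (lco V)). rewrite c1.
  by rewrite wtens1 wcomp1m.
- apply: (@wl_cot_in_mono [] _ [L; L]); cbn [app].
  rewrite !wnil_tens.
  wstep (wslide cot_in δ). rewrite cot_in_rco; cbn [app].
  rewrite -(wtens1 M [L] [L]); cbn [app].
  wunassoc cot_in (wid M [L]) (wid M [L]).
  wback (wrM [L] (cot_in ⊗ ⟨L⟩) cot_rco).
  rewrite cot_in_rco; cbn [app].
  wstep (wrM [L] (⟨V⟩ ⊗ rco W) cot_in). wstep cot_in_rco.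
  rewrite wid2l.
  wback (wlM [bic_ob V] (⟨W⟩ ⊗ δ) (rco W)). rewrite A2'; cbn [app].
  wstep (wlM [bic_ob V] (rco W ⊗ ⟨L⟩) (rco W)).
  by wassoc (wid M [bic_ob V]) (rco W) (wid M [L]).
- apply: cot_in_mono; rewrite wcompm1.
  have {1}-> : cot_in = cot_in ⊗ wid M [] by wnil cot_in.
  wstep (wslide cot_in ε). rewrite cot_in_rco; cbn [app]. rewrite wid2l.
  wback (wlM [bic_ob V] (⟨W⟩ ⊗ ε) (rco W)). rewrite c2'.
  by rewrite wtens1 wcomp1m.
- apply: (@wl_cot_in_mono [L] _ [L]); cbn [app].
  wback (wlM [L] (cot_in ⊗ ⟨L⟩) cot_rco). rewrite cot_in_rco; cbn [app].
  wstep (wlM [L] (⟨V⟩ ⊗ rco W) cot_in). rewrite cot_in_lco; cbn [app].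
  wunassoc (wid M [L]) cot_in (wid M [L]).
  wback (wrM [L] (⟨L⟩ ⊗ cot_in) cot_lco). rewrite cot_in_lco; cbn [app].
  wstep (wrM [L] (lco V ⊗ ⟨W⟩) cot_in). rewrite cot_in_rco; cbn [app].
  rewrite -wid2l. wback (wslide (lco V) (rco W)).
  by wassoc (lco V) (wid M [bic_ob W]) (wid M [L]); rewrite wtens1.
Qed.

Definition cot : bicomodule := Bicomodule cotP.

End Cot.

Section CotMap.
Variables (V V' W W' : bicomodule).
Variables (f : bicomodule_map V V') (g : bicomodule_map W W').

Definition cotm : whom M [cot_ob V W] [cot_ob V' W'] :=
  cot_out V' W' ∘ (f ⊗ g) ∘ cot_in V W.

Lemma cot_in_cotm : cot_in V' W' ∘ cotm = (f ⊗ g) ∘ cot_in V W.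
Proof.
rewrite /cotm; wnorm. wstep (cot_in_out V' W'). wstep (cot_idem_nat f g).
by rewrite cot_idem_in.
Qed.

Lemma cotmP :
  is_bicomodule_map (cot_lco V W) (cot_rco V W) (cot_lco V' W')
    (cot_rco V' W') cotm.
Proof.
split.
  apply: (@wl_cot_in_mono _ _ [L] _ []); cbn [app]; wnil (cot_in V' W').
  wnorm.
  wstep (cot_in_lco V' W'). rewrite cot_in_cotm; cbn [app].
  wback (wlM [L] (cot_in V' W') cotm). rewrite cot_in_cotm; cbn [app].
  wstep (wlM [L] (f ⊗ g) (cot_in V W)). rewrite cot_in_lco; cbn [app].
  wback (wtensM (lco V') f ⟨W'⟩ g). rewrite bic_mapl wcomp1m; cbn [app].
  rewrite -{1}(wcompm1 g). wstep (wtensM (⟨L⟩ ⊗ f) (lco V) g ⟨W⟩).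
  by wassoc (wid M [L]) (bic_map f) (bic_map g).
apply: (@wl_cot_in_mono _ _ [] _ [L]); cbn [app]; rewrite !wnil_tens.
wnorm.
wstep (cot_in_rco V' W'). rewrite cot_in_cotm; cbn [app].
wback (wrM [L] (cot_in V' W') cotm). rewrite cot_in_cotm; cbn [app].
wstep (wrM [L] (f ⊗ g) (cot_in V W)). rewrite cot_in_rco; cbn [app].
wback (wtensM ⟨V'⟩ f (rco W') g). rewrite bic_mapr wcomp1m; cbn [app].
rewrite -{1}(wcompm1 f). wstep (wtensM f ⟨V⟩ (g ⊗ ⟨L⟩) (rco W)).
by wassoc (bic_map f) (bic_map g) (wid M [L]).
Qed.

Definition cot_map : bicomodule_map (cot V W) (cot V' W') :=
  @BicomoduleMap (cot V W) (cot V' W') cotm cotmP.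

End CotMap.

Lemma unitP : is_bicomodule δ δ.
Proof.
split; [exact: comulA | exact: counitl | | exact: counitr |];
by rewrite [RHS](comulA K).
Qed.

Definition bic_unit : bicomodule := Bicomodule unitP.

Section Unitors.
Variable W : bicomodule.

Definition cot_lun : whom M [cot_ob bic_unit W] [bic_ob W] :=
  (ε ⊗ ⟨W⟩) ∘ cot_in bic_unit W.
Definition cot_lunV : whom M [bic_ob W] [cot_ob bic_unit W] :=
  cot_out bic_unit W ∘ lco W.
Definition cot_run : whom M [cot_ob W bic_unit] [bic_ob W] :=
  (⟨W⟩ ⊗ ε) ∘ cot_in W bic_unit.
Definition cot_runV : whom M [bic_ob W] [cot_ob W bic_unit] :=
  cot_out W bic_unit ∘ rco W.

Lemma lco_cot_lun : lco W ∘ cot_lun = cot_in bic_unit W.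
Proof.
rewrite /cot_lun -{1}(wnil_tens (lco W)); cbn [app].
wback (wslide ε (lco W)).
rewrite -(cot_idem_in bic_unit W). wstep (cot_idem_lco bic_unit W).
rewrite -(wtens1 M [L] [bic_ob W]); cbn [app].
wunassoc ε (wid M [L]) (wid M [bic_ob W]).
wback (wrM [bic_ob W] (ε ⊗ ⟨L⟩) δ). wstep (counitl K).
by rewrite wtens1 wcomp1m.
Qed.

Lemma rco_cot_run : rco W ∘ cot_run = cot_in W bic_unit.
Proof.
rewrite /cot_run; cbn [app].
have {1}-> : rco W = rco W ⊗ wid M [] by wnil (rco W).
wstep (wslide (rco W) ε). rewrite wid2l.
rewrite -(cot_idem_in W bic_unit). wback (cot_idem_lco W bic_unit).
wback (wlM [bic_ob W] (⟨L⟩ ⊗ ε) δ). wstep (counitr K).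
by rewrite wtens1 wcomp1m.
Qed.

Lemma cot_idem_unitl : s bic_unit W ∘ lco W = lco W.
Proof.
have [A1 c1 _ _ _] := bicP W.
rewrite cot_idem_l; wnorm. wstep A1.
wback (wlM [L] (a W) (lco W)). rewrite (left_actK A1 c1).
by rewrite wtens1 wcomp1m.
Qed.

Lemma cot_idem_unitr : s W bic_unit ∘ rco W = rco W.
Proof.
have [_ _ A1 c1 _] := bicP W.
rewrite cot_idem_r; wnorm. wstep A1.
wback (wrM [L] (b W) (rco W)). rewrite (right_actK A1 c1).
by rewrite wtens1 wcomp1m.
Qed.

Lemma cot_lunK : cot_lunV ∘ cot_lun = wid M _.
Proof. by rewrite /cot_lunV -wcompA lco_cot_lun cot_out_in. Qed.

Lemma cot_lunVK : cot_lun ∘ cot_lunV = wid M _.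
Proof.
rewrite /cot_lun /cot_lunV; wnorm; cbn [app].
wstep (cot_in_out bic_unit W). rewrite cot_idem_unitl.
exact: lco1 (bicP W).
Qed.

Lemma cot_runK : cot_runV ∘ cot_run = wid M _.
Proof. by rewrite /cot_runV -wcompA rco_cot_run cot_out_in. Qed.

Lemma cot_runVK : cot_run ∘ cot_runV = wid M _.
Proof.
rewrite /cot_run /cot_runV; wnorm; cbn [app].
wstep (cot_in_out W bic_unit). rewrite cot_idem_unitr.
exact: rco1 (bicP W).
Qed.

Lemma cot_lunP :
  is_bicomodule_map (cot_lco bic_unit W) (cot_rco bic_unit W) (lco W) (rco W)
    cot_lun.
Proof.
split.
  rewrite lco_cot_lun /cot_lun; cbn [app].
  wstep (wlM [L] (ε ⊗ ⟨W⟩) (cot_in bic_unit W)).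
  wstep (cot_in_lco bic_unit W).
  wunassoc (wid M [L]) ε (wid M [bic_ob W]).
  wback (wrM [bic_ob W] (⟨L⟩ ⊗ ε) δ). wstep (counitr K).
  by rewrite wtens1 wcomp1m.
rewrite /cot_lun -{1}(wnil_tens (rco W)); cbn [app].
wback (wslide ε (rco W)).
wstep (wrM [L] (ε ⊗ ⟨W⟩) (cot_in bic_unit W)).
wstep (cot_in_rco bic_unit W).
by wassoc ε (wid M [bic_ob W]) (wid M [L]); rewrite wtens1.
Qed.

Lemma cot_runP :
  is_bicomodule_map (cot_lco W bic_unit) (cot_rco W bic_unit) (lco W) (rco W)
    cot_run.
Proof.
split.
  rewrite /cot_run; cbn [app].
  have {1}-> : lco W = lco W ⊗ wid M [] by wnil (lco W).
  wstep (wslide (lco W) ε). rewrite wid2l.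
  wstep (wlM [L] (⟨W⟩ ⊗ ε) (cot_in W bic_unit)).
  by wstep (cot_in_lco W bic_unit).
rewrite rco_cot_run /cot_run; cbn [app].
wstep (wrM [L] (⟨W⟩ ⊗ ε) (cot_in W bic_unit)).
wstep (cot_in_rco W bic_unit).
wassoc (wid M [bic_ob W]) ε (wid M [L]).
wback (wlM [bic_ob W] (ε ⊗ ⟨L⟩) δ). wstep (counitl K).
by rewrite wtens1 wcomp1m.
Qed.

Definition bic_lun : bicomodule_map (cot bic_unit W) W :=
  @BicomoduleMap (cot bic_unit W) W cot_lun cot_lunP.
Definition bic_run : bicomodule_map (cot W bic_unit) W :=
  @BicomoduleMap (cot W bic_unit) W cot_run cot_runP.

End Unitors.

Lemma bicomodule_inv (V W : bicomodule) (f : bicomodule_map V W)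
    (g : whom M [bic_ob W] [bic_ob V]) :
  g ∘ f = wid M _ -> f ∘ g = wid M _ ->
  is_bicomodule_map (lco W) (rco W) (lco V) (rco V) g.
Proof.
move=> gK fK; split.
  rewrite -[LHS]wcomp1m -{1}(wtens1 M [L] [bic_ob V]) -gK; cbn [app].
  wstep (wlM [L] g f). wback (bic_mapl f). by rewrite fK wcompm1.
rewrite -[LHS]wcomp1m -{1}(wtens1 M [bic_ob V] [L]) -gK; cbn [app].
wstep (wrM [L] g f). wback (bic_mapr f). by rewrite fK wcompm1.
Qed.

Definition bic_lunV (W : bicomodule) : bicomodule_map W (cot bic_unit W) :=
  BicomoduleMap (bicomodule_inv (f := bic_lun W) (cot_lunK W) (cot_lunVK W)).
Definition bic_runV (W : bicomodule) : bicomodule_map W (cot W bic_unit) :=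
  BicomoduleMap (bicomodule_inv (f := bic_run W) (cot_runK W) (cot_runVK W)).

Section Associator.
Variables V W Z : bicomodule.

Definition cot3_inl :
    whom M [cot_ob (cot V W) Z] [bic_ob V; bic_ob W; bic_ob Z] :=
  (cot_in V W ⊗ ⟨Z⟩) ∘ cot_in (cot V W) Z.
Definition cot3_inr :
    whom M [cot_ob V (cot W Z)] [bic_ob V; bic_ob W; bic_ob Z] :=
  (⟨V⟩ ⊗ cot_in W Z) ∘ cot_in V (cot W Z).

Definition cot_assoc :
    whom M [cot_ob (cot V W) Z] [cot_ob V (cot W Z)] :=
  cot_out V (cot W Z) ∘ (⟨V⟩ ⊗ cot_out W Z) ∘ cot3_inl.
Definition cot_assocV :
    whom M [cot_ob V (cot W Z)] [cot_ob (cot V W) Z] :=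
  cot_out (cot V W) Z ∘ (cot_out V W ⊗ ⟨Z⟩) ∘ cot3_inr.

Lemma cot3_inl_mono u (f g : whom M u [cot_ob (cot V W) Z]) :
  cot3_inl ∘ f = cot3_inl ∘ g -> f = g.
Proof.
rewrite /cot3_inl; wnorm => e; apply: cot_in_mono.
apply: (@wl_cot_in_mono V W [] _ [bic_ob Z]); cbn [app].
by rewrite !wnil_tens.
Qed.

Lemma cot3_inr_mono u (f g : whom M u [cot_ob V (cot W Z)]) :
  cot3_inr ∘ f = cot3_inr ∘ g -> f = g.
Proof.
rewrite /cot3_inr; wnorm => e; apply: cot_in_mono.
apply: (@wl_cot_in_mono W Z [bic_ob V] _ []); cbn [app].
by wnil (cot_in W Z).
Qed.

Lemma cot_in_idem_l :
  (cot_in V W ⊗ ⟨Z⟩) ∘ s (cot V W) Z = (⟨V⟩ ⊗ s W Z) ∘ (cot_in V W ⊗ ⟨Z⟩).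
Proof.
rewrite !cot_idem_l; cbn [app].
wstep (wslide (cot_in V W) (a Z)).
rewrite -(wtens1 M [L] [bic_ob Z]); cbn [app].
wunassoc (cot_in V W) (wid M [L]) (wid M [bic_ob Z]).
wback (wrM [bic_ob Z] (cot_in V W ⊗ ⟨L⟩) (rco (cot V W))).
rewrite cot_in_rco; cbn [app].
wstep (wrM [bic_ob Z] (⟨V⟩ ⊗ rco W) (cot_in V W)).
wassoc (wid M [bic_ob V]) (rco W) (wid M [bic_ob Z]).
rewrite wid2l.
by wback (wlM [bic_ob V] (⟨W⟩ ⊗ a Z) (rco W ⊗ ⟨Z⟩)).
Qed.

Lemma cot_in_idem_r :
  (⟨V⟩ ⊗ cot_in W Z) ∘ s V (cot W Z) = (s V W ⊗ ⟨Z⟩) ∘ (⟨V⟩ ⊗ cot_in W Z).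
Proof.
rewrite !cot_idem_r; cbn [app].
wback (wslide (b V) (cot_in W Z)).
rewrite wid2l.
wback (wlM [bic_ob V] (⟨L⟩ ⊗ cot_in W Z) (lco (cot W Z))).
rewrite cot_in_lco; cbn [app].
wstep (wlM [bic_ob V] (lco W ⊗ ⟨Z⟩) (cot_in W Z)).
wunassoc (wid M [bic_ob V]) (lco W) (wid M [bic_ob Z]).
rewrite -(wtens1 M [bic_ob W] [bic_ob Z]); cbn [app].
wunassoc (b V) (wid M [bic_ob W]) (wid M [bic_ob Z]).
by wback (wrM [bic_ob Z] (b V ⊗ ⟨W⟩) (⟨V⟩ ⊗ lco W)).
Qed.

Lemma cot3_in_assoc : cot3_inr ∘ cot_assoc = cot3_inl.
Proof.
rewrite /cot_assoc /cot3_inr; wnorm; cbn [app].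
wstep (cot_in_out V (cot W Z)). wstep cot_in_idem_r.
wback (wlM [bic_ob V] (cot_in W Z) (cot_out W Z)). rewrite cot_in_out.
rewrite /cot3_inl. wback cot_in_idem_l. rewrite cot_idem_in.
wback (wrM [bic_ob Z] (s V W) (cot_in V W)).
by rewrite cot_idem_in.
Qed.

Lemma cot3_in_assocE :
  (⟨V⟩ ⊗ cot_in W Z) ∘ (cot_in V (cot W Z) ∘ cot_assoc)
  = (cot_in V W ⊗ ⟨Z⟩) ∘ cot_in (cot V W) Z.
Proof. by rewrite wcompA; exact: cot3_in_assoc. Qed.

Lemma cot3_in_assocV : cot3_inl ∘ cot_assocV = cot3_inr.
Proof.
rewrite /cot_assocV /cot3_inl; wnorm; cbn [app].
wstep (cot_in_out (cot V W) Z). wstep cot_in_idem_l.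
wback (wrM [bic_ob Z] (cot_in V W) (cot_out V W)). rewrite cot_in_out.
rewrite /cot3_inr. wback cot_in_idem_r. rewrite cot_idem_in.
wback (wlM [bic_ob V] (s W Z) (cot_in W Z)).
by rewrite cot_idem_in.
Qed.

Lemma cot_assocK : cot_assocV ∘ cot_assoc = wid M _.
Proof.
apply: cot3_inl_mono.
by rewrite wcompm1 wcompA cot3_in_assocV cot3_in_assoc.
Qed.

Lemma cot_assocVK : cot_assoc ∘ cot_assocV = wid M _.
Proof.
apply: cot3_inr_mono.
by rewrite wcompm1 wcompA cot3_in_assoc cot3_in_assocV.
Qed.

Lemma wl_cot3_inr_mono x u v (f g : whom M u (x ++ [cot_ob V (cot W Z)] ++ v)) :
  (wid M x ⊗ cot3_inr ⊗ wid M v) ∘ f = (wid M x ⊗ cot3_inr ⊗ wid M v) ∘ g ->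
  f = g.
Proof.
have E0 : (cot_out V (cot W Z) ∘ (⟨V⟩ ⊗ cot_out W Z)) ∘ cot3_inr = wid M _.
  rewrite /cot3_inr; wnorm. wback (wlM [bic_ob V] (cot_out W Z) (cot_in W Z)).
  by rewrite cot_out_in wtens1 wcomp1m cot_out_in.
have E : (wid M x ⊗ (cot_out V (cot W Z) ∘ (⟨V⟩ ⊗ cot_out W Z)) ⊗ wid M v)
   ∘ (wid M x ⊗ cot3_inr ⊗ wid M v) = wid M _.
  by rewrite -wlM -wrM E0 !wtens1.
by move=> e; rewrite -(wcomp1m f) -(wcomp1m g) -E -!wcompA e.
Qed.

Lemma cot3_inl_lco :
  (⟨L⟩ ⊗ cot3_inl) ∘ cot_lco (cot V W) Z
  = (lco V ⊗ wid M [bic_ob W; bic_ob Z]) ∘ cot3_inl.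
Proof.
rewrite /cot3_inl; cbn [app].
wstep (wlM [L] (cot_in V W ⊗ ⟨Z⟩) (cot_in (cot V W) Z)).
wstep (cot_in_lco (cot V W) Z).
wunassoc (wid M [L]) (cot_in V W) (wid M [bic_ob Z]).
wback (wrM [bic_ob Z] (⟨L⟩ ⊗ cot_in V W) (lco (cot V W))).
rewrite cot_in_lco; cbn [app].
wstep (wrM [bic_ob Z] (lco V ⊗ ⟨W⟩) (cot_in V W)).
by wassoc (lco V) (wid M [bic_ob W]) (wid M [bic_ob Z]); rewrite wtens1.
Qed.

Lemma cot3_inr_lco :
  (⟨L⟩ ⊗ cot3_inr) ∘ cot_lco V (cot W Z)
  = (lco V ⊗ wid M [bic_ob W; bic_ob Z]) ∘ cot3_inr.
Proof.
rewrite /cot3_inr; cbn [app].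
wstep (wlM [L] (⟨V⟩ ⊗ cot_in W Z) (cot_in V (cot W Z))).
wstep (cot_in_lco V (cot W Z)).
rewrite -wid2l.
by wback (wslide (lco V) (cot_in W Z)).
Qed.

Lemma cot3_inl_rco :
  (cot3_inl ⊗ ⟨L⟩) ∘ cot_rco (cot V W) Z
  = (wid M [bic_ob V; bic_ob W] ⊗ rco Z) ∘ cot3_inl.
Proof.
rewrite /cot3_inl; cbn [app].
wstep (wrM [L] (cot_in V W ⊗ ⟨Z⟩) (cot_in (cot V W) Z)).
wstep (cot_in_rco (cot V W) Z).
wassoc (cot_in V W) (wid M [bic_ob Z]) (wid M [L]). rewrite wtens1.
by wstep (wslide (cot_in V W) (rco Z)).
Qed.

Lemma cot3_inr_rco :
  (cot3_inr ⊗ ⟨L⟩) ∘ cot_rco V (cot W Z)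
  = (wid M [bic_ob V; bic_ob W] ⊗ rco Z) ∘ cot3_inr.
Proof.
rewrite /cot3_inr; cbn [app].
wstep (wrM [L] (⟨V⟩ ⊗ cot_in W Z) (cot_in V (cot W Z))).
wstep (cot_in_rco V (cot W Z)).
wassoc (wid M [bic_ob V]) (cot_in W Z) (wid M [L]).
wback (wlM [bic_ob V] (cot_in W Z ⊗ ⟨L⟩) (rco (cot W Z))).
rewrite cot_in_rco; cbn [app].
wstep (wlM [bic_ob V] (⟨W⟩ ⊗ rco Z) (cot_in W Z)).
by rewrite wid2l.
Qed.

Lemma cot_assocP :
  is_bicomodule_map (cot_lco (cot V W) Z) (cot_rco (cot V W) Z)
    (cot_lco V (cot W Z)) (cot_rco V (cot W Z)) cot_assoc.
Proof.
split.
  apply: (@wl_cot3_inr_mono [L] _ []); cbn [app]; wnil cot3_inr.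
  wstep cot3_inr_lco. rewrite cot3_in_assoc.
  wback (wlM [L] cot3_inr cot_assoc).
  by rewrite cot3_in_assoc cot3_inl_lco.
apply: (@wl_cot3_inr_mono [] _ [L]); cbn [app]; rewrite !wnil_tens.
wstep cot3_inr_rco. rewrite cot3_in_assoc.
wback (wrM [L] cot3_inr cot_assoc).
by rewrite cot3_in_assoc cot3_inl_rco.
Qed.

Definition bic_assoc : bicomodule_map (cot (cot V W) Z) (cot V (cot W Z)) :=
  @BicomoduleMap (cot (cot V W) Z) (cot V (cot W Z)) cot_assoc cot_assocP.
Definition bic_assocV : bicomodule_map (cot V (cot W Z)) (cot (cot V W) Z) :=
  BicomoduleMap (bicomodule_inv (f := bic_assoc) cot_assocK cot_assocVK).

End Associator.

Definition bicomodule_monoidal : monoidal bicomodule_cat.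
Proof.
refine (@Monoidal bicomodule_cat cot cot_map bic_unit bic_assoc bic_assocV
  bic_lun bic_lunV bic_run bic_runV _ _ _ _ _ _ _ _ _ _ _ _ _).
- move=> V W; apply: bicomodule_map_eq; apply: (@cot_in_mono V W).
  change (cot_in V W ∘ cotm (bicomodule_id V) (bicomodule_id W)
    = cot_in V W ∘ wid M _).
  by rewrite cot_in_cotm wcompm1 wtens1 wcomp1m.
- move=> V V' V'' W W' W'' f' f g' g; apply: bicomodule_map_eq.
  apply: (@cot_in_mono V'' W'').
  change (cot_in V'' W'' ∘ cotm (bicomodule_comp f' f) (bicomodule_comp g' g)
    = cot_in V'' W'' ∘ (cotm f' g' ∘ cotm f g)).
  rewrite cot_in_cotm; wstep (cot_in_cotm f' g'). rewrite cot_in_cotm.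
  cbn [bic_map bicomodule_comp].
  by wstep (wtensM (bic_map f') (bic_map f) (bic_map g') (bic_map g)).
- by move=> V W Z; apply: bicomodule_map_eq; apply: cot_assocK.
- by move=> V W Z; apply: bicomodule_map_eq; apply: cot_assocVK.
- by move=> V; apply: bicomodule_map_eq; apply: cot_lunK.
- by move=> V; apply: bicomodule_map_eq; apply: cot_lunVK.
- by move=> V; apply: bicomodule_map_eq; apply: cot_runK.
- by move=> V; apply: bicomodule_map_eq; apply: cot_runVK.
- move=> V V' W W' Z Z' f g h; apply: bicomodule_map_eq.
  apply: (@cot3_inr_mono V' W' Z').
  change (cot3_inr V' W' Z' ∘ (cot_assoc V' W' Z' ∘ cotm (cot_map f g) h)
    = cot3_inr V' W' Z' ∘ (cotm f (cot_map g h) ∘ cot_assoc V W Z)).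
  wstep (cot3_in_assoc V' W' Z'). rewrite /cot3_inl /cot3_inr; wnorm.
  rewrite cot_in_cotm. wstep (cot_in_cotm f (cot_map g h)).
  wback (wtensM (cot_in V' W') (cot_map f g) (wid M [bic_ob Z']) h).
  rewrite cot_in_cotm wcomp1m; cbn [app].
  wback (wtensM (wid M [bic_ob V']) f (cot_in W' Z') (cot_map g h)).
  rewrite cot_in_cotm wcomp1m; cbn [app].
  rewrite -{1}(wcompm1 h). wstep (wtensM (f ⊗ g) (cot_in V W) h (wid M [bic_ob Z])).
  rewrite -{2}(wcompm1 f). wstep (wtensM f (wid M [bic_ob V]) (g ⊗ h) (cot_in W Z)).
  wstep (cot3_in_assocE V W Z).
  by wassoc (bic_map f) (bic_map g) (bic_map h).
- move=> W W' f; apply: bicomodule_map_eq.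
  change (cot_lun W' ∘ cotm (bicomodule_id bic_unit) f = bic_map f ∘ cot_lun W).
  rewrite /cot_lun; wnorm. rewrite cot_in_cotm; cbn [app].
  wstep (wslide ε (bic_map f)). by rewrite wnil_tens.
- move=> W W' f; apply: bicomodule_map_eq.
  change (cot_run W' ∘ cotm f (bicomodule_id bic_unit) = bic_map f ∘ cot_run W).
  rewrite /cot_run; wnorm. rewrite cot_in_cotm; cbn [app].
  wback (wslide (bic_map f) ε). by wnil (bic_map f).
- move=> V W; apply: bicomodule_map_eq; apply: (@cot_in_mono V W).
  change (cot_in V W ∘ (cotm (bicomodule_id V) (bic_lun W)
      ∘ cot_assoc V bic_unit W)
    = cot_in V W ∘ cotm (bic_run V) (bicomodule_id W)).
  rewrite cot_in_cotm. wstep (cot_in_cotm (bicomodule_id V) (bic_lun W)).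
  cbn [bic_map bicomodule_id bic_lun bic_run].
  rewrite /cot_lun /cot_run; cbn [app].
  wstep (wlM [bic_ob V] (ε ⊗ (wid M [bic_ob W])) (cot_in bic_unit W)).
  wstep (cot3_in_assocE V bic_unit W).
  wunassoc (wid M [bic_ob V]) ε (wid M [bic_ob W]).
  by wback (wrM [bic_ob W] ((wid M [bic_ob V]) ⊗ ε) (cot_in V bic_unit)).
- move=> V W Z X; apply: bicomodule_map_eq.
  apply: (@cot3_inr_mono V W (cot Z X)).
  apply: (@wl_cot_in_mono Z X [bic_ob V; bic_ob W] _ []); cbn [app].
  wnil (cot_in Z X).
  change (wid M [bic_ob V; bic_ob W] ⊗ cot_in Z X ∘ (cot3_inr V W (cot Z X)
      ∘ (cot_assoc V W (cot Z X) ∘ cot_assoc (cot V W) Z X))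
    = wid M [bic_ob V; bic_ob W] ⊗ cot_in Z X ∘ (cot3_inr V W (cot Z X)
      ∘ (cotm (bicomodule_id V) (bic_assoc W Z X) ∘ cot_assoc V (cot W Z) X
          ∘ cotm (bic_assoc V W Z) (bicomodule_id X)))).
  wnorm. wstep (cot3_in_assoc V W (cot Z X)).
  rewrite {1}/cot3_inl; wnorm. wback (wslide (cot_in V W) (cot_in Z X)).
  wstep (cot3_in_assocE (cot V W) Z X).
  rewrite /cot3_inr; wnorm.
  wstep (cot_in_cotm (bicomodule_id V) (bic_assoc W Z X)).
  cbn [bic_map bicomodule_id bic_assoc].
  wback (wlM [bic_ob V] (cot_in W (cot Z X)) (cot_assoc W Z X)).
  rewrite wid2l.
  wback (wlM [bic_ob V] ((wid M [bic_ob W]) ⊗ cot_in Z X)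
    (cot_in W (cot Z X) ∘ cot_assoc W Z X)).
  rewrite (cot3_in_assocE W Z X); cbn [app].
  wstep (wlM [bic_ob V] (cot_in W Z ⊗ wid M [bic_ob X]) (cot_in (cot W Z) X)).
  wstep (cot3_in_assocE V (cot W Z) X).
  wstep (cot_in_cotm (bic_assoc V W Z) (bicomodule_id X)).
  cbn [bic_map bicomodule_id bic_assoc].
  wback (wrM [bic_ob X] (cot_in V (cot W Z)) (cot_assoc V W Z)).
  wunassoc (wid M [bic_ob V]) (cot_in W Z) (wid M [bic_ob X]).
  wback (wrM [bic_ob X] (wid M [bic_ob V] ⊗ cot_in W Z)
    (cot_in V (cot W Z) ∘ cot_assoc V W Z)).
  rewrite (cot3_in_assocE V W Z); cbn [app].
  wstep (wrM [bic_ob X] (cot_in V W ⊗ wid M [bic_ob Z])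
    (cot_in (cot V W) Z)).
  by wassoc (cot_in V W) (wid M [bic_ob Z]) (wid M [bic_ob X]); rewrite wtens1.
Defined.

End Bicomodules.

Definition wbraid (B : bmcat) (X Y : B) : whom (bmon B) [X; Y] [Y; X] :=
  braid (bbraid B) X Y.

(* The inverse of the braiding YX -> XY. *)
Definition wbraidV (B : bmcat) (X Y : B) : whom (bmon B) [X; Y] [Y; X] :=
  braidV (bbraid B) Y X.

Definition nondegenerate_left {C : category} {M : monoidal C}
    (Y : C -> Prop) (Z V W : C) (v : whom M [Z; V] [W]) : Prop :=
  forall X P : C, Y P -> forall g h : whom M [X] [V; P],
    (v ⊗ ⟨P⟩) ∘ (⟨Z⟩ ⊗ g) = (v ⊗ ⟨P⟩) ∘ (⟨Z⟩ ⊗ h) -> g = h.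

Definition nondegenerate_right {B : bmcat} (Y : B -> Prop) (Z V W : B)
    (v : whom (bmon B) [Z; V] [W]) : Prop :=
  nondegenerate_left Y (v ∘ wbraid V Z).

Definition nondegenerate {B : bmcat} (Y : B -> Prop) (A : B)
    (m : whom (bmon B) [A; A] [A]) : Prop :=
  nondegenerate_left Y m /\ nondegenerate_right Y m.

Definition closed_under_retracts {C : category} (Y : C -> Prop) : Prop :=
  forall (X R : C) (i : hom R X) (r : hom X R), r · i = idm R -> Y X -> Y R.

Definition fusion_mult {C : category} {M : monoidal C} {A : C}
    (t : whom M [A; A] [A; A]) (j : whom M [A] []) : whom M [A; A] [A] :=
  (j ⊗ ⟨A⟩) ∘ t.

Section FusionMorphism.
Variables (B : bmcat) (A : B).
Local Notation c := (wbraid A A).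
Local Notation c' := (wbraidV A A).
Local Notation "1" := ⟨A⟩.

Record weakly_counital_fusion (t e : whom (bmon B) [A; A] [A; A])
    (j : whom (bmon B) [A] []) (m := fusion_mult t j) : Prop :=
  WeaklyCounitalFusion {
    wcf_fusion :
      (t ⊗ 1) ∘ (c' ⊗ 1) ∘ (1 ⊗ t) ∘ (c ⊗ 1) ∘ (1 ⊗ t) = (1 ⊗ t) ∘ (t ⊗ 1);
    wcf_ee : e ∘ e = e;
    wcf_et : e ∘ t = t;
    wcf_me :
      (m ⊗ 1) ∘ (1 ⊗ c) ∘ (t ⊗ 1) ∘ (1 ⊗ c') ∘ (1 ⊗ e)
      = (m ⊗ 1) ∘ (1 ⊗ c) ∘ (t ⊗ 1) ∘ (1 ⊗ c');
    wcf_e1_1t : (e ⊗ 1) ∘ (1 ⊗ t) = (1 ⊗ t) ∘ (e ⊗ 1);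
    wcf_t1_e1 :
      (t ⊗ 1) ∘ (1 ⊗ c) ∘ (e ⊗ 1) ∘ (1 ⊗ c') = (1 ⊗ e) ∘ (t ⊗ 1);
    wcf_counit1 :
      m ∘ (1 ⊗ j ⊗ 1) ∘ (t ⊗ 1) = m ∘ (1 ⊗ 1 ⊗ j) ∘ (1 ⊗ e) ∘ (1 ⊗ c);
    wcf_counit2 :
      (j ⊗ 1) ∘ (m ⊗ 1) ∘ (1 ⊗ c) ∘ (t ⊗ 1)
      = m ∘ (1 ⊗ j ⊗ 1) ∘ (1 ⊗ e) ∘ (1 ⊗ c) }.

End FusionMorphism.

Section RegularWeakMultiplierBimonoid.
Variables (B : bmcat) (A : B).
Local Notation c := (wbraid A A).
Local Notation c' := (wbraidV A A).
Local Notation "1" := ⟨A⟩.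
Local Notation "X ~> Y" := (whom (bmon B) X Y) (at level 70).

Record is_regular_wmb (t1 t2 t3 t4 e1 e2 : [A; A] ~> [A; A])
    (j : [A] ~> []) (m := fusion_mult t1 j) : Prop := IsRegularWmb {
  rwmb_nondeg : exists Y : B -> Prop,
    [/\ Y (munit (bmon B)), Y A, Y (tens (bmon B) A A) & nondegenerate Y m];
  rwmb_m12 : (m ⊗ 1) ∘ (1 ⊗ t1) = (1 ⊗ m) ∘ (t2 ⊗ 1);
  rwmb_m13 : (1 ⊗ m) ∘ (1 ⊗ c') ∘ (t1 ⊗ 1) = (1 ⊗ m) ∘ (t3 ⊗ 1) ∘ (1 ⊗ c');
  rwmb_m14 : (m ⊗ 1) ∘ (c' ⊗ 1) ∘ (1 ⊗ t1) = (1 ⊗ m) ∘ (t4 ⊗ 1);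
  rwmb_m23 : (1 ⊗ m) ∘ (1 ⊗ c') ∘ (t2 ⊗ 1) = (m ⊗ 1) ∘ (1 ⊗ t3);
  rwmb_m24 : (m ⊗ 1) ∘ (c' ⊗ 1) ∘ (1 ⊗ t2) = (m ⊗ 1) ∘ (1 ⊗ t4) ∘ (c' ⊗ 1);
  rwmb_m34 : (m ⊗ 1) ∘ (c' ⊗ 1) ∘ (1 ⊗ t3) = (1 ⊗ m) ∘ (1 ⊗ c') ∘ (t4 ⊗ 1);
  rwmb_t21 : (t2 ⊗ 1) ∘ (1 ⊗ t1) = (1 ⊗ t1) ∘ (t2 ⊗ 1);
  rwmb_t23 : (t2 ⊗ 1) ∘ (1 ⊗ t3) = (1 ⊗ t3) ∘ (t2 ⊗ 1);
  rwmb_t41 : (t4 ⊗ 1) ∘ (1 ⊗ t1) = (1 ⊗ t1) ∘ (t4 ⊗ 1);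
  rwmb_t43 : (t4 ⊗ 1) ∘ (1 ⊗ t3) = (1 ⊗ t3) ∘ (t4 ⊗ 1);
  rwmb_m_t2 : m = (1 ⊗ j) ∘ t2;
  rwmb_m_t3 : m = (j ⊗ 1) ∘ t3 ∘ c;
  rwmb_m_t4 : m = (1 ⊗ j) ∘ t4 ∘ c;
  rwmb_e12 :
    (m ⊗ m) ∘ (1 ⊗ c ⊗ 1) ∘ (1 ⊗ 1 ⊗ e1)
    = (m ⊗ m) ∘ (1 ⊗ c ⊗ 1) ∘ (e2 ⊗ 1 ⊗ 1);
  rwmb_f1 : @weakly_counital_fusion B A t1 e1 j;
  rwmb_f2 : @weakly_counital_fusion (rev_cat B) A t2 e2 j;
  rwmb_f3 : @weakly_counital_fusion (inv_cat B) A t3 e2 j;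
  rwmb_f4 : @weakly_counital_fusion (rev_cat (inv_cat B)) A t4 e1 j }.

Record regular_wmb := RegularWmb {
  rt1 : [A; A] ~> [A; A];
  rt2 : [A; A] ~> [A; A];
  rt3 : [A; A] ~> [A; A];
  rt4 : [A; A] ~> [A; A];
  re1 : [A; A] ~> [A; A];
  re2 : [A; A] ~> [A; A];
  rj : [A] ~> [];
  rwmbP : is_regular_wmb rt1 rt2 rt3 rt4 re1 re2 rj }.

Variable H : regular_wmb.

Definition rm : [A; A] ~> [A] := fusion_mult (rt1 H) (rj H).

Definition rd1 : [A; A; A] ~> [A; A] :=
  (rm ⊗ 1) ∘ (1 ⊗ c) ∘ (rt1 H ⊗ 1) ∘ (1 ⊗ c').

Definition rd2 : [A; A; A] ~> [A; A] :=
  (1 ⊗ rm) ∘ (c ⊗ 1) ∘ (1 ⊗ rt2 H) ∘ (c' ⊗ 1).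

Lemma re1K : re1 H · re1 H = re1 H.
Proof. exact: wcf_ee (rwmb_f1 (rwmbP H)). Qed.

Lemma re2K : re2 H · re2 H = re2 H.
Proof. exact: wcf_ee (rwmb_f2 (rwmbP H)). Qed.

Definition rd1_hat (split : idempotent_splitting B) :=
  split_out (split _ _ re1K) · rd1.

Definition rd2_hat (split : idempotent_splitting B) :=
  split_out (split _ _ re2K) · rd2.

Definition is_base_object (L : B) (p : [A] ~> [L]) : Prop :=
  is_coequalizer ((rj H ⊗ 1) ∘ re1 H) ((1 ⊗ rj H) ∘ re1 H) p.

Definition is_base_comonoid (L : B) (p : [A] ~> [L]) (n1 : [L; A] ~> [A])
    (K : sf_comonoid (bmon B) L) : Prop :=
  [/\ cmult K ∘ (⟨L⟩ ⊗ p) = p ∘ n1,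
      comul K ∘ p ∘ rm = (p ⊗ p) ∘ rt1 H
    & counit K ∘ p = rj H].

Definition is_base_coactions (L : B) (p : [A] ~> [L])
    (K : sf_comonoid (bmon B) L) (τ : [A] ~> [L; A]) (τ' : [A] ~> [A; L]) :
    Prop :=
  [/\ τ ∘ rm = (p ⊗ 1) ∘ rt1 H,
      τ' ∘ rm = (1 ⊗ p) ∘ rt4 H ∘ c
    & is_bicomodule K τ τ'].

End RegularWeakMultiplierBimonoid.

Section Modules.
Variables (B : bmcat) (Y : B -> Prop) (A : B) (m : whom (bmon B) [A; A] [A]).
Local Notation "U ~> V" := (whom (bmon B) U V) (at level 70).

Record amodule := Amodule {
  mod_ob :> B;
  mod_act : [A; mod_ob] ~> [mod_ob];
  mod_class : Y mod_ob;
  mod_actA : mod_act ∘ (⟨A⟩ ⊗ mod_act) = mod_act ∘ (m ⊗ ⟨mod_ob⟩);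
  mod_regepi : regular_epi mod_act;
  mod_nondeg : nondegenerate_left Y mod_act }.

Record amodule_map (V W : amodule) := AmoduleMap {
  mod_map :> [mod_ob V] ~> [mod_ob W];
  mod_mapP : mod_map ∘ mod_act V = mod_act W ∘ (⟨A⟩ ⊗ mod_map) }.

Lemma amodule_map_eq (V W : amodule) (f g : amodule_map V W) :
  mod_map f = mod_map g -> f = g.
Proof.
case: f g => [f fP] [g gP] /= e; move: gP; rewrite -e => gP.
by rewrite (proof_irrelevance _ fP gP).
Qed.

Lemma amodule_idP (V : amodule) :
  ⟨V⟩ ∘ mod_act V = mod_act V ∘ (⟨A⟩ ⊗ ⟨V⟩).
Proof. by rewrite wtens1 wcompm1 wcomp1m. Qed.

Lemma amodule_compP (V W Z : amodule) (g : amodule_map W Z)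
    (f : amodule_map V W) :
  g ∘ f ∘ mod_act V = mod_act Z ∘ (⟨A⟩ ⊗ (g ∘ f)).
Proof.
by rewrite -wcompA mod_mapP wcompA mod_mapP -wcompA (wlM [A] g f).
Qed.

Definition amodule_id V := AmoduleMap (amodule_idP V).
Definition amodule_comp V W Z (g : amodule_map W Z) (f : amodule_map V W) :=
  AmoduleMap (amodule_compP g f).

Definition amodule_cat : category.
Proof.
refine (@Category amodule amodule_map amodule_id amodule_comp _ _ _).
- by move=> V W f; apply: amodule_map_eq; apply: wcomp1m.
- by move=> V W f; apply: amodule_map_eq; apply: wcompm1.
- by move=> V W Z X h g f; apply: amodule_map_eq; apply: wcompA.
Defined.

(* The coactions on modules induced by coactions on A; they are unique since
   the actions are regular epimorphisms. *)

Variables (L : B) (K : sf_comonoid (bmon B) L).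
Variables (τA : [A] ~> [L; A]) (τA' : [A] ~> [A; L]).

Record module_coactions := ModuleCoactions {
  mod_lco : forall V : amodule, [mod_ob V] ~> [L; mod_ob V];
  mod_rco : forall V : amodule, [mod_ob V] ~> [mod_ob V; L];
  mod_lcoE : forall V : amodule,
    mod_lco V ∘ mod_act V = (⟨L⟩ ⊗ mod_act V) ∘ (τA ⊗ ⟨V⟩);
  mod_rcoE : forall V : amodule,
    mod_rco V ∘ mod_act V
    = (mod_act V ⊗ ⟨L⟩) ∘ (⟨A⟩ ⊗ wbraid L V) ∘ (τA' ⊗ ⟨V⟩);
  mod_bicP : forall V : amodule, is_bicomodule K (mod_lco V) (mod_rco V);
  mod_bic_mapP : forall (V W : amodule) (f : amodule_map V W),
    is_bicomodule_map (mod_lco V) (mod_rco V) (mod_lco W) (mod_rco W) f }.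

Variable D : module_coactions.

Definition module_bic (V : amodule) : bicomodule K :=
  Bicomodule (mod_bicP D V).

Definition module_bic_map (V W : amodule) (f : amodule_map V W) :
    bicomodule_map (module_bic V) (module_bic W) :=
  @BicomoduleMap _ _ _ _ (module_bic V) (module_bic W) f (mod_bic_mapP D f).

Definition module_functor : functor amodule_cat (bicomodule_cat K).
Proof.
refine (@Functor amodule_cat (bicomodule_cat K) module_bic module_bic_map _ _).
- by move=> V; apply: bicomodule_map_eq.
- by move=> V W Z g f; apply: bicomodule_map_eq.
Defined.

End Modules.

(* Main.v *)
From Corelib Require Import ssreflect ssrfun ssrbool.
Require Import Defs.
From Stdlib Require Import List Arith Lia PArith FMapPositive.
From Stdlib Require Import ProofIrrelevance IndefiniteDescription.
Import ListNotations.

Set Implicit Arguments.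
Unset Strict Implicit.
Unset Printing Implicit Defensive.

Local Open Scope cat_scope.

(** The category of modules inherits the monoidal structure of bicomodules: the
carrier of a bicomodule product V∘W of modules, and the carrier L of the unit
bicomodule, are made into modules in such a way that the coactions induced by
these module structures are the given ones and that the coherence isomorphisms
of bicomodules are linear.  Since U is faithful, the coherence laws and
functoriality are then inherited, and U is strict ([transport_monoidal]).

Three ideas carry the construction.

The pairing.  Let β : AL → I be determined by β.(1p) = j.m.  The non-degeneracy
of n1 on the right makes β non-degenerate on the left ([pairing_faithful]),
because m.(1n1) can be written with β.  Thus morphisms into a product LX are
equal as soon as they agree after pairing with A.  The structure morphisms of
L and the coactions on A and on modules are all defined on quotients; after
such a pairing they are expressed by the structure morphisms of A, for instance
(β1).(1τ) = (j1).t2.  Hence their existence and their laws reduce to identities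
between composites of m, t1, ..., t4, e1, e2 and j.

The action of AA.  The morphism (vw).(1c1) : AAVW → VW is a regular epimorphism
and is non-degenerate.  Along it the idempotent s that defines V∘W becomes e1
when applied after the action and e2 when applied before it
([cot_idem_act2], [act2_cot_idem]), while the diagonal action

  Δ = (v1).(1c).(T1).(1c^-1) : AVW → VW,

where T : AW → AW is t1 acting on W, becomes d1 and d2 respectively
([diag_act2], [act2_diag_act]).  It follows that Δ is associative and absorbs
s on both sides, so that it restricts to V∘W; the restriction is a regular
epimorphism because the corestriction of d1 is one, and it is non-degenerate
because the corestriction of d2 is an epimorphism.

The unit.  L is a module through λ : AL → L with λ.(1p) = p.m.  It is
non-degenerate because ε.λ = β, and the inverse unit constraints are the
coactions V → LV and V → VL, which are linear for the diagonal actions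
([lun_inv_linear], [run_inv_linear]).

All these arguments consist of long computations with string diagrams in a
braided monoidal category.  They are done by the tactic [diagram]: it rewrites
with the given equations, in the given order, and finds the intermediate
isotopies itself.  The search is untrusted and returns a list of elementary
moves (interchange, naturality and invertibility of the braiding, rewriting),
which is replayed by a checker proved sound in [check_sound]. *)

(** * Carrying a wire across a word *)

Section WordBraiding.
Variable B : bmcat.
Notation M := (bmon B).
Implicit Types (X Y : B) (u v : list B).

(** Compatibility with the unit is not among the axioms of a braiding.  It
follows from the hexagon with the unit in the middle: tensored with Z, both
sides agree after composing with the braiding of X and Z, which is invertible. *)
Lemma lun_braid X : lun M X · braid (bbraid B) X (munit M) = run M X.
Proof.
have E Z : tensm M (run M X) (idm Z)
    = tensm M (lun M X · braid (bbraid B) X (munit M)) (idm Z).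
  have -> : tensm M (lun M X · braid (bbraid B) X (munit M)) (idm Z)
      = tensm M (lun M X) (idm Z) · tensm M (braid (bbraid B) X (munit M)) (idm Z).
    by rewrite -tensmM comp1m.
  apply: (mono_split (braidK (bbraid B) X Z)).
  set c := braid (bbraid B) X Z; set k := tensm M (braid _ _ _) _.
  have H := hexagon1 (bbraid B) X (munit M) Z.
  have E1 : c · (tensm M (lun M X) (idm Z) · k)
    = lun M (tens M Z X) · (tensm M (idm _) c · assoc M (munit M) X Z · k).
    by rewrite -lun_tens !compA lun_nat.
  rewrite E1 -H !compA lun_tens.
  rewrite -(braid_nat (bbraid B) (idm X) (lun M Z)).
  by rewrite -(compA _ _ (assoc M X _ Z)) triangle.
apply: (epi_split (runVK M (tens M X (munit M)))).
by rewrite -!run_nat E.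
Qed.

Fixpoint cross_word X u : whom M (X :: u) (u ++ [X]) :=
  match u with
  | [] => ⟨X⟩
  | Y :: u' => (⟨Y⟩ ⊗ cross_word X u') ∘ (wbraid X Y ⊗ wid M u')
  end.

(** Crossing the letters one by one amounts, up to coherence, to the braiding
with their product; this is what makes naturality of the braiding available
for morphisms between arbitrary words. *)
Lemma cross_word_phi X u :
  cross_word X u · phi M [X] u = phi M u [X] · braid (bbraid B) X (wob M u).
Proof.
elim: u => [|Y u IH]; first by rewrite /= lun_braid [LHS]comp1m.
case: u IH => [|Z u] IH.
  rewrite /= /wid compm1 comp1m wtens1 wcomp1m.
  by rewrite (wtens_nil_eq (wbraid X Y) eq_refl eq_refl).
have cE : cross_word X (Z :: u) = phi M (Z :: u) [X] · braid (bbraid B) X (wob M (Z :: u)).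
  by rewrite -IH /= compm1.
have -> : phi M [X] (Y :: Z :: u) = idm _ by [].
rewrite compm1.
have -> : cross_word X (Y :: Z :: u)
   = (⟨Y⟩ ⊗ cross_word X (Z :: u)) ∘ (wbraid X Y ⊗ wid M (Z :: u)) by [].
rewrite cE /wcomp !wtensE /wid /= !tensm1 !compm1 !comp1m.
rewrite -{1}(comp1m (idm Y)) tensmM !compA.
have /= H := hexagon1 (bbraid B) X Y (wob1 M Z u).
rewrite -(compA (tensm M (idm Y) (phi1 M Z u [X]))).
rewrite /wbraid.
have {}H : tensm M (idm Y) (braid (bbraid B) X (wob1 M Z u)) · assoc M Y X (wob1 M Z u)
 · tensm M (braid (bbraid B) X Y) (idm (wob1 M Z u)) · assocV M X Y (wob1 M Z u)
 = assoc M Y (wob1 M Z u) X · braid (bbraid B) X (tens M Y (wob1 M Z u)).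
  by rewrite -H -!compA assocVK compm1.
by move: H; rewrite !compA -!compA => ->.
Qed.

Lemma cross_word_nat X u v (f : whom M u v) :
  cross_word X v ∘ (⟨X⟩ ⊗ f) = (f ⊗ ⟨X⟩) ∘ cross_word X u.
Proof.
have E : phi M [X] u · phiV M [X] u = idm _ := phiVK M [X] u.
rewrite -[RHS]compm1 -[in RHS]E /wcomp compA -(compA (f ⊗ ⟨X⟩)) cross_word_phi.
rewrite compA wtens_phi -(compA (phi M v [X])) -braid_nat compA -cross_word_phi.
by rewrite wtensE !compA.
Qed.

End WordBraiding.

(** * String diagrams and their elementary moves *)

Section Same.
Variables (C : category) (M : monoidal C).
Implicit Types x y u v w : list C.

(** Concatenation is associative only up to a propositional equality, so the
two bracketings of a product of three morphisms have different types.  [same]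
compares morphisms across such equalities of words without mentioning casts. *)
Inductive same u v (f : whom M u v) : forall u' v', whom M u' v' -> Prop :=
  same_refl : same f f.

Lemma same_dom u v u' v' (f : whom M u v) (g : whom M u' v') :
  same f g -> u = u'.
Proof. by case. Qed.

Lemma same_cod u v u' v' (f : whom M u v) (g : whom M u' v') :
  same f g -> v = v'.
Proof. by case. Qed.

(** Proof irrelevance makes all casts along equalities of words trivial. *)
Lemma same_eq u v (f g : whom M u v) : same f g -> f = g.
Proof.
have E u' v' (h : whom M u' v') : same f h -> forall (e : u = u') (e' : v = v'),
    eq_rect _ (fun x => whom M x v') (eq_rect _ (whom M u) f _ e') _ e = h.
  case=> e e'.
  by rewrite (proof_irrelevance _ e eq_refl) (proof_irrelevance _ e' eq_refl).
by move=> /E /(_ eq_refl eq_refl).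
Qed.

Lemma same_sym u v u' v' (f : whom M u v) (g : whom M u' v') :
  same f g -> same g f.
Proof. by case. Qed.

Lemma same_trans u v u' v' u2 v2 (f : whom M u v) (g : whom M u' v')
    (h : whom M u2 v2) : same f g -> same g h -> same f h.
Proof. by move=> fg gh; case: gh fg. Qed.

Lemma same_comp u v w u' v' w' (g : whom M v w) (f : whom M u v)
    (g' : whom M v' w') (f' : whom M u' v') :
  same g g' -> same f f' -> same (g ∘ f) (g' ∘ f').
Proof.
move=> Eg Ef; move: (same_dom Eg) (same_cod Eg) (same_dom Ef) => e1 e2 e3.
by subst v' w' u'; rewrite (same_eq Eg) (same_eq Ef).
Qed.

Lemma same_tens u v u' v' x y x' y' (f : whom M u v) (g : whom M x y)
    (f' : whom M u' v') (g' : whom M x' y') :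
  same f f' -> same g g' -> same (f ⊗ g) (f' ⊗ g').
Proof. by case; case. Qed.

Lemma same_assoc u u' v v' w w' (f : whom M u u') (g : whom M v v')
    (h : whom M w w') : same ((f ⊗ g) ⊗ h) (f ⊗ (g ⊗ h)).
Proof.
rewrite (wtensA_eq f g h (app_assoc _ _ _) (app_assoc _ _ _)).
move: (f ⊗ (g ⊗ h)).
by case: _ / (app_assoc u v w); case: _ / (app_assoc u' v' w') => k.
Qed.

Lemma same_nil u v (f : whom M u v) : same (f ⊗ wid M []) f.
Proof.
rewrite (wtens_nil_eq f (eq_sym (app_nil_r _)) (eq_sym (app_nil_r _))).
by case: _ / (eq_sym (app_nil_r u)); case: _ / (eq_sym (app_nil_r v)).
Qed.

Definition slice x u v (f : whom M u v) y : whom M (x ++ u ++ y) (x ++ v ++ y) :=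
  wid M x ⊗ (f ⊗ wid M y).

Lemma slice_comp x y u v w (g : whom M v w) (f : whom M u v) :
  slice x (g ∘ f) y = slice x g y ∘ slice x f y.
Proof. by rewrite /slice wrM wlM. Qed.

Lemma slice_id x y u : slice x (wid M u) y = wid M (x ++ u ++ y).
Proof. by rewrite /slice !wtens1. Qed.

Lemma slice_slice x1 x2 y1 y2 u v (f : whom M u v) :
  same (slice x1 (slice x2 f y2) y1) (slice (x1 ++ x2) f (y2 ++ y1)).
Proof.
rewrite /slice -(wtens1 M x1) -(wtens1 M y2).
apply: same_sym; apply: (same_trans (same_assoc _ _ _)).
apply: same_tens => //; apply: same_sym; apply: (same_trans (same_assoc _ _ _)).
by apply: same_tens => //; apply: same_assoc.
Qed.

Lemma slice_nil u v (f : whom M u v) : same (slice [] f []) f.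
Proof. by rewrite /slice wnil_tens; apply: same_nil. Qed.

End Same.

Lemma app_split (T : Type) (x x' a a' : list T) :
  length x = length x' -> x ++ a = x' ++ a' -> x = x' /\ a = a'.
Proof.
elim: x x' => [|t x IH] [|t' x'] //= [l] [-> e].
by have [-> ->] := IH _ l e.
Qed.

Lemma app_split_le (T : Type) (x x' a a' : list T) :
  length x <= length x' -> x ++ a = x' ++ a' -> exists z, x' = x ++ z /\ a = z ++ a'.
Proof.
elim: x x' => [|t x IH] x' /=; first by move=> _ ->; exists x'.
case: x' => [|t' x'] /=; first by lia.
by move=> l [-> e]; have [|z [-> ->]] := IH x' _ e; [lia | exists z].
Qed.

(** A diagram is a list of generators in the order in which they are applied,
each with the number of wires on its left.  [Over] and [Under] are the braiding
and its inverse; wires carry the index of their object in a list, so that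
diagrams have decidable equality. *)
Inductive sym := Box (i : nat) | Over (a b : nat) | Under (a b : nat).
Definition node : Type := nat * sym.
Definition arity : Type := list nat * list nat.

Section Arity.
Variable ar : list arity.

Definition box_arity i : arity := nth i ar ([], []).
Definition sdom s := match s with
  | Box i => fst (box_arity i) | Over a b | Under a b => [a; b] end.
Definition scod s := match s with
  | Box i => snd (box_arity i) | Over a b | Under a b => [b; a] end.

Definition shift k (d : list node) : list node :=
  map (fun n => (k + fst n, snd n)) d.

Definition after (w : list nat) (n : node) : list nat :=
  firstn (fst n) w ++ scod (snd n) ++ skipn (fst n + length (sdom (snd n))) w.

(** Formulas are reified together with their source and target words, so that
their meaning can be convertible to the original formula; [flat] turns them
into diagrams. *)
Inductive expr : list nat -> list nat -> Type :=
| EId w : expr w w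
| EBox i : expr (fst (box_arity i)) (snd (box_arity i))
| EOver a b : expr [a; b] [b; a]
| EUnder a b : expr [a; b] [b; a]
| EComp u v w : expr v w -> expr u v -> expr u w
| ETens u u' v v' : expr u u' -> expr v v' -> expr (u ++ v) (u' ++ v').

Fixpoint flat k u v (e : expr u v) : list node :=
  match e with
  | EId _ => []
  | EBox i => [(k, Box i)]
  | EOver a b => [(k, Over a b)]
  | EUnder a b => [(k, Under a b)]
  | @EComp _ _ _ g f => flat k f ++ flat k g
  | @ETens _ u' _ _ f g => flat k f ++ flat (k + length u') g
  end.

Record equation := Equation {
  eq_dom : list nat;
  eq_cod : list nat;
  eq_lhs : expr eq_dom eq_cod;
  eq_rhs : expr eq_dom eq_cod }.

Definition crossing (under : bool) a b := if under then Under a b else Over a b.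
Fixpoint move_right under x k (u : list nat) : list node :=
  match u with
  | [] => []
  | a :: u' => (k, crossing under x a) :: move_right under x (S k) u'
  end.

(** Besides the given equations, the rules are naturality of the braiding
([Slide] moves the generator [s] through the wire [x]) and invertibility of the
braiding ([Cancel]); these two can be used in both directions. *)
Inductive rule :=
| Given (i : nat)
| Slide (s : sym) (x : nat) (under rev : bool)
| Cancel (a b : nat) (under rev : bool).

Definition oriented (rev : bool) (w : list nat) (l r : list node) :=
  if rev then (w, r, l) else (w, l, r).

Variable eqs : list equation.

Definition rule_data (r : rule) : list nat * list node * list node :=
  match r with
  | Given i =>
      match nth_error eqs i with
      | Some q => (eq_dom q, flat 0 (eq_lhs q), flat 0 (eq_rhs q))
      | None => ([], [], [])
      end
  | Slide s x under rev =>
      oriented rev (x :: sdom s) (move_right under x 0 (sdom s) ++ [(0, s)])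
        ((1, s) :: move_right under x 0 (scod s))
  | Cancel a b under rev =>
      oriented rev [a; b] [(0, crossing under a b); (0, crossing (negb under) b a)] []
  end.

Inductive op := Swap (n : nat) | Rewrite (r : rule) (n k : nat).

(** Consecutive generators that act on disjoint sets of wires may be
interchanged; their offsets change by the difference between the numbers of
inputs and outputs of the other one. *)
Definition swap2 (n1 n2 : node) : option (node * node) :=
  let (k1, s1) := n1 in let (k2, s2) := n2 in
  if k1 + length (scod s1) <=? k2 then
    Some ((k2 - length (scod s1) + length (sdom s1), s2), (k1, s1))
  else if k2 + length (sdom s2) <=? k1 then
    Some ((k2, s2), (k1 - length (sdom s2) + length (scod s2), s1))
  else None.

Definition sym_dec (s t : sym) : {s = t} + {s <> t}.
Proof. by decide equality; apply: Nat.eq_dec. Defined.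

Definition node_dec (s t : node) : {s = t} + {s <> t}.
Proof. by decide equality; [apply: sym_dec | apply: Nat.eq_dec]. Defined.

Definition diag_dec (d d' : list node) : {d = d'} + {d <> d'} :=
  list_eq_dec node_dec d d'.

Definition word_dec (d d' : list nat) : {d = d'} + {d <> d'} :=
  list_eq_dec Nat.eq_dec d d'.

Definition run_op w (d : list node) (o : op) : option (list node) :=
  match o with
  | Swap n =>
      match skipn n d with
      | n1 :: n2 :: d2 =>
          match swap2 n1 n2 with
          | Some (a, b) => Some (firstn n d ++ a :: b :: d2)
          | None => None
          end
      | _ => None
      end
  | Rewrite r n k =>
      let '(w0, l, r') := rule_data r in
      let pre := firstn n d in
      let post := skipn n d in
      let w1 := fold_left after pre w in
      if word_dec (firstn (length w0) (skipn k w1)) w0 then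
        if k <=? length w1 then
          if diag_dec (firstn (length l) post) (shift k l) then
            Some (pre ++ shift k r' ++ skipn (length l) post)
          else None
        else None
      else None
  end.

Fixpoint run_ops w d (os : list op) : option (list node) :=
  match os with
  | [] => Some d
  | o :: os' => match run_op w d o with
      | Some d' => run_ops w d' os' | None => None end
  end.

Definition check u v (e1 e2 : expr u v) os1 os2 : bool :=
  match run_ops u (flat 0 e1) os1, run_ops u (flat 0 e2) os2 with
  | Some d1, Some d2 => if diag_dec d1 d2 then true else false
  | _, _ => false
  end.

End Arity.

Section Semantics.
Variable B : bmcat.
Notation M := (bmon B).
Variables (obs : list B) (ar : list arity).

Definition ow (w : list nat) : list B := map (fun i => nth i obs (munit M)) w.

Fixpoint boxes (l : list arity) : Type :=
  match l with
  | [] => unit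
  | a :: l' => whom M (ow (fst a)) (ow (snd a)) * boxes l'
  end.

Fixpoint box_mor (l : list arity) : boxes l -> forall i,
    whom M (ow (fst (nth i l ([], [])))) (ow (snd (nth i l ([], [])))) :=
  match l with
  | [] => fun _ i => match i with 0 => wid M [] | S _ => wid M [] end
  | a :: l' => fun E i =>
      match i with 0 => fst E | S i' => box_mor (snd E) i' end
  end.

Variable E : boxes ar.

Definition smor s : whom M (ow (sdom ar s)) (ow (scod ar s)) :=
  match s with
  | Box i => box_mor E i
  | Over a b => wbraid (nth a obs (munit M)) (nth b obs (munit M))
  | Under a b => wbraidV (nth a obs (munit M)) (nth b obs (munit M))
  end.

Fixpoint ow_app u v : ow u ++ ow v = ow (u ++ v) :=
  match u with
  | [] => eq_refl
  | a :: u' => f_equal (cons (nth a obs (munit M))) (ow_app u' v)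
  end.

Definition otens u u' v v' (f : whom M (ow u) (ow u')) (g : whom M (ow v) (ow v'))
    : whom M (ow (u ++ v)) (ow (u' ++ v')) :=
  eq_rect _ (fun x => whom M x _) (eq_rect _ (whom M _) (f ⊗ g) _ (ow_app u' v'))
    _ (ow_app u v).

Lemma same_otens u u' v v' (f : whom M (ow u) (ow u')) (g : whom M (ow v) (ow v')) :
  same (otens f g) (f ⊗ g).
Proof.
rewrite /otens; move: (f ⊗ g).
by case: _ / (ow_app u v); case: _ / (ow_app u' v').
Qed.

Fixpoint denote u v (e : expr ar u v) : whom M (ow u) (ow v) :=
  match e in expr _ u v return whom M (ow u) (ow v) with
  | @EId _ w => wid M (ow w)
  | @EBox _ i => box_mor E i
  | @EOver _ a b => wbraid (nth a obs (munit M)) (nth b obs (munit M))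
  | @EUnder _ a b => wbraidV (nth a obs (munit M)) (nth b obs (munit M))
  | @EComp _ _ _ _ g f => denote g ∘ denote f
  | @ETens _ _ _ _ _ f g => otens (denote f) (denote g)
  end.

(** A diagram has no canonical meaning as a function of the source word, since
the words between two generators are determined only up to equality.  It is
therefore interpreted as a relation, which holds of the composites of slices
with matching boundaries and is functional by [sem_fun]. *)
Inductive sem w : list node -> forall w', whom M w w' -> Prop :=
| sem_nil : sem [] (wid M w)
| sem_cons w1 w' x y s d (g : whom M w w1) (f : whom M w1 w') :
    same g (slice x (smor s) y) -> sem d f -> sem ((length x, s) :: d) (f ∘ g).

Lemma sem_inv w d w' (f : whom M w w') : sem d f ->
  match d with
  | [] => same f (wid M w)
  | n :: d' => exists x y w1 (g : whom M w w1) (f' : whom M w1 w'),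
     [/\ length x = fst n, same g (slice x (smor (snd n)) y), sem d' f' & f = f' ∘ g]
  end.
Proof. by case=> [|w1 {}w' x y s d' g {}f gE fd] //; exists x, y, w1, g, f. Qed.

Lemma sem_same w d w' v v' (f : whom M w w') (g : whom M v v') :
  same f g -> sem d f -> sem d g.
Proof. by case. Qed.

Lemma sem_app w d1 d2 w1 w2 (f : whom M w w1) (g : whom M w1 w2) :
  sem d1 f -> sem d2 g -> sem (d1 ++ d2) (g ∘ f).
Proof.
move=> s1 s2; elim: s1 g s2 => [v|v v1 v2 x y s d h k hE kd IH] g gd /=.
  by rewrite wcompm1.
by rewrite wcompA; apply: (sem_cons hE); apply: IH.
Qed.

Lemma sem_split w d1 d2 w2 (f : whom M w w2) : sem (d1 ++ d2) f ->
  exists w1 (g : whom M w w1) (h : whom M w1 w2),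
    [/\ sem d1 g, sem d2 h & f = h ∘ g].
Proof.
elim: d1 w f => [|[k s] d1 IH] w f /= S.
  by exists w, (wid M w), f; split=> //; [apply: sem_nil | rewrite wcompm1].
have [x [y [w1 [g [f' [lx gE S' ->]]]]]] := sem_inv S.
have [v [h1 [h2 [S1 S2 ->]]]] := IH _ _ S'.
exists v, (h1 ∘ g), h2; split=> //; last by rewrite wcompA.
by have <- : length x = k := lx; apply: (sem_cons gE).
Qed.

Lemma sem_fun w d w1 w2 (f : whom M w w1) (g : whom M w w2) :
  sem d f -> sem d g -> same f g.
Proof.
move=> S; elim: S w2 g => [v|v v1 v2 x y s d' h k hE kd IH] w2 g S'.
  by apply: same_sym; apply: (sem_inv S').
have [x' [y' [w1' [h' [k' [/= lx hE' S1 ->]]]]]] := sem_inv S'.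
have e := eq_trans (eq_sym (same_dom hE)) (same_dom hE').
have [ex e'] := app_split (esym lx) e.
have [_ ey] := app_split eq_refl e'; subst x' y'.
have hh' := same_trans hE (same_sym hE').
move: (same_cod hh') => e1; subst w1'.
exact: same_comp (IH _ _ S1) hh'.
Qed.

Lemma length_ow w : length (ow w) = length w.
Proof. exact: length_map. Qed.

Lemma shift_sem w d w' (f : whom M w w') x y :
  sem d f -> sem (shift (length x) d) (slice x f y).
Proof.
elim=> {w d w' f} [w|w w1 w' x1 y1 s d g f gE fd IH] /=.
  by rewrite slice_id; apply: sem_nil.
rewrite slice_comp -length_app; apply: sem_cons IH.
apply: same_trans (slice_slice x x1 y y1 (smor s)).
rewrite /slice; apply: same_tens => //; exact: same_tens gE (same_refl _).
Qed.

Lemma swap_words x z y u u' v v' (f : whom M u u') (g : whom M v v')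
    w w1 w2 (p : whom M w w1) (q : whom M w1 w2) :
  same p (slice x f (z ++ v ++ y)) ->
  same q (slice (x ++ u' ++ z) g y) ->
  exists w1' (p' : whom M w w1') (q' : whom M w1' w2),
   [/\ same p' (slice (x ++ u ++ z) g y), same q' (slice x f (z ++ v' ++ y))
     & q ∘ p = q' ∘ p'].
Proof.
have S u0 : same (slice (x ++ u0 ++ z) g y)
    (wid M x ⊗ wid M u0 ⊗ wid M z ⊗ g ⊗ wid M y).
  rewrite /slice -!wtens1; apply: (same_trans (same_assoc _ _ _)).
  by apply: same_tens => //; apply: same_assoc.
move=> pE qE; have {}qE := same_trans qE (S u').
move: (same_dom pE) (same_cod pE) (same_cod qE) => e1 e2 e3; subst w w1 w2.
have {pE}-> := same_eq pE; have {qE}-> := same_eq qE.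
exists _, (wid M x ⊗ wid M u ⊗ wid M z ⊗ g ⊗ wid M y), (slice x f (z ++ v' ++ y)).
split=> //; first exact: same_sym (S u).
by rewrite /slice -!wtensM !wcomp1m !wcompm1.
Qed.

Lemma swap_words_rev x z y u u' v v' (f : whom M u u') (g : whom M v v')
    w w1 w2 (p : whom M w w1) (q : whom M w1 w2) :
  same p (slice (x ++ u ++ z) g y) ->
  same q (slice x f (z ++ v' ++ y)) ->
  exists w1' (p' : whom M w w1') (q' : whom M w1' w2),
   [/\ same p' (slice x f (z ++ v ++ y)), same q' (slice (x ++ u' ++ z) g y)
     & q ∘ p = q' ∘ p'].
Proof.
have S u0 : same (slice (x ++ u0 ++ z) g y)
    (wid M x ⊗ wid M u0 ⊗ wid M z ⊗ g ⊗ wid M y).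
  rewrite /slice -!wtens1; apply: (same_trans (same_assoc _ _ _)).
  by apply: same_tens => //; apply: same_assoc.
move=> pE qE; have {}pE := same_trans pE (S u).
move: (same_dom pE) (same_cod pE) (same_cod qE) => e1 e2 e3; subst w w1 w2.
have {pE}-> := same_eq pE; have {qE}-> := same_eq qE.
exists _, (slice x f (z ++ v ++ y)), (wid M x ⊗ wid M u' ⊗ wid M z ⊗ g ⊗ wid M y).
split=> //; first exact: same_sym (S u').
by rewrite /slice -!wtensM !wcomp1m !wcompm1.
Qed.

Lemma swap2_sem n1 n2 a b d w w' (f : whom M w w') :
  swap2 ar n1 n2 = Some (a, b) -> sem (n1 :: n2 :: d) f -> sem (a :: b :: d) f.
Proof.
case: n1 n2 => [k1 s1] [k2 s2].
move=> sE S; have [x1 [y1 [w1 [g1 [f1 [/= l1 E1 {}S ->]]]]]] := sem_inv S.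
have [x2 [y2 [w2 [g2 [f2 [/= l2 E2 S2 ->]]]]]] := sem_inv S.
have e := same_dom E2; rewrite (same_cod E1) in e.
move: sE => /=; case: Nat.leb_spec => [le1 | _].
  case=> <- <-.
  rewrite app_assoc in e; have [|z [ex ey]] := app_split_le _ e.
    by rewrite length_app length_ow; lia.
  rewrite -app_assoc in ex; subst x2 y1.
  have [w1' [p' [q' [pE qE e']]]] := swap_words E1 E2.
  rewrite -wcompA e' wcompA.
  have -> : k2 - length (scod ar s1) + length (sdom ar s1)
      = length (x1 ++ ow (sdom ar s1) ++ z).
    by rewrite -l2 !length_app !length_ow; lia.
  by apply: (sem_cons pE); rewrite -l1; apply: (sem_cons qE).
case: Nat.leb_spec => [le2 | //] [<- <-].
have e0 := esym e; rewrite app_assoc in e0; have [|z [ex ey]] := app_split_le _ e0.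
  by rewrite length_app length_ow; lia.
rewrite -app_assoc in ex; subst x1 y2.
have [w1' [p' [q' [pE qE e']]]] := swap_words_rev E1 E2.
rewrite -wcompA e' wcompA -l2; apply: (sem_cons pE).
have -> : k1 - length (sdom ar s2) + length (scod ar s2)
    = length (x2 ++ ow (scod ar s2) ++ z).
  by rewrite -l1 !length_app !length_ow; lia.
exact: (sem_cons qE).
Qed.

Lemma after_ow w n w1 (g : whom M (ow w) w1) x y :
  length x = fst n -> same g (slice x (smor (snd n)) y) -> w1 = ow (after ar w n).
Proof.
move=> lx gE; have e := same_dom gE; rewrite (same_cod gE) /after.
have e1 : firstn (fst n) (ow w) = x.
  by rewrite -lx e firstn_app Nat.sub_diag firstn_all app_nil_r.
have e2 : skipn (fst n + length (sdom ar (snd n))) (ow w) = y.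
  rewrite e app_assoc -lx -(length_ow (sdom _ _)) -length_app.
  by rewrite skipn_app Nat.sub_diag skipn_all.
rewrite -e1 -e2 /ow firstn_map skipn_map.
by rewrite [RHS]map_app map_app.
Qed.

Lemma sem_word w d w' (f : whom M (ow w) w') :
  sem d f -> w' = ow (fold_left (after ar) d w).
Proof.
elim: d w f => [|n d IH] w f S /=.
  by have := same_cod (sem_inv S).
have [x [y [w1 [g [f' [lx gE S' _]]]]]] := sem_inv S.
move: (after_ow lx gE) => e; subst w1.
exact: IH S'.
Qed.

Definition valid (t : list nat * list node * list node) : Prop :=
  exists w' (f : whom M (ow (fst (fst t))) w'),
    sem (snd (fst t)) f /\ sem (snd t) f.

(** The two sides of a valid rule are meanings of one morphism, hence so are
their translates by [k] wires; as meanings are unique, one may replace the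
other inside a diagram. *)
Lemma rewrite_sem t k d w1 w0 w' (f : whom M w0 w') :
  valid t -> w0 = ow w1 ->
  firstn (length (fst (fst t))) (skipn k w1) = fst (fst t) -> k <= length w1 ->
  sem (shift k (snd (fst t)) ++ d) f -> sem (shift k (snd t) ++ d) f.
Proof.
case=> w2 [h [Sl Sr]] e wE lk S; subst w0.
have [v [p [q [S1 S2 ->]]]] := sem_split S.
apply: sem_app S2.
set x := ow (firstn k w1); set y := ow (skipn (length (fst (fst t))) (skipn k w1)).
have lx : length x = k by rewrite length_ow firstn_length_le.
have e1 : x ++ ow (fst (fst t)) ++ y = ow w1.
  have -> : fst (fst t) = firstn (length (fst (fst t))) (skipn k w1) by rewrite wE.
  by rewrite /x /y /ow -!map_app wE -{1}wE !firstn_skipn.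
have Sl' := @shift_sem _ _ _ _ x y Sl; have Sr' := @shift_sem _ _ _ _ x y Sr.
rewrite lx in Sl' Sr'.
have [p' pE] : exists p' : whom M (ow w1) (x ++ w2 ++ y), same p' (slice x h y).
  by rewrite -e1; exists (slice x h y).
have pp' := sem_fun S1 (sem_same (same_sym pE) Sl').
by apply: sem_same Sr'; apply: same_trans (same_sym pE) (same_sym pp').
Qed.

Section Rules.
Variable eqs : list (equation ar).

Fixpoint hold (l : list (equation ar)) : Prop :=
  match l with
  | [] => True
  | q :: l' => denote (eq_lhs q) = denote (eq_rhs q) /\ hold l'
  end.

Hypothesis eqsP : hold eqs.

Lemma flat_sem u v (e : expr ar u v) x y :
  sem (flat (length x) e) (slice x (denote e) y).
Proof.
elim: e x y => {u v} [w|i|a b|a b|u v w g IHg f IHf|u u' v v' f IHf g IHg] x y /=.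
- by rewrite slice_id; apply: sem_nil.
- rewrite -[slice _ _ _]wcomp1m.
  exact: (@sem_cons _ _ _ _ _ (Box i) _ _ _ (same_refl _) (sem_nil _)).
- rewrite -[slice _ _ _]wcomp1m.
  exact: (@sem_cons _ _ _ _ _ (Over a b) _ _ _ (same_refl _) (sem_nil _)).
- rewrite -[slice _ _ _]wcomp1m.
  exact: (@sem_cons _ _ _ _ _ (Under a b) _ _ _ (same_refl _) (sem_nil _)).
- by rewrite slice_comp; apply: sem_app.
- have {}IHf := IHf x (ow v ++ y).
  have := IHg (x ++ ow u') y; rewrite length_app length_ow => {}IHg.
  have {}IHg : sem (flat (length x + length u') g)
      (wid M x ⊗ (wid M (ow u') ⊗ (denote g ⊗ wid M y))).
    by apply: sem_same IHg; rewrite /slice -(wtens1 M x); apply: same_assoc.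
  have := sem_app IHf IHg; rewrite /slice -!wtensM !wcomp1m !wcompm1.
  apply: sem_same; apply: same_tens => //; apply: same_sym.
  by apply: same_trans (same_tens (same_otens _ _) (same_refl _)) (same_assoc _ _ _).
Qed.

Lemma flat_sem0 u v (e : expr ar u v) : sem (flat 0 e) (denote e).
Proof. by apply: sem_same (@flat_sem _ _ e [] []); apply: slice_nil. Qed.

Lemma sem1 s x y : sem [(length x, s)] (slice x (smor s) y).
Proof.
rewrite -[slice _ _ _]wcomp1m.
exact: (sem_cons (same_refl _) (sem_nil _)).
Qed.

Lemma sem10 s : sem [(0, s)] (smor s).
Proof. by apply: sem_same (sem1 s [] []); apply: slice_nil. Qed.

Lemma cancel_sem a b under : valid (rule_data eqs (Cancel a b under false)).
Proof.
exists (ow [a; b]), (wid M _); split; last exact: sem_nil.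
case: under.
  have <- : (smor (Over b a) : whom M (ow [b; a]) (ow [a; b])) ∘ smor (Under a b)
    = wid M (ow [a; b]) by apply: (braidVK (bbraid B)).
  exact: sem_app (sem10 (Under a b)) (sem10 (Over b a)).
have <- : (smor (Under b a) : whom M (ow [b; a]) (ow [a; b])) ∘ smor (Over a b)
  = wid M (ow [a; b]) by apply: (braidK (bbraid B)).
exact: sem_app (sem10 (Over a b)) (sem10 (Under b a)).
Qed.

Definition cross (under : bool) (X : B) (u : list B) : whom M (X :: u) (u ++ [X]) :=
  if under then @cross_word (inv_cat B) X u else cross_word X u.

Lemma cross_nat under X u v (f : whom M u v) :
  cross under X v ∘ (⟨X⟩ ⊗ f) = (f ⊗ ⟨X⟩) ∘ cross under X u.
Proof.
by case: under; [exact: (@cross_word_nat (inv_cat B)) | exact: cross_word_nat].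
Qed.

Lemma move_right_sem under x u y z :
  sem (move_right under x (length y) u)
    (slice y (cross under (nth x obs (munit M)) (ow u)) z).
Proof.
elim: u y => [|a u IH] y /=.
  have -> : cross under (nth x obs (munit M)) [] = ⟨nth x obs (munit M)⟩.
    by case: under.
  by rewrite slice_id; apply: sem_nil.
set X := nth x obs (munit M) in IH *; set Y := nth a obs (munit M).
have -> : cross under X (Y :: ow u)
  = (⟨Y⟩ ⊗ cross under X (ow u))
    ∘ ((if under then wbraidV X Y else wbraid X Y) ⊗ wid M (ow u)).
  by case: under {IH}.
rewrite slice_comp.
have {}IH := IH (y ++ [Y]); rewrite length_app Nat.add_comm in IH.
apply: (@sem_app _ [_]); last first.
  apply: sem_same IH; rewrite /slice -wtens1; apply: (same_trans (same_assoc _ _ _)).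
  apply: same_tens => //; apply: same_sym.
  exact: (same_assoc ⟨Y⟩ (cross under X (ow u)) (wid M z)).
have S : sem [(length y, crossing under x a)]
    (slice y (if under then wbraidV X Y else wbraid X Y) (ow u ++ z)).
  by clear IH; case: under; [exact: (sem1 (Under x a)) | exact: (sem1 (Over x a))].
apply: sem_same S.
rewrite /slice -(wtens1 M (ow u)); apply: same_tens => //; apply: same_sym.
exact: (same_assoc (if under then wbraidV X Y else wbraid X Y) (wid M (ow u))
  (wid M z)).
Qed.

Lemma slide_sem s x under : valid (rule_data eqs (Slide s x under false)).
Proof.
set X := nth x obs (munit M).
have S1 : sem [(1, s)] (⟨X⟩ ⊗ smor s).
  apply: sem_same (sem1 s [X] []).
  by apply: (@same_tens _ _ _ _ _ _ _ _ _ _ ⟨X⟩ _ ⟨X⟩) => //; apply: same_nil.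
have S0 : sem [(0, s)] (smor s ⊗ ⟨X⟩).
  by apply: sem_same (sem1 s [] [X]); rewrite /slice wnil_tens.
have Sm u : sem (move_right under x 0 u) (cross under X (ow u)).
  by apply: sem_same (move_right_sem under x u [] []); apply: slice_nil.
exists (ow (scod ar s) ++ [X]), (cross under X (ow (scod ar s)) ∘ (⟨X⟩ ⊗ smor s)).
split; last exact: sem_app S1 (Sm _).
by rewrite cross_nat; apply: sem_app (Sm _) S0.
Qed.

Lemma valid_oriented rev w l r : valid (w, l, r) -> valid (oriented rev w l r).
Proof. by case: rev => // -[w' [f [? ?]]]; exists w', f. Qed.

Lemma rule_sem r : valid (rule_data eqs r).
Proof.
case: r => [i|s x under rev|a b under rev].
3: exact: valid_oriented (cancel_sem a b under).
2: exact: valid_oriented (slide_sem s x under).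
rewrite /rule_data; case Ei: (nth_error eqs i) => [q|]; last first.
  by exists [], (wid M []); split; apply: sem_nil.
have qE : denote (eq_lhs q) = denote (eq_rhs q).
  elim: eqs i Ei eqsP => [|q' l IH] [|i] //= Ei [h1 h2].
    by case: Ei => <-.
  exact: IH Ei h2.
exists (ow (eq_cod q)), (denote (eq_lhs q)); split; first exact: flat_sem0.
by rewrite qE; apply: flat_sem0.
Qed.

Lemma run_op_sem w d d' o w' (f : whom M (ow w) w') :
  run_op eqs w d o = Some d' -> sem d f -> sem d' f.
Proof.
case: o => [n|r n k] /=.
  have := firstn_skipn n d; case: (skipn n d) => [|n1 [|n2 d2]] // dE.
  case sE: (swap2 ar n1 n2) => [[a b]|] // [<-] S.
  have [v [p [q [S1 S2 ->]]]] := sem_split (eq_ind_r (fun d => sem d f) S dE).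
  exact: sem_app S1 (swap2_sem sE S2).
have := rule_sem r; case: (rule_data eqs r) => [[w0 l] r'] V.
case: word_dec => // wE; case: Nat.leb_spec => // lk.
case: diag_dec => // lE [<-] S.
have [v [p [q [S1 S2 ->]]]] :=
  sem_split (eq_ind_r (fun d => sem d f) S (firstn_skipn n d)).
apply: (sem_app S1).
rewrite -(firstn_skipn (length l) (skipn n d)) lE in S2.
exact: (rewrite_sem V (sem_word S1)).
Qed.

Lemma run_ops_sem w d d' os w' (f : whom M (ow w) w') :
  run_ops eqs w d os = Some d' -> sem d f -> sem d' f.
Proof.
elim: os d => [|o os IH] d /=; first by case=> <-.
case E1: run_op => [d1|] // E2 S.
exact: IH E2 (run_op_sem E1 S).
Qed.

Theorem check_sound u v (e1 e2 : expr ar u v) os1 os2 :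
  check eqs e1 e2 os1 os2 = true -> denote e1 = denote e2.
Proof.
rewrite /check; case E1: run_ops => [d1|] //; case E2: run_ops => [d2|] //.
case: diag_dec => // e _; subst d2; apply: same_eq.
exact: sem_fun (run_ops_sem E1 (flat_sem0 e1)) (run_ops_sem E2 (flat_sem0 e2)).
Qed.

End Rules.
End Semantics.

(** * Search for isotopies of diagrams *)

Section Search.
Variable ar : list arity.
Variable eqs : list (equation ar).
Variable w0 : list nat.
Notation diag := (list node).

Definition sym_eqb (s t : sym) : bool :=
  match s, t with
  | Box i, Box j => Nat.eqb i j
  | Over a b, Over c d | Under a b, Under c d => Nat.eqb a c && Nat.eqb b d
  | _, _ => false
  end.
Definition node_eqb (m n : node) : bool :=
  Nat.eqb (fst m) (fst n) && sym_eqb (snd m) (snd n).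

(** Normal forms for interchange: a generator is moved before every generator
that lies entirely to its right.  Visited diagrams can then be compared
literally.  The list [os] records the moves, the latest one first. *)
Fixpoint bubble (rp : diag) (idx : nat) (z : node) (post : diag) (os : list op) :=
  match rp with
  | p :: rp' =>
      if fst z + length (sdom ar (snd z)) <=? fst p then
        bubble rp' (idx - 1) z
          ((fst p - length (sdom ar (snd z)) + length (scod ar (snd z)), snd p) :: post)
          (Swap (idx - 1) :: os)
      else (rev_append post (z :: rp), os)
  | [] => (rev_append post (z :: rp), os)
  end.

Fixpoint normal_aux rp idx (d : diag) os :=
  match d with
  | [] => (rev rp, os)
  | z :: d' => let (rp', os') := bubble rp idx z [] os in normal_aux rp' (S idx) d' os'
  end.
Definition normal d os := normal_aux [] 0 d os.

Fixpoint pull (rp : diag) z idx acc os :=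
  match rp with
  | [] => Some (z, acc, os)
  | p :: rp' => match swap2 ar p z with
      | Some (z', p') => pull rp' z' (idx - 1) (p' :: acc) (Swap (idx - 1) :: os)
      | None => None
      end
  end.

(** Extends a partial match of a pattern, searching for its remaining generators
[pat] further on in the diagram.  The generators [blk] matched so far stay
together: one that comes in between is moved ahead of them ([pre]) if interchange
allows it, and delayed ([skip]) otherwise. *)
Fixpoint grow fuel k0 pre npre blk nblk skip nskip rest (pat : diag) off os
    : option (diag * nat * nat * list op) :=
  match fuel with 0 => None | S fuel' =>
  match pat with
  | [] => Some (rev_append pre (rev_append blk (rev_append skip rest)), npre, off, os)
  | p :: pat' =>
    match rest with
    | [] => None
    | z :: rest' =>
      match pull skip z (npre + nblk + nskip) [] os with
      | Some (z', skip', os1) =>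
        if node_eqb z' (off + fst p, snd p) then
          grow fuel' k0 pre npre (z' :: blk) (S nblk) [] 0 (skip' ++ rest') pat' off os1
        else match pull blk z' (npre + nblk) [] os1 with
          | Some (z2, blk', os2) =>
            grow fuel' k0 (z2 :: pre) (S npre) (rev blk') nblk (rev skip') nskip rest' pat
              (match blk' with n :: _ => fst n - k0 | [] => off end) os2
          | None => grow fuel' k0 pre npre blk nblk (z :: skip) (S nskip) rest' pat off os
          end
      | None => grow fuel' k0 pre npre blk nblk (z :: skip) (S nskip) rest' pat off os
      end
    end
  end end.

Definition state : Type := diag * list op.

Definition match_at (st : state) n (pat : diag) :=
  match pat, skipn n (fst st) with
  | p :: pat', x :: rest =>
      if sym_eqb (snd x) (snd p) && (fst p <=? fst x) then
        grow 60 (fst p) (rev (firstn n (fst st))) n [x] 1 [] 0 rest pat'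
          (fst x - fst p) (snd st)
      else None
  | _, _ => None
  end.

Definition finish (t : option (diag * nat * nat * list op))
    (f : nat -> nat -> list op) : list state :=
  match t with
  | None => []
  | Some (d, n, k, os) =>
      let os' := f n k in
      match run_ops eqs w0 d os' with
      | Some d' => [normal d' (rev_append os' os)]
      | None => []
      end
  end.

Definition rewrites (st : state) (pat : diag) (f : nat -> nat -> list op) : list state :=
  flat_map (fun n => finish (match_at st n pat) f) (seq 0 (length (fst st))).

Definition is_crossing (s : sym) := match s with Box _ => false | _ => true end.
Definition opposite s := match s with
  | Over a b => Under b a | Under a b => Over b a | Box i => Box i end.
Definition crossings (d : diag) := filter is_crossing (map snd d).

(** Only crossings are passed to this function; the value on boxes is junk. *)
Definition cancel_rule s := match s with
  | Over a b => Cancel a b false false | Under a b => Cancel a b true false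
  | Box _ => Cancel 0 0 false false end.

Fixpoint simplify fuel (st : state) : state :=
  match fuel with 0 => st | S fuel' =>
  match flat_map (fun s => rewrites st [(0, s); (0, opposite s)]
     (fun n k => [Rewrite (cancel_rule s) n k])) (crossings (fst st)) with
  | st' :: _ => simplify fuel' st'
  | [] => st
  end end.

Fixpoint move_left under x k (u : list nat) : diag :=
  match u with
  | [] => []
  | a :: u' => move_left under x (S k) u' ++ [(k, crossing under a x)]
  end.

(** In [block_right] the wire [x] starts between the inputs [i-1] and [i] of
[s], passes [s] on the right, and ends between the outputs [j-1] and [j]; in
[block_left] it passes [s] on the left.  The two diagrams are isotopic:
[slide_ops] first creates crossings of [x] with the first [i] inputs, then
slides [s] through [x], and cancels the crossings with the last outputs. *)
Definition block_right s x i j under : diag :=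
  move_right under x i (skipn i (sdom ar s)) ++ (0, s)
    :: move_left (negb under) x j (skipn j (scod ar s)).
Definition block_left s x i j under : diag :=
  move_left (negb under) x 0 (firstn i (sdom ar s)) ++ (1, s)
    :: move_right under x 0 (firstn j (scod ar s)).

Definition slide_ops s x i j under n k : list op :=
  let u := sdom ar s in let v := scod ar s in
  map (fun t => Rewrite (Cancel (nth (i - 1 - t) u 0) x (negb under) true)
         (n + t) (k + (i - 1 - t))) (seq 0 i)
  ++ [Rewrite (Slide s x under false) (n + i) k]
  ++ map (fun t => let p := length v - 1 - t in
       Rewrite (Cancel x (nth p v 0) under false) (n + i + 1 + p) (k + p))
     (seq 0 (length v - j)).

Definition flip_op o := match o with
  | Swap n => Swap n
  | Rewrite (Given i) n k => Rewrite (Given i) n k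
  | Rewrite (Slide s x u b) n k => Rewrite (Slide s x u (negb b)) n k
  | Rewrite (Cancel a b u v) n k => Rewrite (Cancel a b u (negb v)) n k
  end.

Definition mem_sym s l := existsb (sym_eqb s) l.
Fixpoint dedup (T : Type) (eqb : T -> T -> bool) l : list T :=
  match l with
  | [] => []
  | a :: l' => if existsb (eqb a) l' then dedup eqb l' else a :: dedup eqb l'
  end.

(** Every naturality move of a wire already involved in a crossing, past any
generator present in the diagram.  At least one crossing must be there to begin
with, and the number of crossings may not exceed [bound], which keeps the
search finite. *)
Definition slide_moves (bound : nat) (st : state) : list state :=
  let syms := dedup sym_eqb (map snd (fst st)) in
  let cs := crossings (fst st) in
  let nc := length cs in
  let xs := dedup Nat.eqb (flat_map (fun s => sdom ar s) cs) in
  flat_map (fun s =>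
   let nu := length (sdom ar s) in let nv := length (scod ar s) in
   flat_map (fun x => flat_map (fun i => flat_map (fun j => flat_map (fun under =>
     let cl := (nu - i) + (nv - j) in
     let cr := i + j in
     let go cost gain (blk : diag) (f : nat -> nat -> list op) :=
       if (1 <=? cost) && (nc + gain <=? cost + bound)
          && forallb (fun n => negb (is_crossing (snd n)) || mem_sym (snd n) cs) blk
       then rewrites st blk f else [] in
     go cl cr (block_right s x i j under) (slide_ops s x i j under)
     ++ go cr cl (block_left s x i j under)
          (fun n k => map flip_op (rev (slide_ops s x i j under n k))))
    [false; true]) (seq 0 (S nv))) (seq 0 (S nu))) xs) syms.

Fixpoint pos_bits (b n : nat) (p : positive) : positive :=
  match b with 0 => p | S b' =>
    pos_bits b' (Nat.div2 n) (if Nat.odd n then xI p else xO p) end.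
Definition key_node (n : node) (p : positive) : positive :=
  let p := pos_bits 4 (fst n) p in
  match snd n with
  | Box i => pos_bits 5 i (xO p)
  | Over a b => pos_bits 4 a (pos_bits 4 b (xO (xI p)))
  | Under a b => pos_bits 4 a (pos_bits 4 b (xI (xI p)))
  end.
(** Diagrams are encoded as binary numbers, the keys of the tables of visited
states.  Numbers that need more bits than provided are truncated, which could
only make the search overlook a diagram. *)
Definition key (stage : nat) (d : diag) : positive :=
  fold_right key_node (pos_bits 4 stage 1%positive) d.

(** The diagrams reachable from the right-hand side by isotopies alone, with the
moves that lead to them: the search from the left-hand side succeeds when it
meets one of these. *)
Fixpoint closure (fuel budget bound : nat) (frontier : list state)
    (seen : PositiveMap.t (list op)) : PositiveMap.t (list op) :=
  match fuel with 0 => seen | S fuel' =>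
  match frontier with [] => seen | _ =>
  let step := fix step fr seen next budget :=
    match fr with
    | [] => (seen, next, budget)
    | st :: fr' =>
      match budget with 0 => (seen, next, 0) | S b =>
      let '(seen, next) := fold_left (fun '(seen, next) st' =>
          let st' := simplify 20 st' in
          let k := key 0 (fst st') in
          match PositiveMap.find k seen with
          | Some _ => (seen, next)
          | None => (PositiveMap.add k (snd st') seen, st' :: next)
          end) (slide_moves bound st) (seen, next) in
      step fr' seen next b
      end
    end in
  let '(seen, next, b) := step frontier seen [] budget in
  closure fuel' b bound (rev next) seen
  end end.

(** A given equation is written with one order of its generators, but the block
found in a diagram may realize another one; all orders related by interchange
are tried. *)
Definition orders (pat : diag) : list (diag * list op) :=
  let fix go fuel (todo : list (diag * list op)) (done : list (diag * list op)) :=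
    match fuel with 0 => done | S fuel' =>
    match todo with [] => done | (d, os) :: todo' =>
      if existsb (fun p => if diag_dec (fst p) d then true else false) done
      then go fuel' todo' done
      else go fuel' (flat_map (fun n =>
         match run_op eqs [] d (Swap n) with
         | Some d' => [(d', Swap n :: os)] | None => [] end) (seq 0 (length d)) ++ todo')
         ((d, os) :: done)
    end end in
  go 40 [(pat, [])] [].

Definition shift_op n o := match o with
  | Swap m => Swap (n + m)
  | Rewrite r m k => Rewrite r (n + m) k
  end.

Definition given_moves (i : nat) (pats : list (diag * list op)) (st : state) : list state :=
  flat_map (fun '(pat, os) =>
    rewrites st pat (fun n k => map (shift_op n) os ++ [Rewrite (Given i) n k])) pats.

Definition rule_patterns (i : nat) : list (diag * list op) :=
  match nth_error eqs i with
  | Some q => orders (flat 0 (eq_lhs q))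
  | None => []
  end.

(** Breadth-first search; a state is marked with the number of given equations
already used.  The fuel is large enough for [budget] to be the effective
limit. *)
Fixpoint search (fuel budget bound : nat)
    (rules : list (nat * list (diag * list op)))
    (goal : PositiveMap.t (list op)) (frontier : list (nat * state))
    (seen : PositiveMap.t unit) : option (list op * list op) :=
  match fuel with 0 => None | S fuel' =>
  match frontier with [] => None | _ =>
  let step := fix step fr seen next budget :=
    match fr with
    | [] => inl (seen, next, budget)
    | (i, st) :: fr' =>
      match budget with 0 => inr None | S b =>
      let new := map (pair i) (slide_moves bound st) ++
        match nth_error rules i with
        | Some (r, pats) => map (pair (S i)) (given_moves r pats st)
        | None => [] end in
      let res := (fix each new seen next := match new with
         | [] => inl (seen, next)
         | (i', st') :: new' =>
           let st' := simplify 20 st' in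
           match (if i' =? length rules
                  then PositiveMap.find (key 0 (fst st')) goal else None) with
           | Some os => inr (Some (rev (snd st'), rev os))
           | None =>
             let k := key i' (fst st') in
             match PositiveMap.find k seen with
             | Some _ => each new' seen next
             | None => each new' (PositiveMap.add k tt seen) ((i', st') :: next)
             end
           end
         end) new seen next in
      match res with
      | inl (seen, next) => step fr' seen next b
      | inr o => inr o
      end
      end
    end in
  match step frontier seen [] budget with
  | inl (seen, next, b) => search fuel' b bound rules goal (rev next) seen
  | inr o => o
  end
  end end.

Definition solve (budget bound : nat) (rules : list nat) u v (e1 e2 : expr ar u v)
    : option (list op * list op) :=
  let st1 := simplify 20 (normal (flat 0 e1) []) in
  let st2 := simplify 20 (normal (flat 0 e2) []) in
  let m := Nat.max (length (crossings (fst st1))) (length (crossings (fst st2))) + bound in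
  let goal := closure 30 (budget / 2) m [st2]
     (PositiveMap.add (key 0 (fst st2)) (snd st2) (PositiveMap.empty _)) in
  match (match rules with [] => PositiveMap.find (key 0 (fst st1)) goal | _ => None end) with
  | Some os => Some (rev (snd st1), rev os)
  | None =>
  search 60 budget m (map (fun r => (r, rule_patterns r)) rules) goal [(0, st1)]
    (PositiveMap.add (key 0 (fst st1)) tt (PositiveMap.empty _))
  end.

End Search.

(** * The tactic for diagrammatic equations *)

(** Objects are compared up to conversion, as the carriers of modules and of
their products appear in several convertible forms; boxes are compared
syntactically. *)
Ltac same_term x y := first [constr_eq x y | unify x y].

Ltac position x l :=
  match l with
  | cons ?y ?t =>
      match constr:(tt) with
      | _ => let _ := match constr:(tt) with _ => same_term x y end in constr:(O)
      | _ => let n := position x t in constr:(S n)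
      end
  end.

Ltac box_position x l :=
  match l with
  | pair ?y ?t =>
      match constr:(tt) with
      | _ => let _ := match constr:(tt) with _ => constr_eq x y end in constr:(O)
      | _ => let n := box_position x t in constr:(S n)
      end
  end.

Ltac snoc_ob l x :=
  match l with
  | nil => constr:(cons x l)
  | cons ?y ?t => let t' := snoc_ob t x in constr:(cons y t')
  end.

Ltac add_ob x obs :=
  match constr:(tt) with
  | _ => let _ := position x obs in obs
  | _ => snoc_ob obs x
  end.

Ltac add_word w obs :=
  let w := eval cbn [app] in w in
  match w with
  | nil => obs
  | cons ?x ?t => let obs := add_ob x obs in add_word t obs
  end.

Ltac snoc_box l x :=
  match l with
  | tt => constr:(pair x tt)
  | pair ?y ?t => let t' := snoc_box t x in constr:(pair y t')
  end.

Ltac collect t acc :=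
  match t with
  | @wcomp _ _ _ _ _ ?g ?f => let acc := collect f acc in collect g acc
  | @wtens _ _ _ _ _ _ ?f ?g => let acc := collect f acc in collect g acc
  | @wid _ _ ?u =>
      match acc with (?obs, ?bx) => let obs := add_word u obs in constr:((obs, bx)) end
  | @wbraid _ ?X ?Y =>
      match acc with (?obs, ?bx) =>
        let obs := add_ob X obs in let obs := add_ob Y obs in constr:((obs, bx)) end
  | @wbraidV _ ?X ?Y =>
      match acc with (?obs, ?bx) =>
        let obs := add_ob X obs in let obs := add_ob Y obs in constr:((obs, bx)) end
  | _ =>
      match acc with (?obs, ?bx) =>
        match constr:(tt) with
        | _ => let _ := box_position t bx in acc
        | _ =>
          let T := type of t in
          match T with
          | @whom _ _ ?u ?v =>
            let obs := add_word u obs in let obs := add_word v obs in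
            let bx := snoc_box bx t in constr:((obs, bx))
          end
        end
      end
  end.

Ltac code_word obs w :=
  let w := eval cbn [app] in w in
  match w with
  | nil => constr:(@nil nat)
  | cons ?x ?t => let n := position x obs in let l := code_word obs t in
      constr:(@cons nat n l)
  end.

Ltac box_arities obs bx :=
  match bx with
  | tt => constr:(@nil arity)
  | pair ?t ?r =>
      let T := type of t in
      match T with
      | @whom _ _ ?u ?v =>
        let u := code_word obs u in let v := code_word obs v in
        let l := box_arities obs r in constr:(@cons arity (u, v) l)
      end
  end.

Ltac reify ar obs bx t :=
  match t with
  | @wcomp _ _ ?u ?v ?w ?g ?f =>
      let u := code_word obs u in let v := code_word obs v in
      let w := code_word obs w in
      let g := reify ar obs bx g in let f := reify ar obs bx f in
      constr:(@EComp ar u v w g f)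
  | @wtens _ _ ?u ?u' ?v ?v' ?f ?g =>
      let u := code_word obs u in let v := code_word obs v in
      let u' := code_word obs u' in let v' := code_word obs v' in
      let g := reify ar obs bx g in let f := reify ar obs bx f in
      constr:(@ETens ar u u' v v' f g)
  | @wid _ _ ?u => let u := code_word obs u in constr:(@EId ar u)
  | @wbraid _ ?X ?Y =>
      let a := position X obs in let b := position Y obs in constr:(EOver ar a b)
  | @wbraidV _ ?X ?Y =>
      let a := position X obs in let b := position Y obs in constr:(EUnder ar a b)
  | _ => let i := box_position t bx in constr:(EBox ar i)
  end.

Ltac collect_eqs Es acc :=
  match Es with
  | tt => acc
  | pair ?Es' ?E => let acc := collect_eqs Es' acc in collect_eqs E acc
  | ?E => let T := type of E in
      match T with @eq _ ?f ?g => let acc := collect f acc in collect g acc end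
  end.

Ltac reify_eqs ar obs bx Es l :=
  match Es with
  | tt => l
  | pair ?Es' ?E => let l := reify_eqs ar obs bx E l in reify_eqs ar obs bx Es' l
  | ?E => let T := type of E in
      match T with @eq (@whom _ _ ?u ?v) ?f ?g =>
        let u := code_word obs u in let v := code_word obs v in
        let f := reify ar obs bx f in let g := reify ar obs bx g in
        constr:(@cons (equation ar) (@Equation ar u v f g) l)
      end
  end.

Ltac eqs_proof Es p :=
  match Es with
  | tt => p
  | pair ?Es' ?E => let p := eqs_proof E p in eqs_proof Es' p
  | ?E => constr:(conj E p)
  end.

Ltac count_eqs Es :=
  match Es with
  | tt => constr:(O)
  | pair ?Es' ?E => let n := count_eqs Es' in constr:(S n)
  | _ => constr:(1)
  end.

Ltac diagram_core budget bound Es :=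
  match goal with
  | |- @eq (@whom _ (bmon ?B) ?u ?v) ?f ?g =>
    let acc := constr:((@nil (ob (bcat B)), tt)) in
    let acc := collect f acc in
    let acc := collect g acc in
    let acc := collect_eqs Es acc in
    match acc with (?obs, ?bx) =>
      let ar := box_arities obs bx in
      let u := code_word obs u in let v := code_word obs v in
      let e1 := reify ar obs bx f in
      let e2 := reify ar obs bx g in
      let nil0 := constr:(@nil (equation ar)) in
      let qs := reify_eqs ar obs bx Es nil0 in
      let n := count_eqs Es in
      let r := eval vm_compute in
        (@solve ar qs u budget bound (seq 0 n) u v e1 e2) in
      match r with
      | Some (?a, ?b) =>
        let P := eqs_proof Es I in
        exact (@check_sound B obs ar (bx : @boxes B obs ar) qs P u v e1 e2 a b eq_refl)
      | None => fail 1 "no isotopy found"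
      end
    end
  end.

(** [diagram (E1, ..., En)] proves f = g by transforming f: each Ei is used once,
from left to right and in this order, with isotopies in between.  A defined
morphism is a box like any other; it is unfolded by giving the equation with
its definition.  The variant [within n extra k] explores up to [n] states, and
allows diagrams with up to [k] crossings more than f and g have. *)
Tactic Notation "diagram" := diagram_core 100 1 tt.
Tactic Notation "diagram" constr(Es) := diagram_core 100 1 Es.
Tactic Notation "diagram" constr(Es) "within" constr(n) "extra" constr(k) :=
  diagram_core n k Es.

(** * Regular epimorphisms and non-degeneracy for words *)

Section RegularEpis.
Variable C : category.
Implicit Types X Y Z Q : C.

Lemma regular_epi_epi Y Q Z (q : hom Y Q) (g h : hom Q Z) :
  regular_epi q -> g · q = h · q -> g = h.
Proof.
case=> X [a [b [e U]]] E.
have [|k [_ kU]] := U Z (g · q); first by rewrite -!compA e.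
by rewrite -(kU g erefl) (kU h (esym E)).
Qed.

Lemma regular_epi_factor Y Q Z (q : hom Y Q) (f : hom Y Z) :
  regular_epi q ->
  (forall X (a b : hom X Y), q · a = q · b -> f · a = f · b) ->
  exists k, k · q = f.
Proof.
by case=> X [a [b [e U]]] F; have [k [kE _]] := U Z f (F X a b e); exists k.
Qed.

(** If f is epi and g.f is the coequalizer of a and b, then g is the coequalizer
of f.a and f.b. *)
Lemma regular_epi_cancel X Y Z (g : hom Y Z) (f : hom X Y) :
  (forall W (a b : hom Y W), a · f = b · f -> a = b) ->
  regular_epi (g · f) -> regular_epi g.
Proof.
move=> fE [W [a [b [e U]]]]; exists W, (f · a), (f · b); split.
  by rewrite !compA.
move=> V h E; have [|k [kE kU]] := U V (h · f); first by rewrite -!compA.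
exists k; split; first by apply: fE; rewrite -compA.
by move=> k' k'E; apply: kU; rewrite compA k'E.
Qed.

Lemma split_epi_regular X Y (q : hom X Y) (i : hom Y X) :
  q · i = idm _ -> regular_epi q.
Proof.
move=> qi; exists X, (i · q), (idm X); split; first by rewrite compA qi comp1m compm1.
move=> Z h; rewrite compm1 => E; exists (h · i); split; first by rewrite -compA.
by move=> k <-; rewrite -compA qi compm1.
Qed.

(** Used with the coherence isomorphisms that relate the product of words to
their concatenation. *)
Lemma coequalizer_iso X X' Y Y' Q Q' (a b : hom X Y) (q : hom Y Q)
    (k : hom X' X) (kV : hom X X') (i : hom Y Y') (iV : hom Y' Y)
    (l : hom Q Q') (lV : hom Q' Q) :
  k · kV = idm _ -> i · iV = idm _ -> iV · i = idm _ -> l · lV = idm _ ->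
  lV · l = idm _ ->
  is_coequalizer a b q -> is_coequalizer (i · a · k) (i · b · k) (l · q · iV).
Proof.
move=> kK iK iVK lK lVK [e U]; split.
  rewrite !compA -(compA (l · q) iV i) iVK compm1.
  by rewrite -(compA l q) e !compA.
move=> Z h E.
have [|f [fE fU]] := U Z (h · i).
  by apply: (epi_split kK); rewrite -!compA !compA in E *.
exists (f · lV); split.
  by rewrite !compA -(compA f) lVK compm1 fE -compA iK compm1.
move=> f' f'E; have -> : f = f' · l by apply: fU; rewrite -f'E -!compA iVK compm1.
by rewrite -compA lK compm1.
Qed.

End RegularEpis.

Section WordEpis.
Variables (C : category) (M : monoidal C).
Hypothesis preserved : tensor_preserves_coequalizers M.
Implicit Types x y u v w : list C.

Lemma slice_coequalizer x y s u v (a b : whom M s u) (q : whom M u v) :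
  is_coequalizer a b q ->
  is_coequalizer (slice x a y) (slice x b y) (slice x q y).
Proof.
move=> E.
have R z : is_coequalizer (a ⊗ wid M z) (b ⊗ wid M z) (q ⊗ wid M z).
  rewrite !wtensE; have [_] := preserved E (wob M z).
  exact: (coequalizer_iso (phiK M s z) (phiVK M u z) (phiK M u z) (phiVK M v z)
    (phiK M v z)).
rewrite /slice !(wtensE (wid M x)); have [+ _] := preserved (R y) (wob M x).
exact: (coequalizer_iso (phiK M x (s ++ y)) (phiVK M x (u ++ y))
  (phiK M x (u ++ y)) (phiVK M x (v ++ y)) (phiK M x (v ++ y))).
Qed.

Lemma slice_regular_epi x y u v (q : whom M u v) :
  regular_epi q -> regular_epi (slice x q y).
Proof.
case=> X [a [b E]]; exists (wob M (x ++ [X] ++ y)), (slice x (a : whom M [X] u) y),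
  (slice x (b : whom M [X] u) y); exact: (@slice_coequalizer x y [X]).
Qed.

Lemma coequalizer_factor x y s u v w (a b : whom M s u) (q : whom M u v)
    (f : whom M (x ++ u ++ y) w) :
  is_coequalizer a b q ->
  f ∘ (wid M x ⊗ a ⊗ wid M y) = f ∘ (wid M x ⊗ b ⊗ wid M y) ->
  exists k, k ∘ (wid M x ⊗ q ⊗ wid M y) = f.
Proof.
move=> E F; have [_ U] := slice_coequalizer x y E.
by have [k [kE _]] := U _ f F; exists k.
Qed.

Lemma slice_cancel x y u v w (q : whom M u v) (g h : whom M (x ++ v ++ y) w) :
  regular_epi q ->
  g ∘ (wid M x ⊗ q ⊗ wid M y) = h ∘ (wid M x ⊗ q ⊗ wid M y) -> g = h.
Proof. by move=> /(slice_regular_epi x y); apply: regular_epi_epi. Qed.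

Lemma left_regular_epi x u v (q : whom M u v) :
  regular_epi q -> regular_epi (wid M x ⊗ q).
Proof.
case=> X [a [b E]]; rewrite wtensE; have [E' _] := preserved E (wob M x).
have := coequalizer_iso (phiK M x [X]) (phiVK M x u) (phiK M x u) (phiVK M x v)
  (phiK M x v) E'.
by exists (wob M (x ++ [X])), (phi M x u · tensm M (idm _) a · phiV M x [X]),
  (phi M x u · tensm M (idm _) b · phiV M x [X]).
Qed.

Lemma right_regular_epi y u v (q : whom M u v) :
  regular_epi q -> regular_epi (q ⊗ wid M y).
Proof.
case=> X [a [b E]]; rewrite wtensE; have [_ E'] := preserved E (wob M y).
have := coequalizer_iso (phiK M [X] y) (phiVK M u y) (phiK M u y) (phiVK M v y)
  (phiK M v y) E'.
by exists (wob M ([X] ++ y)), (phi M u y · tensm M a (idm _) · phiV M [X] y),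
  (phi M u y · tensm M b (idm _) · phiV M [X] y).
Qed.

Lemma word_epi u v w (q : whom M u v) (g h : whom M v w) :
  regular_epi q -> g ∘ q = h ∘ q -> g = h.
Proof. exact: regular_epi_epi. Qed.

Lemma word_factor u v w (q : whom M u v) (f : whom M u w) :
  regular_epi q ->
  (forall X (a b : whom M [X] u), q ∘ a = q ∘ b -> f ∘ a = f ∘ b) ->
  exists k : whom M v w, k ∘ q = f.
Proof. exact: regular_epi_factor. Qed.

End WordEpis.

Section Pack.
Variables (C : category) (M : monoidal C).

(** A word and the object that it denotes are isomorphic by the identity;
[pack] and [unpack] let conditions on single objects be used for words. *)
Definition pack (w : list C) : whom M w [wob M w] := idm (wob M w).
Definition unpack (w : list C) : whom M [wob M w] w := idm (wob M w).

Lemma packK w : unpack w ∘ pack w = wid M w.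
Proof. exact: comp1m. Qed.

(** Non-degeneracy on the left, for morphisms with values in any word; the
pairing below takes values in the empty one. *)
Definition faithful_left (Y : C -> Prop) (Z V : C) (w0 : list C)
    (v : whom M [Z; V] w0) : Prop :=
  forall X P : C, Y P -> forall g h : whom M [X] [V; P],
    (v ⊗ ⟨P⟩) ∘ (⟨Z⟩ ⊗ g) = (v ⊗ ⟨P⟩) ∘ (⟨Z⟩ ⊗ h) -> g = h.

Lemma faithful_left_word Y Z V w0 (v : whom M [Z; V] w0) (u w : list C)
    (g h : whom M u (V :: w)) :
  faithful_left Y v -> Y (wob M w) ->
  (v ⊗ wid M w) ∘ (⟨Z⟩ ⊗ g) = (v ⊗ wid M w) ∘ (⟨Z⟩ ⊗ h) -> g = h.
Proof.
move=> nd Yw E.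
pose k f : whom M [wob M u] [V; wob M w] := (⟨V⟩ ⊗ pack w) ∘ (f ∘ unpack u).
have K f : (⟨V⟩ ⊗ unpack w) ∘ (k f ∘ pack u) = f.
  rewrite /k -!wcompA packK wcompm1 wcompA.
  by rewrite -(wlM [V] (unpack w) (pack w)) packK wtens1 wcomp1m.
have F f : (v ⊗ ⟨wob M w⟩) ∘ (⟨Z⟩ ⊗ k f)
    = (wid M w0 ⊗ pack w) ∘ ((v ⊗ wid M w) ∘ (⟨Z⟩ ⊗ f)) ∘ (⟨Z⟩ ⊗ unpack u).
  rewrite /k (wlM [Z] (⟨V⟩ ⊗ pack w)) (wlM [Z] f) -(wid2l Z V).
  by rewrite !wcompA (wslide v (pack w)).
rewrite -(K g) -(K h); congr (_ ∘ (_ ∘ _)).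
by apply: (nd _ _ Yw); rewrite !F E.
Qed.

Definition faithful_right (Y : C -> Prop) (V Z : C) (w0 : list C)
    (v : whom M [V; Z] w0) : Prop :=
  forall X P : C, Y P -> forall g h : whom M [X] [P; V],
    (⟨P⟩ ⊗ v) ∘ (g ⊗ ⟨Z⟩) = (⟨P⟩ ⊗ v) ∘ (h ⊗ ⟨Z⟩) -> g = h.

Lemma faithful_right_word Y V Z w0 (v : whom M [V; Z] w0) (u : list C) P
    (g h : whom M u [P; V]) :
  faithful_right Y v -> Y P ->
  (⟨P⟩ ⊗ v) ∘ (g ⊗ ⟨Z⟩) = (⟨P⟩ ⊗ v) ∘ (h ⊗ ⟨Z⟩) -> g = h.
Proof.
move=> nd YP E.
have K (f : whom M u [P; V]) : (f ∘ unpack u) ∘ pack u = f.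
  by rewrite -wcompA packK wcompm1.
rewrite -(K g) -(K h); congr (_ ∘ _); apply: (nd _ _ YP).
by rewrite !(wrM [Z] _ (unpack u)) !wcompA E.
Qed.

Lemma faithful_right_word2 Y V Z w0 (v : whom M [V; Z] w0) (u : list C) P Q
    (g h : whom M u [P; Q; V]) :
  faithful_right Y v -> Y (tens M P Q) ->
  (wid M [P; Q] ⊗ v) ∘ (g ⊗ ⟨Z⟩) = (wid M [P; Q] ⊗ v) ∘ (h ⊗ ⟨Z⟩) -> g = h.
Proof.
move=> nd YP E.
have K (f : whom M u [P; Q; V]) :
    (unpack [P; Q] ⊗ ⟨V⟩) ∘ ((pack [P; Q] ⊗ ⟨V⟩) ∘ f) = f.
  by rewrite wcompA -(wrM [V] (unpack [P; Q])) packK wtens1 wcomp1m.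
rewrite -(K g) -(K h); congr (_ ∘ _); apply: (faithful_right_word nd YP).
have F : (⟨tens M P Q⟩ ⊗ v) ∘ ((pack [P; Q] ⊗ ⟨V⟩) ⊗ ⟨Z⟩)
    = (pack [P; Q] ⊗ wid M w0) ∘ (wid M [P; Q] ⊗ v).
  have := same_assoc (pack [P; Q]) ⟨V⟩ ⟨Z⟩.
  rewrite wtens1 => /same_eq /= ->; exact: esym (wslide (pack [P; Q]) v).
by rewrite !(wrM [Z] (pack [P; Q] ⊗ ⟨V⟩)) !wcompA F -!wcompA E.
Qed.

End Pack.

(** * Identities in a regular weak multiplier bimonoid *)

Section Identities.
Variables (B : bmcat) (A : B) (H : regular_wmb A).
Local Notation M := (bmon B).
Local Notation c := (wbraid A A).
Local Notation c' := (wbraidV A A).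
Local Notation "1" := ⟨A⟩.
Local Notation m := (rm H).
Local Notation t1 := (rt1 H).
Local Notation t2 := (rt2 H).
Local Notation t3 := (rt3 H).
Local Notation t4 := (rt4 H).
Local Notation e1 := (re1 H).
Local Notation e2 := (re2 H).
Local Notation j := (rj H).

Lemma m_t1 : m = (j ⊗ 1) ∘ t1.
Proof. by []. Qed.
Lemma m_t3 : (j ⊗ 1) ∘ t3 = m ∘ c'.
Proof.
have E : m = (j ⊗ 1) ∘ t3 ∘ c := rwmb_m_t3 (rwmbP H).
symmetry; diagram E.
Qed.
Lemma m_t4 : (1 ⊗ j) ∘ t4 = m ∘ c'.
Proof.
have E : m = (1 ⊗ j) ∘ t4 ∘ c := rwmb_m_t4 (rwmbP H).
symmetry; diagram E.
Qed.

Lemma m_12 : (m ⊗ 1) ∘ (1 ⊗ t1) = (1 ⊗ m) ∘ (t2 ⊗ 1).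
Proof. exact: rwmb_m12 (rwmbP H). Qed.
Lemma m_13 : (1 ⊗ m) ∘ (1 ⊗ c') ∘ (t1 ⊗ 1) = (1 ⊗ m) ∘ (t3 ⊗ 1) ∘ (1 ⊗ c').
Proof. exact: rwmb_m13 (rwmbP H). Qed.
Lemma m_14 : (m ⊗ 1) ∘ (c' ⊗ 1) ∘ (1 ⊗ t1) = (1 ⊗ m) ∘ (t4 ⊗ 1).
Proof. exact: rwmb_m14 (rwmbP H). Qed.
Lemma m_23 : (1 ⊗ m) ∘ (1 ⊗ c') ∘ (t2 ⊗ 1) = (m ⊗ 1) ∘ (1 ⊗ t3).
Proof. exact: rwmb_m23 (rwmbP H). Qed.
Lemma m_34 : (m ⊗ 1) ∘ (c' ⊗ 1) ∘ (1 ⊗ t3) = (1 ⊗ m) ∘ (1 ⊗ c') ∘ (t4 ⊗ 1).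
Proof. exact: rwmb_m34 (rwmbP H). Qed.

Lemma t1_fusion :
  (t1 ⊗ 1) ∘ (c' ⊗ 1) ∘ (1 ⊗ t1) ∘ (c ⊗ 1) ∘ (1 ⊗ t1) = (1 ⊗ t1) ∘ (t1 ⊗ 1).
Proof. exact: wcf_fusion (rwmb_f1 (rwmbP H)). Qed.
Lemma t3_fusion :
  (t3 ⊗ 1) ∘ (c ⊗ 1) ∘ (1 ⊗ t3) ∘ (c' ⊗ 1) ∘ (1 ⊗ t3) = (1 ⊗ t3) ∘ (t3 ⊗ 1).
Proof. exact: wcf_fusion (rwmb_f3 (rwmbP H)). Qed.
Lemma e1_t1 : e1 ∘ t1 = t1.
Proof. exact: wcf_et (rwmb_f1 (rwmbP H)). Qed.
Lemma d1_e1 :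
  (m ⊗ 1) ∘ (1 ⊗ c) ∘ (t1 ⊗ 1) ∘ (1 ⊗ c') ∘ (1 ⊗ e1)
  = (m ⊗ 1) ∘ (1 ⊗ c) ∘ (t1 ⊗ 1) ∘ (1 ⊗ c').
Proof. exact: wcf_me (rwmb_f1 (rwmbP H)). Qed.
Lemma e1_comm_t1 : (e1 ⊗ 1) ∘ (1 ⊗ t1) = (1 ⊗ t1) ∘ (e1 ⊗ 1).
Proof. exact: wcf_e1_1t (rwmb_f1 (rwmbP H)). Qed.
Lemma t1_counit1 :
  m ∘ (1 ⊗ 1 ⊗ j) ∘ (1 ⊗ e1) = m ∘ (1 ⊗ j ⊗ 1) ∘ (t1 ⊗ 1) ∘ (1 ⊗ c').
Proof.
have E : m ∘ (1 ⊗ j ⊗ 1) ∘ (t1 ⊗ 1) = m ∘ (1 ⊗ 1 ⊗ j) ∘ (1 ⊗ e1) ∘ (1 ⊗ c).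
  exact: wcf_counit1 (rwmb_f1 (rwmbP H)).
symmetry; diagram E.
Qed.
Lemma t1_counit2 :
  m ∘ (1 ⊗ j ⊗ 1) ∘ (1 ⊗ e1) = (j ⊗ 1) ∘ (m ⊗ 1) ∘ (1 ⊗ c) ∘ (t1 ⊗ 1) ∘ (1 ⊗ c').
Proof.
have E : (j ⊗ 1) ∘ (m ⊗ 1) ∘ (1 ⊗ c) ∘ (t1 ⊗ 1) = m ∘ (1 ⊗ j ⊗ 1) ∘ (1 ⊗ e1) ∘ (1 ⊗ c).
  exact: wcf_counit2 (rwmb_f1 (rwmbP H)).
symmetry; diagram E.
Qed.
Lemma t3_counit1 :
  m ∘ c' ∘ (1 ⊗ 1 ⊗ j) ∘ (1 ⊗ e2) = m ∘ c' ∘ (1 ⊗ j ⊗ 1) ∘ (t3 ⊗ 1) ∘ (1 ⊗ c).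
Proof.
have E : m ∘ c' ∘ (1 ⊗ j ⊗ 1) ∘ (t3 ⊗ 1) = m ∘ c' ∘ (1 ⊗ 1 ⊗ j) ∘ (1 ⊗ e2) ∘ (1 ⊗ c').
  rewrite -m_t3; exact: wcf_counit1 (rwmb_f3 (rwmbP H)).
symmetry; diagram E.
Qed.
Lemma t3_counit2 :
  m ∘ c' ∘ (1 ⊗ j ⊗ 1) ∘ (1 ⊗ e2)
  = (j ⊗ 1) ∘ ((m ∘ c') ⊗ 1) ∘ (1 ⊗ c') ∘ (t3 ⊗ 1) ∘ (1 ⊗ c).
Proof.
have E : (j ⊗ 1) ∘ ((m ∘ c') ⊗ 1) ∘ (1 ⊗ c') ∘ (t3 ⊗ 1)
    = m ∘ c' ∘ (1 ⊗ j ⊗ 1) ∘ (1 ⊗ e2) ∘ (1 ⊗ c').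
  rewrite -m_t3; exact: wcf_counit2 (rwmb_f3 (rwmbP H)).
symmetry; diagram E.
Qed.

(** The axiom is stated for the reversed product, whose bracketing is the
opposite one; conjugating with the associativity isomorphism restores the
bracketing of words. *)
Lemma e1_comm_t4 : (1 ⊗ e1) ∘ (t4 ⊗ 1) = (t4 ⊗ 1) ∘ (1 ⊗ e1).
Proof.
have := wcf_e1_1t (rwmb_f4 (rwmbP H)).
rewrite /wcomp !wtensE /= /wid !tensm1 ?compm1 ?comp1m => E.
apply: (mono_split (assocVK M A A A)).
rewrite !compA in E *; rewrite E assocK comp1m.
by rewrite -!compA assocVK compm1.
Qed.

Lemma t2_t1 : (t2 ⊗ 1) ∘ (1 ⊗ t1) = (1 ⊗ t1) ∘ (t2 ⊗ 1).
Proof. exact: rwmb_t21 (rwmbP H). Qed.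
Lemma t2_t3 : (t2 ⊗ 1) ∘ (1 ⊗ t3) = (1 ⊗ t3) ∘ (t2 ⊗ 1).
Proof. exact: rwmb_t23 (rwmbP H). Qed.
Lemma t4_t1 : (t4 ⊗ 1) ∘ (1 ⊗ t1) = (1 ⊗ t1) ∘ (t4 ⊗ 1).
Proof. exact: rwmb_t41 (rwmbP H). Qed.
Lemma t4_t3 : (t4 ⊗ 1) ∘ (1 ⊗ t3) = (1 ⊗ t3) ∘ (t4 ⊗ 1).
Proof. exact: rwmb_t43 (rwmbP H). Qed.
Lemma e1_e2 :
  (m ⊗ m) ∘ (1 ⊗ c ⊗ 1) ∘ (1 ⊗ 1 ⊗ e1) = (m ⊗ m) ∘ (1 ⊗ c ⊗ 1) ∘ (e2 ⊗ 1 ⊗ 1).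
Proof. exact: rwmb_e12 (rwmbP H). Qed.

(** The fusion equation turns m.(m1) into the second counit law applied to t1,
and there the idempotent e1 is absorbed by t1. *)
Lemma m_assoc : m ∘ (m ⊗ 1) = m ∘ (1 ⊗ m).
Proof.
have E : m ∘ (m ⊗ 1) = (j ⊗ 1) ∘ (m ⊗ 1) ∘ (1 ⊗ c) ∘ (t1 ⊗ 1) ∘ (1 ⊗ c') ∘ (1 ⊗ t1).
  diagram (m_t1, m_t1, eq_sym t1_fusion, eq_sym m_t1).
diagram (E, eq_sym t1_counit2, e1_t1, eq_sym m_t1).
Qed.

(** Applying the counit j to the first factor of the fusion equation turns one
of the maps t1 into m. *)
Lemma t1_mult : t1 ∘ (m ⊗ 1) = (m ⊗ 1) ∘ (c' ⊗ 1) ∘ (1 ⊗ t1) ∘ (c ⊗ 1) ∘ (1 ⊗ t1).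
Proof. diagram (m_t1, eq_sym t1_fusion, eq_sym m_t1). Qed.

Lemma t3_mult :
  t3 ∘ (m ⊗ 1) = (m ⊗ 1) ∘ (1 ⊗ t3) ∘ (c' ⊗ 1) ∘ (1 ⊗ t3) ∘ (c ⊗ 1).
Proof.
have E : t3 ∘ ((m ∘ c') ⊗ 1)
    = ((m ∘ c') ⊗ 1) ∘ (c ⊗ 1) ∘ (1 ⊗ t3) ∘ (c' ⊗ 1) ∘ (1 ⊗ t3).
  diagram (eq_sym m_t3, eq_sym t3_fusion, m_t3).
transitivity (t3 ∘ ((m ∘ c') ⊗ 1) ∘ (c ⊗ 1)); first by diagram.
rewrite E; diagram.
Qed.

(** If A has a unit, (j1).e1 is the map a⊗b ↦ π(a)b for an idempotent map π on A,
the projection to the base; (1j).e1, (j1).t2, (1j).t3, (j1).e2 and (1j).e2 are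
built in the same way from the four projections of a weak bimonoid.  This
lemma and the next ones replace a.(π(b)c) by (a.π(b)).c, where the map
a⊗b ↦ a.π(b) is again expressible by a structure morphism. *)
Lemma left_pi : m ∘ (1 ⊗ ((j ⊗ 1) ∘ e1)) = m ∘ (((j ⊗ 1) ∘ t4) ⊗ 1) ∘ (c ⊗ 1).
Proof. diagram (t1_counit2, m_14). Qed.

Lemma left_pi' : m ∘ (1 ⊗ ((1 ⊗ j) ∘ e1)) = m ∘ (((1 ⊗ j) ∘ t1) ⊗ 1) ∘ (1 ⊗ c').
Proof. diagram t1_counit1. Qed.

Lemma left_pibar : m ∘ (1 ⊗ ((j ⊗ 1) ∘ t2)) = m ∘ (((j ⊗ 1) ∘ e2) ⊗ 1) ∘ (c ⊗ 1).
Proof.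
have E : m ∘ (1 ⊗ ((j ⊗ 1) ∘ t2)) = (j ⊗ 1) ∘ (m ⊗ 1) ∘ (1 ⊗ t3) ∘ (1 ⊗ c) ∘ (c ⊗ 1).
  symmetry; diagram (eq_sym m_23).
have F : m ∘ (((j ⊗ 1) ∘ e2) ⊗ 1)
    = m ∘ c' ∘ (1 ⊗ j ⊗ 1) ∘ (1 ⊗ e2) ∘ (c ⊗ 1) ∘ (1 ⊗ c).
  symmetry; diagram.
rewrite E; symmetry; diagram (F, t3_counit2).
Qed.

Lemma left_pibar' :
  m ∘ (1 ⊗ ((1 ⊗ j) ∘ t3)) = m ∘ (((1 ⊗ j) ∘ e2) ⊗ 1) ∘ (1 ⊗ c').
Proof.
have F : m ∘ (((1 ⊗ j) ∘ e2) ⊗ 1) ∘ (1 ⊗ c')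
    = m ∘ c' ∘ (1 ⊗ 1 ⊗ j) ∘ (1 ⊗ e2) ∘ (1 ⊗ c') ∘ (1 ⊗ c) ∘ (c ⊗ 1).
  symmetry; diagram.
rewrite F; symmetry; diagram t3_counit1.
Qed.

(** The two counit laws of t1 bring both sides to the same form.  This equality
is what makes j.m and p.n1 factor through the coequalizer p. *)
Lemma jm_pi : j ∘ m ∘ (1 ⊗ ((j ⊗ 1) ∘ e1)) = j ∘ m ∘ (1 ⊗ ((1 ⊗ j) ∘ e1)).
Proof.
have E : j ∘ m ∘ (1 ⊗ ((j ⊗ 1) ∘ e1))
  = j ∘ (j ⊗ 1) ∘ (m ⊗ 1) ∘ (1 ⊗ c) ∘ (t1 ⊗ 1) ∘ (1 ⊗ c').
  diagram t1_counit2.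
rewrite E; symmetry; diagram t1_counit1.
Qed.

Lemma t1_e1 : t1 ∘ (((j ⊗ 1) ∘ e1) ⊗ 1) = (((j ⊗ 1) ∘ e1) ⊗ 1) ∘ (1 ⊗ t1).
Proof. diagram (eq_sym e1_comm_t1). Qed.
Lemma t4_e1 : t4 ∘ (1 ⊗ ((1 ⊗ j) ∘ e1)) = (1 ⊗ ((1 ⊗ j) ∘ e1)) ∘ (t4 ⊗ 1).
Proof. diagram (eq_sym e1_comm_t4). Qed.

(** Associativity of the multiplication of the base, seen through the pairing
with A. *)
Lemma jm_pi_assoc :
  j ∘ m ∘ (1 ⊗ ((j ⊗ 1) ∘ e1)) ∘ (1 ⊗ ((j ⊗ 1) ∘ e1) ⊗ 1)
  = j ∘ m ∘ (1 ⊗ ((j ⊗ 1) ∘ e1)) ∘ (1 ⊗ 1 ⊗ ((j ⊗ 1) ∘ e1)).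
Proof.
transitivity (j ∘ m ∘ ((((1 ⊗ j) ∘ t1) ∘ (((j ⊗ 1) ∘ t4) ⊗ 1)) ⊗ 1) ∘ (c ⊗ c')).
  diagram (jm_pi, left_pi', left_pi, t4_t1) within 300 extra 2.
symmetry; diagram (left_pi, jm_pi, left_pi').
Qed.

(** The comultiplication of the base can be described through either coaction;
after pairing both factors with A, this is the agreement of the two
descriptions. *)
Lemma jm_pibar : j ∘ m ∘ (1 ⊗ ((1 ⊗ j) ∘ t3)) = j ∘ m ∘ c' ∘ (((j ⊗ 1) ∘ t2) ⊗ 1).
Proof. diagram (eq_sym m_23). Qed.

Variable Y : B -> Prop.
Hypothesis Y_A : Y A.
Hypothesis Y_unit : Y (munit M).
Hypothesis m_faithful : faithful_left Y m.

(** A left multiplication moves the projection to the left, where it does not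
interfere with multiplications on the right; non-degeneracy of m then removes
the left multiplication.  The next three lemmas hold for the same reason. *)
Lemma pibar_linear : ((j ⊗ 1) ∘ t2) ∘ (1 ⊗ m) = m ∘ (((j ⊗ 1) ∘ t2) ⊗ 1).
Proof.
apply: (faithful_left_word m_faithful (w := [])) => //.
diagram (left_pibar, eq_sym m_assoc, eq_sym left_pibar, m_assoc).
Qed.

Lemma pibar'_linear : ((1 ⊗ j) ∘ t3) ∘ (m ⊗ 1) = m ∘ (((1 ⊗ j) ∘ t3) ⊗ 1) ∘ (1 ⊗ c').
Proof.
apply: (faithful_left_word m_faithful (w := [])) => //.
diagram (left_pibar', eq_sym m_assoc, eq_sym left_pibar', m_assoc).
Qed.

Lemma pi_linear : ((j ⊗ 1) ∘ e1) ∘ (1 ⊗ m) = m ∘ (((j ⊗ 1) ∘ e1) ⊗ 1).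
Proof.
apply: (faithful_left_word m_faithful (w := [])) => //.
diagram (left_pi, eq_sym m_assoc, eq_sym left_pi, m_assoc).
Qed.

Lemma pi'_linear : ((1 ⊗ j) ∘ e1) ∘ (m ⊗ 1) = m ∘ (((1 ⊗ j) ∘ e1) ⊗ 1) ∘ (1 ⊗ c').
Proof.
apply: (faithful_left_word m_faithful (w := [])) => //.
diagram (left_pi', eq_sym m_assoc, eq_sym left_pi', m_assoc).
Qed.

Lemma t1_linear : t1 ∘ (1 ⊗ m) = (1 ⊗ m) ∘ (t1 ⊗ 1).
Proof.
apply: (faithful_left_word m_faithful (w := [A])) => //.
diagram (m_12, eq_sym m_assoc, eq_sym m_12).
Qed.

(** Multiplying from the left turns t1 into t2, which commutes with t3. *)
Lemma t1_pibar' : (1 ⊗ ((1 ⊗ j) ∘ t3)) ∘ (t1 ⊗ 1) = t1 ∘ (((1 ⊗ j) ∘ t3) ⊗ 1) ∘ (1 ⊗ c').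
Proof.
apply: (faithful_left_word m_faithful (w := [A])) => //.
transitivity ((1 ⊗ m) ∘ (1 ⊗ ((1 ⊗ j) ∘ t3) ⊗ 1) ∘ (t2 ⊗ 1 ⊗ 1) ∘ (1 ⊗ 1 ⊗ c')).
  diagram (m_12, pibar'_linear).
symmetry; diagram (m_12, t2_t3).
Qed.

End Identities.

(** * The pairing of the bimonoid with its base object *)

Section Pairing.
Variables (B : bmcat) (A : B) (H : regular_wmb A).
Local Notation M := (bmon B).
Hypothesis preserved : tensor_preserves_coequalizers M.
Variables (L : B) (p : whom M [A] [L]).
Hypothesis p_base : is_base_object H p.
Local Notation "1" := ⟨A⟩.
Local Notation m := (rm H).
Local Notation t1 := (rt1 H).
Local Notation e1 := (re1 H).
Local Notation j := (rj H).

Lemma base_regular_epi : regular_epi p.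
Proof. by exists (tens M A A), ((j ⊗ 1) ∘ e1), ((1 ⊗ j) ∘ e1). Qed.

(** p is the coequalizer of (j1).e1 and (1j).e1, and the monoidal product
preserves it. *)
Lemma base_factor (V : B) w (f : whom M [V; A] w) :
  f ∘ (⟨V⟩ ⊗ ((j ⊗ 1) ∘ e1)) = f ∘ (⟨V⟩ ⊗ ((1 ⊗ j) ∘ e1)) ->
  exists k : whom M [V; L] w, k ∘ (⟨V⟩ ⊗ p) = f.
Proof.
move=> E.
(* A product with an empty word on the right is the same only up to a cast. *)
have N (s t : list B) (a : whom M s t) :
    same (wid M [V] ⊗ a ⊗ wid M []) (wid M [V] ⊗ a).
  by apply: (@same_tens _ _ _ _ _ _ _ _ _ _ ⟨V⟩ _ ⟨V⟩) => //; apply: same_nil.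
have Np := same_eq (N _ _ p : same (_ : whom M [V; A] [V; L]) _).
have [|k kE] := @coequalizer_factor _ _ preserved [V] [] [A; A] [A] [L] w _ _ p f p_base.
  rewrite (same_eq (N [A; A] [A] ((j ⊗ 1) ∘ e1)
    : same (_ : whom M [V; A; A] [V; A]) _)) E.
  by rewrite (same_eq (N [A; A] [A] ((1 ⊗ j) ∘ e1)
    : same (_ : whom M [V; A; A] [V; A]) _)).
by exists k; rewrite -kE Np.
Qed.

Lemma pairing_exists : exists β : whom M [A; L] [], β ∘ (1 ⊗ p) = j ∘ m.
Proof. by apply: base_factor; apply: jm_pi. Qed.

Lemma counit_exists : exists ε : whom M [L] [], ε ∘ p = j.
Proof.
have [_ U] := p_base; have [|k [kE _]] := U (munit M) j; last by exists k.
change (j ∘ ((j ⊗ 1) ∘ e1) = j ∘ ((1 ⊗ j) ∘ e1)); diagram.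
Qed.

Section Faithful.
Variable β : whom M [A; L] [].
Hypothesis pairingE : β ∘ (1 ⊗ p) = j ∘ m.
Variable Y : B -> Prop.
Hypothesis m_faithful : faithful_left Y m.
Variable n1 : whom M [L; A] [A].
Hypothesis n1_def : n1 ∘ (p ⊗ 1) = (j ⊗ 1) ∘ e1.
Hypothesis n1_faithful : nondegenerate_right Y n1.

(** The second counit law of t1, read on the quotient L. *)
Lemma m_n1 :
  m ∘ (1 ⊗ n1) = (β ⊗ 1) ∘ (1 ⊗ wbraid A L) ∘ (t1 ⊗ ⟨L⟩) ∘ (1 ⊗ wbraidV L A).
Proof.
apply: (@slice_cancel _ _ preserved [A] [A] _ _ _ p); first exact: base_regular_epi.
symmetry; diagram (pairingE, eq_sym (t1_counit2 H), eq_sym n1_def).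
Qed.

(** If g and h become equal after pairing with A, then by [m_n1] so do their
images under n1 after a further multiplication by A on the left; now both m and
n1 are non-degenerate. *)
Lemma pairing_faithful : faithful_left Y β.
Proof.
move=> X P YP g h E.
apply: (n1_faithful YP); apply: (faithful_left_word m_faithful (w := [P])) => //.
have F (f : whom M [X] [L; P]) : (m ⊗ ⟨P⟩) ∘ (1 ⊗ (((n1 ∘ wbraid A L) ⊗ ⟨P⟩) ∘ (1 ⊗ f)))
   = wbraidV P A ∘ (((β ⊗ ⟨P⟩) ∘ (1 ⊗ f)) ⊗ 1) ∘ (1 ⊗ wbraid A X) ∘ (t1 ⊗ ⟨X⟩).
  diagram m_n1.
by rewrite !F E.
Qed.

End Faithful.
End Pairing.

(** * The base comonoid and its coactions on the bimonoid *)

Section BaseStructure.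
Variables (B : bmcat) (A : B) (H : regular_wmb A).
Local Notation M := (bmon B).
Hypothesis preserved : tensor_preserves_coequalizers M.
Hypothesis compose : regular_epis_compose B.
Variables (L : B) (p : whom M [A] [L]).
Hypothesis p_base : is_base_object H p.
Local Notation c := (wbraid A A).
Local Notation c' := (wbraidV A A).
Local Notation "1" := ⟨A⟩.
Local Notation m := (rm H).
Local Notation t1 := (rt1 H).
Local Notation t2 := (rt2 H).
Local Notation t3 := (rt3 H).
Local Notation t4 := (rt4 H).
Local Notation e1 := (re1 H).
Local Notation e2 := (re2 H).
Local Notation j := (rj H).

Hypothesis m_regular_epi : regular_epi m.
Variable Y : B -> Prop.
Hypothesis Y_A : Y A.
Hypothesis Y_L : Y L.
Hypothesis Y_unit : Y (munit M).
Hypothesis Y_tens : forall V W : B, Y V -> Y W -> Y (tens (bmon B) V W).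
Hypothesis m_faithful : faithful_left Y m.
Variable β : whom M [A; L] [].
Hypothesis pairingE : β ∘ (1 ⊗ p) = j ∘ m.
Hypothesis pairing_faithful : faithful_left Y β.
Variable n1 : whom M [L; A] [A].
Hypothesis n1_def : n1 ∘ (p ⊗ 1) = (j ⊗ 1) ∘ e1.

Let p_regular_epi : regular_epi p := base_regular_epi p_base.

Lemma m'_regular_epi : regular_epi (m ∘ c').
Proof.
apply: (compose (f := c')) m_regular_epi.
by apply: (split_epi_regular (i := c)); apply: braidK.
Qed.

Lemma pm_regular_epi : regular_epi (p ∘ m).
Proof. exact: (compose (f := m)). Qed.

(** The inverse braiding is the right one here: this pairing has to match t3 and
t4, which are fusion morphisms for the inverse braiding. *)
Definition pairing_r : whom M [L; A] [] := β ∘ wbraidV L A.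
Local Notation β' := pairing_r.

Lemma pairing_rE : β' ∘ (p ⊗ 1) = j ∘ m ∘ c'.
Proof.
have E : β' ∘ (p ⊗ 1) = β ∘ wbraidV L A ∘ (p ⊗ 1) by [].
diagram (E, pairingE).
Qed.

Lemma pairing_r_faithful : faithful_right Y β'.
Proof.
move=> X P YP g h E.
have K (f : whom M [X] [P; L]) : f = wbraid L P ∘ (wbraidV P L ∘ f).
  symmetry; diagram.
rewrite (K g) (K h); congr (_ ∘ _); apply: (pairing_faithful YP).
have F (f : whom M [X] [P; L]) : (β ⊗ ⟨P⟩) ∘ (1 ⊗ (wbraidV P L ∘ f))
    = ((⟨P⟩ ⊗ β') ∘ (f ⊗ 1)) ∘ wbraid A X.
  have E' : β' = β ∘ wbraidV L A by [].
  symmetry; diagram E'.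
by rewrite !F E.
Qed.

(** Paired with A and composed with (1x), the morphism p.n1 becomes j.m.(1x),
preceded by a morphism that does not involve x; by [jm_pi] this does not
distinguish (j1).e1 from (1j).e1. *)
Lemma mult_exists : exists μ : whom M [L; L] [L], μ ∘ (⟨L⟩ ⊗ p) = p ∘ n1.
Proof.
apply: (base_factor preserved p_base).
apply: (word_epi (right_regular_epi preserved [A; A] p_regular_epi)).
apply: (faithful_left_word pairing_faithful (w := [])) => //.
have E (X : whom M [A; A] [A]) :
    (β ⊗ wid M []) ∘ (1 ⊗ (p ∘ n1 ∘ (⟨L⟩ ⊗ X) ∘ (p ⊗ wid M [A; A])))
  = j ∘ m ∘ (1 ⊗ X) ∘ (((j ⊗ 1) ∘ t4) ⊗ 1 ⊗ 1) ∘ (c ⊗ 1 ⊗ 1).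
  diagram (pairingE, n1_def, left_pi H).
by rewrite !E (jm_pi H).
Qed.

(** Pairing both factors of (pp).t1 with A leaves an expression that depends
only on p.m, because t1 is turned into t2 and then into e2. *)
Lemma comult_exists : exists δ : whom M [L] [L; L], δ ∘ (p ∘ m) = (p ⊗ p) ∘ t1.
Proof.
apply: (word_factor pm_regular_epi) => X a b E.
apply: (faithful_left_word pairing_faithful (w := [L])) => //.
apply: (faithful_left_word pairing_faithful (w := [])) => //.
have F (f : whom M [X] [A; A]) :
  (β ⊗ wid M []) ∘ (1 ⊗ ((β ⊗ ⟨L⟩) ∘ (1 ⊗ ((p ⊗ p) ∘ t1 ∘ f))))
  = β ∘ (((j ⊗ 1) ∘ e2 ∘ c) ⊗ ⟨L⟩) ∘ (1 ⊗ 1 ⊗ (p ∘ m ∘ f)).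
  diagram (pairingE, pairingE, m_12 H, eq_sym (m_assoc H), left_pibar H, m_assoc H,
    eq_sym pairingE).
by rewrite !F E.
Qed.

Lemma coaction_exists : exists τ : whom M [A] [L; A], τ ∘ m = (p ⊗ 1) ∘ t1.
Proof.
apply: (word_factor m_regular_epi) => X a b E.
apply: (faithful_left_word pairing_faithful (w := [A])) => //.
apply: (faithful_left_word m_faithful (w := [])) => //.
have F (f : whom M [X] [A; A]) :
  (m ⊗ wid M []) ∘ (1 ⊗ ((β ⊗ 1) ∘ (1 ⊗ ((p ⊗ 1) ∘ t1 ∘ f))))
  = m ∘ (((j ⊗ 1) ∘ e2 ∘ c) ⊗ 1) ∘ (1 ⊗ 1 ⊗ (m ∘ f)).
  diagram (pairingE, m_12 H, eq_sym (m_assoc H), left_pibar H, m_assoc H).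
by rewrite !F E.
Qed.

Lemma coaction_r_exists : exists τ' : whom M [A] [A; L], τ' ∘ (m ∘ c') = (1 ⊗ p) ∘ t4.
Proof.
apply: (word_factor m'_regular_epi) => X a b E.
apply: (faithful_right_word pairing_r_faithful) => //.
apply: (faithful_left_word m_faithful (w := [])) => //.
have F (f : whom M [X] [A; A]) :
  (m ⊗ wid M []) ∘ (1 ⊗ ((1 ⊗ β') ∘ (((1 ⊗ p) ∘ t4 ∘ f) ⊗ 1)))
  = m ∘ (((1 ⊗ j) ∘ e2) ⊗ 1) ∘ (1 ⊗ c') ∘ (1 ⊗ (m ∘ c' ∘ f) ⊗ 1).
  diagram (pairing_rE, eq_sym (m_34 H), eq_sym (m_assoc H), left_pibar' H, m_assoc H).
by rewrite !F E.
Qed.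

Section Structure.
Variables (μ : whom M [L; L] [L]) (δ : whom M [L] [L; L]) (ε : whom M [L] []).
Variables (τ : whom M [A] [L; A]) (τ' : whom M [A] [A; L]).
Hypothesis μE : μ ∘ (⟨L⟩ ⊗ p) = p ∘ n1.
Hypothesis δE : δ ∘ (p ∘ m) = (p ⊗ p) ∘ t1.
Hypothesis εE : ε ∘ p = j.
Hypothesis τE : τ ∘ m = (p ⊗ 1) ∘ t1.
Hypothesis τ'E : τ' ∘ (m ∘ c') = (1 ⊗ p) ∘ t4.

(** Up to the pairing, the coaction is (j1).t2: its properties will all follow
from those of t2. *)
Lemma tau_pairing : (β ⊗ 1) ∘ (1 ⊗ τ) = (j ⊗ 1) ∘ t2.
Proof.
apply: (word_epi (left_regular_epi preserved [A] m_regular_epi)).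
symmetry; diagram (pibar_linear Y_unit m_faithful, eq_sym (m_12 H), eq_sym pairingE,
  eq_sym τE).
Qed.

(** Up to the pairing, the right coaction is (1j).t3. *)
Lemma tau_pairing' : (1 ⊗ β') ∘ (τ' ⊗ 1) = (1 ⊗ j) ∘ t3.
Proof.
apply: (word_epi (right_regular_epi preserved [A] m'_regular_epi)).
symmetry; diagram (pibar'_linear Y_unit m_faithful, m_34 H, eq_sym pairing_rE, eq_sym τ'E).
Qed.

Lemma delta_tau : δ ∘ p = (⟨L⟩ ⊗ p) ∘ τ.
Proof. apply: (word_epi m_regular_epi); diagram (δE, eq_sym τE). Qed.

Lemma tau_linear : τ ∘ m = (⟨L⟩ ⊗ m) ∘ (τ ⊗ 1).
Proof.
apply: (faithful_left_word pairing_faithful (w := [A])) => //.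
diagram (tau_pairing, pibar_linear Y_unit m_faithful, eq_sym tau_pairing).
Qed.

Lemma tau'_linear : τ' ∘ m = (m ⊗ ⟨L⟩) ∘ (1 ⊗ wbraid L A) ∘ (τ' ⊗ 1).
Proof.
apply: (faithful_right_word pairing_r_faithful) => //.
diagram (tau_pairing', pibar'_linear Y_unit m_faithful, eq_sym tau_pairing').
Qed.

(** The definition of δ prefers t1 to t4; that the right coaction has the same
relation to δ is seen by pairing both factors, where it becomes
[jm_pibar]. *)
Lemma delta_tau' : δ ∘ p = (p ⊗ ⟨L⟩) ∘ τ'.
Proof.
rewrite delta_tau.
apply: (faithful_left_word pairing_faithful (w := [L])) => //.
apply: (faithful_left_word pairing_faithful (w := [])) => //.
have E : β' = β ∘ wbraidV L A by [].
transitivity (j ∘ m ∘ (1 ⊗ ((1 ⊗ j) ∘ t3)) ∘ (1 ⊗ c) ∘ (c ⊗ 1)).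
  transitivity (j ∘ m ∘ (1 ⊗ ((j ⊗ 1) ∘ t2))).
    diagram (tau_pairing, pairingE).
  symmetry; diagram (jm_pibar H).
diagram (eq_sym tau_pairing', E, eq_sym pairingE).
Qed.

Lemma tau_t1 : (τ ⊗ 1) ∘ t1 = (⟨L⟩ ⊗ t1) ∘ (τ ⊗ 1).
Proof.
apply: (faithful_left_word pairing_faithful (w := [A; A])); first exact: Y_tens.
diagram (tau_pairing, t2_t1 H, eq_sym tau_pairing).
Qed.

Lemma tau'_t4 : (1 ⊗ τ') ∘ t4 = (t4 ⊗ ⟨L⟩) ∘ (1 ⊗ τ').
Proof.
apply: (faithful_right_word2 pairing_r_faithful); first exact: Y_tens.
diagram (tau_pairing', eq_sym (t4_t3 H), eq_sym tau_pairing').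
Qed.

(** Unlike in [tau'_t4], the coaction moves from the second factor to the first
one; this needs [t1_pibar']. *)
Lemma tau'_t1 : (1 ⊗ τ') ∘ t1 = (t1 ⊗ ⟨L⟩) ∘ (1 ⊗ wbraid L A) ∘ (τ' ⊗ 1).
Proof.
apply: (faithful_right_word2 pairing_r_faithful); first exact: Y_tens.
diagram (tau_pairing', t1_pibar' Y_A Y_unit m_faithful, eq_sym tau_pairing').
Qed.

Lemma p_pi : p ∘ ((j ⊗ 1) ∘ e1) = p ∘ ((1 ⊗ j) ∘ e1).
Proof. by case: p_base. Qed.

Lemma tau_coassoc : (δ ⊗ 1) ∘ τ = (⟨L⟩ ⊗ τ) ∘ τ.
Proof.
apply: (word_epi m_regular_epi).
transitivity ((⟨L⟩ ⊗ p ⊗ 1) ∘ (τ ⊗ 1) ∘ t1); first by diagram (τE, delta_tau).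
symmetry; diagram (tau_linear, τE, eq_sym tau_t1).
Qed.

Lemma tau_counit : (ε ⊗ 1) ∘ τ = 1.
Proof. apply: (word_epi m_regular_epi); diagram (τE, εE, eq_sym (m_t1 H)). Qed.

Lemma tau'_coassoc : (1 ⊗ δ) ∘ τ' = (τ' ⊗ ⟨L⟩) ∘ τ'.
Proof.
apply: (word_epi m'_regular_epi).
transitivity ((1 ⊗ p ⊗ ⟨L⟩) ∘ (1 ⊗ τ') ∘ t4); first by diagram (τ'E, delta_tau').
symmetry; diagram (tau'_linear, τ'E, eq_sym tau'_t4).
Qed.

Lemma tau'_counit : (1 ⊗ ε) ∘ τ' = 1.
Proof. apply: (word_epi m'_regular_epi); diagram (τ'E, εE, m_t4 H). Qed.

Lemma tau_tau' : (⟨L⟩ ⊗ τ') ∘ τ = (τ ⊗ ⟨L⟩) ∘ τ'.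
Proof.
apply: (faithful_left_word pairing_faithful (w := [A; L])); first exact: Y_tens.
apply: (faithful_right_word pairing_r_faithful) => //.
diagram (tau_pairing', tau_pairing, eq_sym (t2_t3 H), eq_sym tau_pairing', eq_sym tau_pairing).
Qed.

Lemma comul_coassoc : (δ ⊗ ⟨L⟩) ∘ δ = (⟨L⟩ ⊗ δ) ∘ δ.
Proof.
apply: (word_epi p_regular_epi).
diagram (delta_tau, tau_coassoc, eq_sym delta_tau, eq_sym delta_tau).
Qed.

Lemma comul_counitl : (ε ⊗ ⟨L⟩) ∘ δ = ⟨L⟩.
Proof. apply: (word_epi p_regular_epi); diagram (delta_tau, tau_counit). Qed.

Lemma comul_counitr : (⟨L⟩ ⊗ ε) ∘ δ = ⟨L⟩.
Proof. apply: (word_epi p_regular_epi); diagram (delta_tau', tau'_counit). Qed.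

Lemma mult_assoc : μ ∘ (μ ⊗ ⟨L⟩) = μ ∘ (⟨L⟩ ⊗ μ).
Proof.
apply: (word_epi (left_regular_epi preserved [L; L] p_regular_epi)).
apply: (word_epi (left_regular_epi preserved [L]
  (right_regular_epi preserved [A] p_regular_epi))).
apply: (word_epi (right_regular_epi preserved [A; A] p_regular_epi)).
apply: (faithful_left_word pairing_faithful (w := [])) => //.
transitivity (j ∘ m ∘ (1 ⊗ ((j ⊗ 1) ∘ e1)) ∘ (1 ⊗ ((j ⊗ 1) ∘ e1) ⊗ 1)).
  diagram (μE, n1_def, μE, n1_def, pairingE).
symmetry; diagram (μE, μE, n1_def, n1_def, pairingE, eq_sym (jm_pi_assoc H)).
Qed.

Lemma mult_comult : μ ∘ δ = ⟨L⟩.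
Proof.
apply: (word_epi pm_regular_epi); diagram (δE, μE, n1_def, e1_t1 H, eq_sym (m_t1 H)).
Qed.

(** On generators, this is the commutation of e1 with t1; similarly
[frobenius_r] is its commutation with t4. *)
Lemma frobenius_l : (μ ⊗ ⟨L⟩) ∘ (⟨L⟩ ⊗ δ) = δ ∘ μ.
Proof.
apply: (word_epi (left_regular_epi preserved [L] pm_regular_epi)).
apply: (word_epi (right_regular_epi preserved [A; A] p_regular_epi)).
transitivity ((p ⊗ p) ∘ (((j ⊗ 1) ∘ e1) ⊗ 1) ∘ (1 ⊗ t1)).
  diagram (δE, μE, n1_def).
symmetry; diagram (μE, n1_def, pi_linear Y_unit m_faithful, δE, t1_e1 H).
Qed.

Lemma frobenius_r : (⟨L⟩ ⊗ μ) ∘ (δ ⊗ ⟨L⟩) = δ ∘ μ.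
Proof.
apply: (word_epi (left_regular_epi preserved [L] p_regular_epi)).
apply: (word_epi (right_regular_epi preserved [A] p_regular_epi)).
apply: (word_epi (right_regular_epi preserved [A] m'_regular_epi)).
transitivity ((p ⊗ p) ∘ (1 ⊗ ((1 ⊗ j) ∘ e1)) ∘ (t4 ⊗ 1)).
  diagram (delta_tau', τ'E, μE, n1_def, p_pi).
symmetry; diagram (μE, n1_def, p_pi, pi'_linear Y_unit m_faithful, delta_tau', τ'E, t4_e1 H).
Qed.

End Structure.
End BaseStructure.

(** * Coactions on modules, and the first fusion map on a module *)

Section Modules.
Variables (B : bmcat) (A : B) (H : regular_wmb A).
Local Notation M := (bmon B).
Hypothesis preserved : tensor_preserves_coequalizers M.
Variable L : B.
Local Notation c := (wbraid A A).
Local Notation "1" := ⟨A⟩.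
Local Notation m := (rm H).
Local Notation t1 := (rt1 H).
Local Notation t2 := (rt2 H).
Local Notation t3 := (rt3 H).
Local Notation e2 := (re2 H).
Local Notation j := (rj H).

Variable Y : B -> Prop.
Hypothesis Y_unit : Y (munit M).
Hypothesis m_faithful : faithful_left Y m.
Variable β : whom M [A; L] [].
Hypothesis pairing_faithful : faithful_left Y β.
Local Notation β' := (pairing_r β).
Variables (τ : whom M [A] [L; A]) (τ' : whom M [A] [A; L]).
Hypothesis tau_pairing : (β ⊗ 1) ∘ (1 ⊗ τ) = (j ⊗ 1) ∘ t2.
Hypothesis tau_pairing' : (1 ⊗ β') ∘ (τ' ⊗ 1) = (1 ⊗ j) ∘ t3.
Implicit Types V W : amodule Y m.
Local Notation act := mod_act.

Lemma act_faithful V : faithful_left Y (act V).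
Proof. exact: mod_nondeg. Qed.

(** Pair the candidate (1v).(τ1) with A and act with A once more: the result
depends only on v. *)
Lemma module_lco_exists V : exists τV : whom M [mod_ob V] [L; mod_ob V],
  τV ∘ act V = (⟨L⟩ ⊗ act V) ∘ (τ ⊗ ⟨mod_ob V⟩).
Proof.
have YV := mod_class V.
apply: (word_factor (mod_regepi V)) => X a b E.
apply: (faithful_left_word pairing_faithful (w := [mod_ob V])) => //.
apply: (faithful_left_word (@act_faithful V) (w := [])) => //.
have F (f : whom M [X] [A; mod_ob V]) :
  (act V ⊗ wid M []) ∘ (1 ⊗ ((β ⊗ ⟨mod_ob V⟩)
    ∘ (1 ⊗ ((⟨L⟩ ⊗ act V) ∘ (τ ⊗ ⟨mod_ob V⟩) ∘ f))))
  = act V ∘ (((j ⊗ 1) ∘ e2 ∘ c) ⊗ ⟨mod_ob V⟩) ∘ (1 ⊗ 1 ⊗ (act V ∘ f)).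
  diagram (tau_pairing, mod_actA V, left_pibar H, eq_sym (mod_actA V)).
by rewrite !F E.
Qed.

Lemma module_rco_exists V : exists τV : whom M [mod_ob V] [mod_ob V; L],
  τV ∘ act V = (act V ⊗ ⟨L⟩) ∘ (1 ⊗ wbraid L (mod_ob V)) ∘ (τ' ⊗ ⟨mod_ob V⟩).
Proof.
have YV := mod_class V.
apply: (word_factor (mod_regepi V)) => X a b E.
apply: (faithful_right_word (pairing_r_faithful pairing_faithful)) => //.
apply: (faithful_left_word (@act_faithful V) (w := [])) => //.
have F (f : whom M [X] [A; mod_ob V]) :
  (act V ⊗ wid M []) ∘ (1 ⊗ ((⟨mod_ob V⟩ ⊗ β')
    ∘ (((act V ⊗ ⟨L⟩) ∘ (1 ⊗ wbraid L (mod_ob V)) ∘ (τ' ⊗ ⟨mod_ob V⟩) ∘ f) ⊗ 1)))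
  = act V ∘ (((1 ⊗ j) ∘ e2) ⊗ ⟨mod_ob V⟩) ∘ (1 ⊗ wbraidV (mod_ob V) A)
    ∘ (1 ⊗ (act V ∘ f) ⊗ 1).
  diagram (tau_pairing', mod_actA V, left_pibar' H, eq_sym (mod_actA V)).
by rewrite !F E.
Qed.

(** The fusion map t1 on a module W; it exists because multiplying by A on the
left makes (1w).(t1 1) depend on 1w only. *)
Lemma coproduct_exists W : exists T : whom M [A; mod_ob W] [A; mod_ob W],
  T ∘ (1 ⊗ act W) = (1 ⊗ act W) ∘ (t1 ⊗ ⟨mod_ob W⟩).
Proof.
have YV := mod_class W.
apply: (word_factor (left_regular_epi preserved [A] (mod_regepi W))) => X a b E.
apply: (faithful_left_word m_faithful (w := [mod_ob W])) => //.
have F (f : whom M [X] [A; A; mod_ob W]) :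
  (m ⊗ ⟨mod_ob W⟩) ∘ (1 ⊗ ((1 ⊗ act W) ∘ (t1 ⊗ ⟨mod_ob W⟩) ∘ f))
  = (1 ⊗ act W) ∘ (t2 ⊗ ⟨mod_ob W⟩) ∘ (1 ⊗ ((1 ⊗ act W) ∘ f)).
  diagram (m_12 H, eq_sym (mod_actA W)).
by rewrite !F E.
Qed.

Section Coactions.
Variable K : sf_comonoid M L.
Hypothesis bicA : is_bicomodule K τ τ'.
Variable V : amodule Y m.
Local Notation X := (mod_ob V).
Variables (τV : whom M [X] [L; X]) (τV' : whom M [X] [X; L]).
Hypothesis τVE : τV ∘ act V = (⟨L⟩ ⊗ act V) ∘ (τ ⊗ ⟨X⟩).
Hypothesis τV'E : τV' ∘ act V = (act V ⊗ ⟨L⟩) ∘ (1 ⊗ wbraid L X) ∘ (τ' ⊗ ⟨X⟩).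

(** As V is a quotient of the free module AV, the laws are inherited from A. *)
Lemma module_bicomodule : is_bicomodule K τV τV'.
Proof.
have [A1 A2 A3 A4 A5] := bicA.
split; apply: (word_epi (mod_regepi V)).
- transitivity ((wid M [L; L] ⊗ act V) ∘ (((⟨L⟩ ⊗ τ) ∘ τ) ⊗ ⟨X⟩)).
    diagram (τVE, A1).
  symmetry; diagram (τVE, τVE).
- diagram (τVE, A2).
- transitivity ((act V ⊗ ⟨L⟩ ⊗ ⟨L⟩) ∘ (1 ⊗ wbraid L X ⊗ ⟨L⟩)
     ∘ (1 ⊗ ⟨L⟩ ⊗ wbraid L X) ∘ (((τ' ⊗ ⟨L⟩) ∘ τ') ⊗ ⟨X⟩)).
    diagram (τV'E, A3).
  symmetry; diagram (τV'E, τV'E).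
- diagram (τV'E, A4).
- transitivity ((⟨L⟩ ⊗ act V ⊗ ⟨L⟩) ∘ (⟨L⟩ ⊗ 1 ⊗ wbraid L X)
     ∘ (((τ ⊗ ⟨L⟩) ∘ τ') ⊗ ⟨X⟩)).
    diagram (τVE, τV'E, A5).
  symmetry; diagram (τV'E, τVE).
Qed.

End Coactions.

Lemma module_map_bicomodule V W (f : amodule_map V W)
   (τV : whom M [mod_ob V] [L; mod_ob V]) (τV' : whom M [mod_ob V] [mod_ob V; L])
   (τW : whom M [mod_ob W] [L; mod_ob W]) (τW' : whom M [mod_ob W] [mod_ob W; L]) :
  τV ∘ act V = (⟨L⟩ ⊗ act V) ∘ (τ ⊗ ⟨mod_ob V⟩) ->
  τV' ∘ act V = (act V ⊗ ⟨L⟩) ∘ (1 ⊗ wbraid L (mod_ob V)) ∘ (τ' ⊗ ⟨mod_ob V⟩) ->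
  τW ∘ act W = (⟨L⟩ ⊗ act W) ∘ (τ ⊗ ⟨mod_ob W⟩) ->
  τW' ∘ act W = (act W ⊗ ⟨L⟩) ∘ (1 ⊗ wbraid L (mod_ob W)) ∘ (τ' ⊗ ⟨mod_ob W⟩) ->
  is_bicomodule_map τV τV' τW τW' f.
Proof.
move=> VE V'E WE W'E; split; apply: (word_epi (mod_regepi V)).
  transitivity ((⟨L⟩ ⊗ act W) ∘ (τ ⊗ mod_map f)); first diagram (mod_mapP f, WE).
  symmetry; diagram (VE, mod_mapP f).
transitivity ((act W ⊗ ⟨L⟩) ∘ (1 ⊗ wbraid L (mod_ob W)) ∘ (τ' ⊗ mod_map f)).
  diagram (mod_mapP f, W'E).
symmetry; diagram (V'E, mod_mapP f).
Qed.

Lemma module_coactions_exist (K : sf_comonoid M L) :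
  is_bicomodule K τ τ' -> exists D : module_coactions Y m K τ τ', True.
Proof.
move=> bicA.
have l V := constructive_indefinite_description _ (module_lco_exists V).
have r V := constructive_indefinite_description _ (module_rco_exists V).
unshelve eexists; last by [].
refine (@ModuleCoactions _ _ _ _ _ _ _ _ (fun V => proj1_sig (l V))
  (fun V => proj1_sig (r V)) (fun V => proj2_sig (l V)) (fun V => proj2_sig (r V)) _ _).
  by move=> V; apply: (module_bicomodule bicA); [case: (l V) | case: (r V)].
move=> V W f; apply: module_map_bicomodule;
  [exact: proj2_sig (l V) | exact: proj2_sig (r V) | exact: proj2_sig (l W)
  | exact: proj2_sig (r W)].
Qed.

End Modules.

(** * The action of two copies of the bimonoid on a product *)

Section PairAction.
Variables (B : bmcat) (A : B).
Local Notation M := (bmon B).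
Local Notation c := (wbraid A A).
Local Notation "1" := ⟨A⟩.
Variable Y : B -> Prop.
Hypothesis Y_tens : forall V W : B, Y V -> Y W -> Y (tens (bmon B) V W).
Variables (V W : B) (v : whom M [A; V] [V]) (w : whom M [A; W] [W]).

Definition pair_act : whom M [A; A; V; W] [V; W] :=
  (v ⊗ w) ∘ (1 ⊗ wbraid A V ⊗ ⟨W⟩).

Lemma pair_actE : pair_act = (v ⊗ w) ∘ (1 ⊗ wbraid A V ⊗ ⟨W⟩).
Proof. by []. Qed.

Hypotheses (YV : Y V) (YW : Y W).
Hypotheses (v_faithful : faithful_left Y v) (w_faithful : faithful_left Y w).

(** The two factors are removed one after the other; in between, the braiding
brings W to the front. *)
Lemma pair_act_faithful (X : B) (g h : whom M [X] [V; W]) :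
  pair_act ∘ (wid M [A; A] ⊗ g) = pair_act ∘ (wid M [A; A] ⊗ h) -> g = h.
Proof.
move=> E.
apply: (faithful_left_word v_faithful (w := [W])) => //.
have K (f : whom M [A; X] [V; W]) : f = wbraid W V ∘ (wbraidV V W ∘ f).
  symmetry; diagram.
rewrite (K (_ ∘ (1 ⊗ g))) (K (_ ∘ (1 ⊗ h))); congr (_ ∘ _).
apply: (faithful_left_word w_faithful (w := [V])) => //.
have F (f : whom M [X] [V; W]) :
  (w ⊗ ⟨V⟩) ∘ (1 ⊗ (wbraidV V W ∘ ((v ⊗ ⟨W⟩) ∘ (1 ⊗ f))))
  = wbraidV V W ∘ (pair_act ∘ (wid M [A; A] ⊗ f)) ∘ (c ⊗ ⟨X⟩).
  symmetry; diagram pair_actE.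
by rewrite !F E.
Qed.

Lemma pair_act_faithful1 (X P : B) (YP : Y P) (g h : whom M [X] [V; W; P]) :
  (pair_act ⊗ ⟨P⟩) ∘ (wid M [A; A] ⊗ g)
  = (pair_act ⊗ ⟨P⟩) ∘ (wid M [A; A] ⊗ h) -> g = h.
Proof.
move=> E.
apply: (faithful_left_word v_faithful (w := [W; P])); first exact: Y_tens.
have K (f : whom M [A; X] [V; W; P]) :
    f = (wbraid W V ⊗ ⟨P⟩) ∘ ((wbraidV V W ⊗ ⟨P⟩) ∘ f).
  symmetry; diagram.
rewrite (K (_ ∘ (1 ⊗ g))) (K (_ ∘ (1 ⊗ h))); congr (_ ∘ _).
apply: (faithful_left_word w_faithful (w := [V; P])); first exact: Y_tens.
have F (f : whom M [X] [V; W; P]) :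
  (w ⊗ wid M [V; P]) ∘ (1 ⊗ ((wbraidV V W ⊗ ⟨P⟩) ∘ ((v ⊗ wid M [W; P]) ∘ (1 ⊗ f))))
  = (wbraidV V W ⊗ ⟨P⟩) ∘ ((pair_act ⊗ ⟨P⟩) ∘ (wid M [A; A] ⊗ f)) ∘ (c ⊗ ⟨X⟩).
  symmetry; diagram pair_actE.
by rewrite !F E.
Qed.

Lemma pair_act_faithful_word u (g h : whom M u [V; W]) :
  pair_act ∘ (wid M [A; A] ⊗ g) = pair_act ∘ (wid M [A; A] ⊗ h) -> g = h.
Proof.
move=> E; have K (f : whom M u [V; W]) : (f ∘ unpack M u) ∘ pack M u = f.
  by rewrite -wcompA packK wcompm1.
rewrite -(K g) -(K h); congr (_ ∘ _); apply: pair_act_faithful.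
by rewrite !(wlM [A; A] _ (unpack M u)) !wcompA E.
Qed.

Lemma pair_act_regular_epi :
  tensor_preserves_coequalizers M -> regular_epis_compose B ->
  regular_epi v -> regular_epi w -> regular_epi pair_act.
Proof.
move=> CP comp vr wr; rewrite /pair_act wtensR.
apply: (comp _ _ _ (1 ⊗ wbraid A V ⊗ ⟨W⟩)).
  apply: (split_epi_regular (i := (1 ⊗ wbraidV V A ⊗ ⟨W⟩))).
  change ((1 ⊗ wbraid A V ⊗ ⟨W⟩) ∘ (1 ⊗ wbraidV V A ⊗ ⟨W⟩) = wid M _).
  diagram.
apply: (comp _ _ _ (v ⊗ wid M [A; W])); first exact: right_regular_epi.
exact: left_regular_epi.
Qed.

End PairAction.

Section RegularModule.
Variables (B : bmcat) (A : B) (H : regular_wmb A).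
Local Notation M := (bmon B).
Local Notation c := (wbraid A A).
Local Notation c' := (wbraidV A A).
Local Notation "1" := ⟨A⟩.
Local Notation m := (rm H).
Local Notation t1 := (rt1 H).
Local Notation t4 := (rt4 H).
Local Notation e1 := (re1 H).
Local Notation j := (rj H).
Variable Y : B -> Prop.
Hypothesis Y_A : Y A.
Hypothesis Y_unit : Y (munit M).
Hypothesis m_faithful : faithful_left Y m.
Local Notation act2 := (pair_act m m).
Let act2E : act2 = (m ⊗ m) ∘ (1 ⊗ c ⊗ 1) := erefl _.

(** By [e1_e2], acting with AA turns e1 into e2 on the acting factors, where it
does not interfere with the multiplication on the other side. *)
Lemma e1_linear_l : e1 ∘ (m ⊗ 1) = (m ⊗ 1) ∘ (1 ⊗ c) ∘ (e1 ⊗ 1) ∘ (1 ⊗ c').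
Proof.
apply: (pair_act_faithful_word Y_A Y_A m_faithful m_faithful).
rewrite act2E.
diagram (e1_e2 H, eq_sym (m_assoc H), eq_sym (e1_e2 H), m_assoc H).
Qed.

Lemma e1_d1 : e1 ∘ rd1 H = rd1 H.
Proof.
have E : rd1 H = (m ⊗ 1) ∘ (1 ⊗ c) ∘ (t1 ⊗ 1) ∘ (1 ⊗ c') by [].
rewrite E; diagram (e1_linear_l, e1_t1 H).
Qed.

Lemma d1_mult : rd1 H ∘ (1 ⊗ rd1 H) = rd1 H ∘ (m ⊗ wid M [A; A]).
Proof.
have E : rd1 H = (m ⊗ 1) ∘ (1 ⊗ c) ∘ (t1 ⊗ 1) ∘ (1 ⊗ c') by [].
rewrite E; symmetry; diagram (t1_mult H, m_assoc H).
Qed.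

Variables (L : B) (p : whom M [A] [L]).
Variables (τ : whom M [A] [L; A]) (τ' : whom M [A] [A; L]).
Variables (μ : whom M [L; L] [L]) (ε : whom M [L] []) (n1 : whom M [L; A] [A]).
Hypothesis preserved : tensor_preserves_coequalizers M.
Hypothesis m_regular_epi : regular_epi m.
Hypothesis m'_regular_epi : regular_epi (m ∘ c').
Hypothesis p_regular_epi : regular_epi p.
Hypothesis n1_def : n1 ∘ (p ⊗ 1) = (j ⊗ 1) ∘ e1.
Hypothesis μE : μ ∘ (⟨L⟩ ⊗ p) = p ∘ n1.
Hypothesis εE : ε ∘ p = j.
Hypothesis τE : τ ∘ m = (p ⊗ 1) ∘ t1.
Hypothesis τ'E : τ' ∘ (m ∘ c') = (1 ⊗ p) ∘ t4.

(** On arguments of the form p(a) and bc, the coaction becomes t1, with which the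
idempotent e1 commutes, and the counit then turns t1 into m. *)
Lemma base_act : (ε ⊗ 1) ∘ (μ ⊗ 1) ∘ (⟨L⟩ ⊗ τ) = n1.
Proof.
apply: (word_epi (left_regular_epi preserved [L] m_regular_epi)).
apply: (word_epi (right_regular_epi preserved [A; A] p_regular_epi)).
diagram (τE, μE, n1_def, εE, eq_sym (t1_e1 H), eq_sym (m_t1 H),
   eq_sym (pi_linear Y_unit m_faithful), eq_sym n1_def).
Qed.

(** By [base_act] the product with the right coaction is expressed by e1 and t4;
these commute, and the counit turns t4 into m. *)
Lemma cotensor_idem :
  (1 ⊗ ε ⊗ 1) ∘ (1 ⊗ μ ⊗ 1) ∘ (τ' ⊗ τ) = e1.
Proof.
apply: (word_epi (right_regular_epi preserved [A] m'_regular_epi)).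
transitivity (((m ∘ c') ⊗ 1) ∘ (1 ⊗ e1)).
  diagram (base_act, τ'E, n1_def, e1_comm_t4 H, m_t4 H).
symmetry; diagram e1_linear_l.
Qed.

End RegularModule.

(** * Transport of a monoidal structure along a faithful functor *)

Lemma eq_homK (C : category) (X Y : C) (e : X = Y) :
  eq_hom (eq_sym e) · eq_hom e = idm X.
Proof. by case: _ / e; rewrite comp1m. Qed.

Lemma eq_homVK (C : category) (X Y : C) (e : X = Y) :
  eq_hom e · eq_hom (eq_sym e) = idm Y.
Proof. by case: _ / e; rewrite comp1m. Qed.

Section Transport.
Variables (C D : category) (MD : monoidal D) (F : functor C D).
Hypothesis faithful : forall (X Y : C) (f g : hom X Y), fmap F f = fmap F g -> f = g.
Variables (tensC : C -> C -> C) (unitC : C).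
Hypothesis e0 : munit MD = F unitC.
Hypothesis e2 : forall X Y, tens MD (F X) (F Y) = F (tensC X Y).
Local Notation φ X Y := (eq_hom (e2 X Y)).
Local Notation ψ X Y := (eq_hom (eq_sym (e2 X Y))).
Local Notation φ0 := (eq_hom e0).
Local Notation ψ0 := (eq_hom (eq_sym e0)).
Local Notation "f ⊠ g" := (tensm MD f g) (at level 30).
Local Notation id := (idm _).

Lemma tensl (X Y Z W : D) (g : hom Y Z) (f : hom X Y) :
  idm W ⊠ (g · f) = (idm W ⊠ g) · (idm W ⊠ f).
Proof. by rewrite -tensmM comp1m. Qed.

Lemma tensr (X Y Z W : D) (g : hom Y Z) (f : hom X Y) :
  (g · f) ⊠ idm W = (g ⊠ idm W) · (f ⊠ idm W).
Proof. by rewrite -tensmM comp1m. Qed.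

Lemma tens_swap (X X' Y Y' : D) (f : hom X X') (g : hom Y Y') :
  (f ⊠ id) · (id ⊠ g) = (id ⊠ g) · (f ⊠ id).
Proof. by rewrite -!tensmM !comp1m !compm1. Qed.

(** As the φ are isomorphisms, the coherence laws may be checked after composing
with them. *)
Lemma cancelφ X Y Z (f g : hom (F (tensC X Y)) Z) :
  f · φ X Y = g · φ X Y -> f = g.
Proof. exact: epi_split (eq_homVK (e2 X Y)). Qed.

Lemma cancelφr X X' Y W (f g : hom (tens MD W (F (tensC X X'))) Y) :
  f · (id ⊠ φ X X') = g · (id ⊠ φ X X') -> f = g.
Proof. by apply: (epi_split (fi := id ⊠ ψ X X')); rewrite -tensl eq_homVK tensm1. Qed.

Lemma cancelφl X X' Y W (f g : hom (tens MD (F (tensC X X')) W) Y) :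
  f · (φ X X' ⊠ id) = g · (φ X X' ⊠ id) -> f = g.
Proof. by apply: (epi_split (fi := ψ X X' ⊠ id)); rewrite -tensr eq_homVK tensm1. Qed.

Section Coherence.
Variable tm : forall X X' Y Y' : C, hom X X' -> hom Y Y' -> hom (tensC X Y) (tensC X' Y').
Variable am : forall X Y Z, hom (tensC (tensC X Y) Z) (tensC X (tensC Y Z)).
Variable aVm : forall X Y Z, hom (tensC X (tensC Y Z)) (tensC (tensC X Y) Z).
Variables (lm : forall X, hom (tensC unitC X) X) (lVm : forall X, hom X (tensC unitC X)).
Variables (rm : forall X, hom (tensC X unitC) X) (rVm : forall X, hom X (tensC X unitC)).
Hypothesis tmE : forall X X' Y Y' (f : hom X X') (g : hom Y Y'),
  fmap F (tm f g) · φ X Y = φ X' Y' · (fmap F f ⊠ fmap F g).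
Hypothesis amE : forall X Y Z, fmap F (am X Y Z) · φ (tensC X Y) Z · (φ X Y ⊠ id)
  = φ X (tensC Y Z) · (id ⊠ φ Y Z) · assoc MD (F X) (F Y) (F Z).
Hypothesis aVE : forall X Y Z, fmap F (aVm X Y Z) · φ X (tensC Y Z) · (id ⊠ φ Y Z)
  = φ (tensC X Y) Z · (φ X Y ⊠ id) · assocV MD (F X) (F Y) (F Z).
Hypothesis lmE : forall X, fmap F (lm X) · φ unitC X · (φ0 ⊠ id) = lun MD (F X).
Hypothesis rmE : forall X, fmap F (rm X) · φ X unitC · (id ⊠ φ0) = run MD (F X).
Hypothesis lVE : forall X, fmap F (lVm X) = φ unitC X · (φ0 ⊠ id) · lunV MD (F X).
Hypothesis rVE : forall X, fmap F (rVm X) = φ X unitC · (id ⊠ φ0) · runV MD (F X).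

(** Each law is mapped into D by the faithful functor F, where the given
equations turn it into the same law of D.  The data stay transparent, so that
strictness of F is a direct consequence. *)
Definition transported : monoidal C.
Proof.
refine (@Monoidal C tensC tm unitC
  am aVm
  lm lVm
  rm rVm _ _ _ _ _ _ _ _ _ _ _ _ _).
- move=> X Y; apply: faithful; apply: cancelφ.
  by rewrite tmE !fmap1 tensm1 compm1 comp1m.
- move=> X X' X'' Y Y' Y'' f' f g' g; apply: faithful; apply: cancelφ.
  by rewrite fmapM tmE -compA tmE compA tmE !fmapM tensmM compA.
- move=> X Y Z; apply: faithful; apply: cancelφ; apply: cancelφl.
  by rewrite fmapM fmap1 -!compA (compA _ (φ _ _)) amE !compA aVE -compA assocK compm1 comp1m.
- move=> X Y Z; apply: faithful; apply: cancelφ; apply: cancelφr.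
  by rewrite fmapM fmap1 -!compA (compA _ (φ _ _)) aVE !compA amE -compA assocVK compm1 comp1m.
- move=> X; apply: faithful; apply: cancelφ.
  apply: (epi_split (f := φ0 ⊠ id) (fi := ψ0 ⊠ id)).
    by rewrite -tensr eq_homVK tensm1.
  by rewrite fmapM fmap1 -!compA (compA _ (φ _ _)) lmE lVE -compA lunK compm1 comp1m.
- move=> X; apply: faithful.
  by rewrite fmapM fmap1 lVE !compA lmE lunVK.
- move=> X; apply: faithful; apply: cancelφ.
  apply: (epi_split (f := id ⊠ φ0) (fi := id ⊠ ψ0)).
    by rewrite -tensl eq_homVK tensm1.
  by rewrite fmapM fmap1 -!compA (compA _ (φ _ _)) rmE rVE -compA runK compm1 comp1m.
- move=> X; apply: faithful.
  by rewrite fmapM fmap1 rVE !compA rmE runVK.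
- move=> X X' Y Y' Z Z' f g h; apply: faithful; apply: cancelφ; apply: cancelφl.
  have E1 : fmap F (tm (tm f g) h) · φ (tensC X Y) Z · (φ X Y ⊠ id)
      = φ (tensC X' Y') Z' · (φ X' Y' ⊠ id) · ((fmap F f ⊠ fmap F g) ⊠ fmap F h).
    by rewrite tmE -!compA -!tensmM tmE compm1 comp1m.
  have E2 : fmap F (tm f (tm g h)) · φ X (tensC Y Z) · (id ⊠ φ Y Z)
      = φ X' (tensC Y' Z') · (id ⊠ φ Y' Z') · (fmap F f ⊠ (fmap F g ⊠ fmap F h)).
    by rewrite tmE -!compA -!tensmM tmE compm1 comp1m.
  rewrite !fmapM -(compA _ _ (φ _ Z)) -(compA _ _ (φ X Y ⊠ id)) E1 !compA amE.
  rewrite -(compA _ (assoc MD _ _ _)) assoc_nat compA -E2.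
  by rewrite -(compA _ _ (φ _ Z)) -(compA _ _ (φ X Y ⊠ id)) amE !compA.
- move=> X X' f; apply: faithful; apply: cancelφ.
  apply: (epi_split (f := φ0 ⊠ id) (fi := ψ0 ⊠ id)).
    by rewrite -tensr eq_homVK tensm1.
  rewrite !fmapM -!compA (compA _ (φ _ _)) tmE (compA (fmap F (lm X))) lmE.
  rewrite -lun_nat -lmE -!compA fmap1; congr (_ · (_ · _)).
  exact: esym (tens_swap _ _).
- move=> X X' f; apply: faithful; apply: cancelφ.
  apply: (epi_split (f := id ⊠ φ0) (fi := id ⊠ ψ0)).
    by rewrite -tensl eq_homVK tensm1.
  rewrite !fmapM -!compA (compA _ (φ _ _)) tmE (compA (fmap F (rm X))) rmE.
  rewrite -run_nat -rmE -!compA fmap1; congr (_ · (_ · _)).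
  exact: tens_swap.
- move=> X Y; apply: faithful; apply: cancelφ; apply: cancelφl.
  apply: (epi_split (f := (id ⊠ φ0) ⊠ id) (fi := (id ⊠ ψ0) ⊠ id)).
    by rewrite -tensr -tensl eq_homVK !tensm1.
  have E1 : fmap F (tm (idm X) (lm Y)) · φ X (tensC unitC Y) · (id ⊠ φ unitC Y)
      · (id ⊠ (φ0 ⊠ id)) = φ X Y · (id ⊠ lun MD (F Y)).
    by rewrite tmE fmap1 -!compA -!tensl compA lmE.
  have E2 : fmap F (am X unitC Y) · φ (tensC X unitC) Y · (φ X unitC ⊠ id)
      · ((id ⊠ φ0) ⊠ id) = φ X (tensC unitC Y) · (id ⊠ φ unitC Y)
      · (id ⊠ (φ0 ⊠ id)) · assoc MD (F X) (munit MD) (F Y).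
    by rewrite amE -(compA _ (assoc MD _ _ _)) assoc_nat compA.
  have E3 : fmap F (tm (rm X) (idm Y)) · φ (tensC X unitC) Y · (φ X unitC ⊠ id)
      · ((id ⊠ φ0) ⊠ id) = φ X Y · (run MD (F X) ⊠ id).
    by rewrite tmE fmap1 -!compA -!tensr compA rmE.
  rewrite E3 -triangle compA -E1 fmapM -!compA; congr (_ · _).
  by rewrite !compA E2.
- move=> X Y Z W; apply: faithful; apply: cancelφ; apply: cancelφl.
  apply: (epi_split (f := (φ X Y ⊠ id) ⊠ id) (fi := (ψ X Y ⊠ id) ⊠ id)).
    by rewrite -!tensr eq_homVK !tensm1.
  rewrite !fmapM.
  have E1 : fmap F (am (tensC X Y) Z W) · φ (tensC (tensC X Y) Z) W
       · (φ (tensC X Y) Z ⊠ id) · ((φ X Y ⊠ id) ⊠ id)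
    = φ (tensC X Y) (tensC Z W) · (φ X Y ⊠ id) · (id ⊠ φ Z W)
       · assoc MD (tens MD (F X) (F Y)) (F Z) (F W).
    rewrite amE -(compA _ (assoc MD _ _ _)) assoc_nat tensm1 compA.
    by rewrite -(compA (φ (tensC X Y) _)) -tens_swap compA.
  have E2 : fmap F (tm (am X Y Z) (idm W)) · φ (tensC (tensC X Y) Z) W
       · (φ (tensC X Y) Z ⊠ id) · ((φ X Y ⊠ id) ⊠ id)
    = φ (tensC X (tensC Y Z)) W · (φ X (tensC Y Z) ⊠ id) · ((id ⊠ φ Y Z) ⊠ id)
       · (assoc MD (F X) (F Y) (F Z) ⊠ id).
    by rewrite tmE fmap1 -!compA -!tensr (compA (fmap F (am X Y Z))) amE -!compA.
  have E3 : fmap F (am X (tensC Y Z) W) · φ (tensC X (tensC Y Z)) W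
       · (φ X (tensC Y Z) ⊠ id) · ((id ⊠ φ Y Z) ⊠ id)
    = φ X (tensC (tensC Y Z) W) · (id ⊠ φ (tensC Y Z) W) · (id ⊠ (φ Y Z ⊠ id))
       · assoc MD (F X) (tens MD (F Y) (F Z)) (F W).
    by rewrite amE -(compA _ (assoc MD _ _ _)) assoc_nat compA.
  have E4 : fmap F (tm (idm X) (am Y Z W)) · φ X (tensC (tensC Y Z) W)
       · (id ⊠ φ (tensC Y Z) W) · (id ⊠ (φ Y Z ⊠ id))
    = φ X (tensC Y (tensC Z W)) · (id ⊠ φ Y (tensC Z W)) · (id ⊠ (id ⊠ φ Z W))
       · (id ⊠ assoc MD (F Y) (F Z) (F W)).
    by rewrite tmE fmap1 -!compA -!tensl (compA (fmap F (am Y Z W))) amE -!compA.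
  have E5 : fmap F (am X Y (tensC Z W)) · φ (tensC X Y) (tensC Z W) · (φ X Y ⊠ id)
       · (id ⊠ φ Z W)
    = φ X (tensC Y (tensC Z W)) · (id ⊠ φ Y (tensC Z W)) · (id ⊠ (id ⊠ φ Z W))
       · assoc MD (F X) (F Y) (tens MD (F Z) (F W)).
    by rewrite amE -(compA _ (assoc MD _ _ _)) -(tensm1 MD (F X)) assoc_nat compA.
  set a1 := fmap F (am (tensC X Y) Z W) in E1 *.
  set a2 := fmap F (tm (am X Y Z) (idm W)) in E2 *.
  set a3 := fmap F (am X (tensC Y Z) W) in E3 *.
  set a4 := fmap F (tm (idm X) (am Y Z W)) in E4 *.
  set a5 := fmap F (am X Y (tensC Z W)) in E5 *.
  set x1 := φ (tensC (tensC X Y) Z) W in E1 E2 *.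
  transitivity (a5 · (a1 · x1 · (φ (tensC X Y) Z ⊠ id) · ((φ X Y ⊠ id) ⊠ id))).
    by rewrite !compA.
  transitivity (a4 · (a3 · (a2 · x1 · (φ (tensC X Y) Z ⊠ id) · ((φ X Y ⊠ id) ⊠ id)))).
    by rewrite E1 E2 !compA E5 -compA pentagon !compA -E4 -(compA a4) -(compA a4)
      -(compA a4) -(compA a4) -E3 !compA.
  by rewrite !compA.
Defined.

End Coherence.

(** The structure isomorphisms of D have to come from C; those of C are then
chosen among their preimages. *)
Definition lifts (X Y : C) (h : hom (F X) (F Y)) := exists f, fmap F f = h.

Hypothesis lifts_inv : forall X Y (h : hom (F X) (F Y)) (k : hom (F Y) (F X)),
  k · h = id -> h · k = id -> lifts h -> lifts k.
Hypothesis lifts_tens : forall X X' Y Y' (f : hom X X') (g : hom Y Y'),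
  lifts (φ X' Y' · (fmap F f ⊠ fmap F g) · ψ X Y).
Hypothesis lifts_assoc : forall X Y Z,
  lifts (φ X (tensC Y Z) · (id ⊠ φ Y Z) · assoc MD (F X) (F Y) (F Z)
    · (ψ X Y ⊠ id) · ψ (tensC X Y) Z).
Hypothesis lifts_lunV : forall X, lifts (φ unitC X · (φ0 ⊠ id) · lunV MD (F X)).
Hypothesis lifts_runV : forall X, lifts (φ X unitC · (id ⊠ φ0) · runV MD (F X)).

Lemma lifts_assocV X Y Z :
  lifts (φ (tensC X Y) Z · (φ X Y ⊠ id) · assocV MD (F X) (F Y) (F Z)
    · (id ⊠ ψ Y Z) · ψ X (tensC Y Z)).
Proof.
apply: lifts_inv (lifts_assoc X Y Z).
  rewrite -!compA (compA (ψ X (tensC Y Z))) eq_homK comp1m.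
  rewrite (compA (id ⊠ ψ Y Z)) -tensl eq_homK tensm1 comp1m.
  rewrite (compA (assocV MD _ _ _)) assocK comp1m (compA (φ X Y ⊠ id)) -tensr eq_homVK.
  by rewrite tensm1 comp1m eq_homVK.
rewrite -!compA (compA (ψ _ Z)) eq_homK comp1m.
rewrite (compA (ψ X Y ⊠ id)) -tensr eq_homK tensm1 comp1m.
rewrite (compA (assoc MD _ _ _)) assocVK comp1m (compA (id ⊠ φ Y Z)) -tensl eq_homVK.
by rewrite tensm1 comp1m eq_homVK.
Qed.

Lemma lifts_lun X : lifts (lun MD (F X) · (ψ0 ⊠ id) · ψ unitC X).
Proof.
apply: lifts_inv (lifts_lunV X).
  rewrite -!compA (compA (ψ unitC X)) eq_homK comp1m (compA (ψ0 ⊠ id)) -tensr eq_homK.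
  by rewrite tensm1 comp1m lunVK.
rewrite -!compA (compA (lunV MD _)) lunK comp1m (compA (φ0 ⊠ id)) -tensr eq_homVK.
by rewrite tensm1 comp1m eq_homVK.
Qed.

Lemma lifts_run X : lifts (run MD (F X) · (id ⊠ ψ0) · ψ X unitC).
Proof.
apply: lifts_inv (lifts_runV X).
  rewrite -!compA (compA (ψ X unitC)) eq_homK comp1m (compA (id ⊠ ψ0)) -tensl eq_homK.
  by rewrite tensm1 comp1m runVK.
rewrite -!compA (compA (runV MD _)) runK comp1m (compA (id ⊠ φ0)) -tensl eq_homVK.
by rewrite tensm1 comp1m eq_homVK.
Qed.

Lemma transport_monoidal : exists MC : monoidal C, strict_monoidal MC MD F.
Proof.
pose lift X Y (h : hom (F X) (F Y)) (l : lifts h) :=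
  constructive_indefinite_description _ l.
have tmE X X' Y Y' (f : hom X X') (g : hom Y Y') :
    fmap F (proj1_sig (lift _ _ _ (lifts_tens f g))) · φ X Y
    = φ X' Y' · (fmap F f ⊠ fmap F g).
  by rewrite (proj2_sig (lift _ _ _ _)) -compA eq_homK compm1.
have amE X Y Z :
    fmap F (proj1_sig (lift _ _ _ (lifts_assoc X Y Z))) · φ (tensC X Y) Z · (φ X Y ⊠ id)
    = φ X (tensC Y Z) · (id ⊠ φ Y Z) · assoc MD (F X) (F Y) (F Z).
  by rewrite (proj2_sig (lift _ _ _ _)) -(compA _ (ψ _ Z)) eq_homK compm1
    -(compA _ (ψ X Y ⊠ id)) -tensr eq_homK tensm1 compm1.
have aVE X Y Z :
    fmap F (proj1_sig (lift _ _ _ (lifts_assocV X Y Z))) · φ X (tensC Y Z) · (id ⊠ φ Y Z)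
    = φ (tensC X Y) Z · (φ X Y ⊠ id) · assocV MD (F X) (F Y) (F Z).
  by rewrite (proj2_sig (lift _ _ _ _)) -(compA _ (ψ X _)) eq_homK compm1
    -(compA _ (id ⊠ ψ Y Z)) -tensl eq_homK tensm1 compm1.
have lmE X : fmap F (proj1_sig (lift _ _ _ (lifts_lun X))) · φ unitC X · (φ0 ⊠ id)
    = lun MD (F X).
  by rewrite (proj2_sig (lift _ _ _ _)) -(compA _ (ψ unitC X)) eq_homK compm1
    -(compA _ (ψ0 ⊠ id)) -tensr eq_homK tensm1 compm1.
have rmE X : fmap F (proj1_sig (lift _ _ _ (lifts_run X))) · φ X unitC · (id ⊠ φ0)
    = run MD (F X).
  by rewrite (proj2_sig (lift _ _ _ _)) -(compA _ (ψ X unitC)) eq_homK compm1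
    -(compA _ (id ⊠ ψ0)) -tensl eq_homK tensm1 compm1.
have lVE X : fmap F (proj1_sig (lift _ _ _ (lifts_lunV X)))
    = φ unitC X · (φ0 ⊠ id) · lunV MD (F X) by rewrite (proj2_sig (lift _ _ _ _)).
have rVE X : fmap F (proj1_sig (lift _ _ _ (lifts_runV X)))
    = φ X unitC · (id ⊠ φ0) · runV MD (F X) by rewrite (proj2_sig (lift _ _ _ _)).
exists (transported tmE amE aVE lmE rmE lVE rVE).
exists e0, e2; split; [exact: tmE | exact: amE | exact: lmE | exact: rmE].
Qed.

End Transport.

(** * The monoidal category of modules *)

(** Strictness asks for equality of bicomodules: they are equal when they share
the carrier and have equal coactions, and the isomorphism given by such an
equality is the identity ([eq_hom_bicomodule]). *)
Lemma bicomodule_eq (C : category) (M : monoidal C) (L : C) (K : sf_comonoid M L)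
    (X : C) l r l' r' (P : @is_bicomodule _ M L K X l r)
    (P' : @is_bicomodule _ M L K X l' r') :
  l = l' -> r = r' -> Bicomodule P = Bicomodule P'.
Proof.
move=> e e'; move: P'; rewrite -e -e' => P'.
by rewrite (proof_irrelevance _ P P').
Qed.

Lemma eq_hom_bicomodule (C : category) (M : monoidal C) (L : C) (K : sf_comonoid M L)
    (X : C) l r l' r' (P : @is_bicomodule _ M L K X l r)
    (P' : @is_bicomodule _ M L K X l' r')
    (e : Bicomodule P = Bicomodule P' :> bicomodule_cat K) :
  l = l' -> r = r' -> bic_map (eq_hom e : bicomodule_map _ _) = wid M [X].
Proof.
move=> el er; move: P' e; rewrite -el -er => P'.
rewrite -(proof_irrelevance _ P P') => e.
by rewrite (proof_irrelevance _ e eq_refl).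
Qed.

Section MonoidalModules.
Variables (B : bmcat) (A : B) (H : regular_wmb A).
Local Notation M := (bmon B).
Hypothesis preserved : tensor_preserves_coequalizers M.
Hypothesis compose : regular_epis_compose B.
Variable L : B.
Local Notation c := (wbraid A A).
Local Notation c' := (wbraidV A A).
Local Notation "1" := ⟨A⟩.
Local Notation m := (rm H).
Local Notation t1 := (rt1 H).
Local Notation t2 := (rt2 H).
Local Notation e1 := (re1 H).
Local Notation e2 := (re2 H).
Local Notation j := (rj H).
Variable Y : B -> Prop.
Hypothesis Y_A : Y A.
Hypothesis Y_unit : Y (munit M).
Hypothesis Y_tens : forall V W : B, Y V -> Y W -> Y (tens (bmon B) V W).
Hypothesis m_regular_epi : regular_epi m.
Hypothesis m_faithful : faithful_left Y m.
Variables (τ : whom M [A] [L; A]) (τ' : whom M [A] [A; L]).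
Hypothesis tau_linear : τ ∘ m = (⟨L⟩ ⊗ m) ∘ (τ ⊗ 1).
Hypothesis tau_t1 : (τ ⊗ 1) ∘ t1 = (⟨L⟩ ⊗ t1) ∘ (τ ⊗ 1).
Hypothesis tau'_t1 : (1 ⊗ τ') ∘ t1 = (t1 ⊗ ⟨L⟩) ∘ (1 ⊗ wbraid L A) ∘ (τ' ⊗ 1).
Variable K : sf_comonoid M L.
Local Notation δ := (comul K).
Local Notation ε := (counit K).
Local Notation μ := (cmult K).
Hypothesis cotensor_e1 : (1 ⊗ ε ⊗ 1) ∘ (1 ⊗ μ ⊗ 1) ∘ (τ' ⊗ τ) = e1.
Variable D : module_coactions Y m K τ τ'.
Local Notation modT := (amodule Y m).
Implicit Types V W Z : modT.
Local Notation ob V := (mod_ob V).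
Local Notation act := mod_act.
Local Notation lco V := (mod_lco D V).
Local Notation rco V := (mod_rco D V).
Variable T : forall W : modT, whom M [A; ob W] [A; ob W].
Hypothesis TE : forall W, T W ∘ (1 ⊗ act W) = (1 ⊗ act W) ∘ (t1 ⊗ ⟨ob W⟩).

Local Notation act2 V W := (pair_act (act V) (act W)).

Lemma act2E V W : act2 V W = (act V ⊗ act W) ∘ (1 ⊗ wbraid A (ob V) ⊗ ⟨ob W⟩).
Proof. by []. Qed.

Lemma act2_mult V W :
  act2 V W ∘ (1 ⊗ 1 ⊗ act2 V W) = act2 V W ∘ (pair_act m m ⊗ wid M [ob V; ob W]).
Proof.
have E : pair_act m m = (m ⊗ m) ∘ (1 ⊗ c ⊗ 1) by [].
rewrite !act2E E; diagram (mod_actA V, mod_actA W).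
Qed.

Lemma act2_epi V W : regular_epi (act2 V W).
Proof. by apply: pair_act_regular_epi => //; apply: mod_regepi. Qed.

(** The relation between t1 and t2 passes to the quotient W of AW. *)
Lemma coproduct_t2 W : (m ⊗ ⟨ob W⟩) ∘ (1 ⊗ T W) = (1 ⊗ act W) ∘ (t2 ⊗ ⟨ob W⟩).
Proof.
apply: (word_epi (left_regular_epi preserved [A; A] (mod_regepi W))).
diagram (TE W, m_12 H, eq_sym (mod_actA W)).
Qed.

Lemma coproduct_nat V W (f : amodule_map V W) :
  (1 ⊗ mod_map f) ∘ T V = T W ∘ (1 ⊗ mod_map f).
Proof.
apply: (word_epi (left_regular_epi preserved [A] (mod_regepi V))).
transitivity ((1 ⊗ act W) ∘ (t1 ⊗ mod_map f)); first diagram (TE V, mod_mapP f).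
symmetry; diagram (mod_mapP f, TE W).
Qed.

Lemma tau_coproduct W : (τ ⊗ ⟨ob W⟩) ∘ T W = (⟨L⟩ ⊗ T W) ∘ (τ ⊗ ⟨ob W⟩).
Proof.
apply: (word_epi (left_regular_epi preserved [A] (mod_regepi W))).
diagram (TE W, tau_t1, eq_sym (TE W)).
Qed.

Lemma tau'_coproduct W : (1 ⊗ rco W) ∘ T W
  = (T W ⊗ ⟨L⟩) ∘ (1 ⊗ wbraid L (ob W)) ∘ (τ' ⊗ ⟨ob W⟩).
Proof.
apply: (word_epi (left_regular_epi preserved [A] (mod_regepi W))).
diagram (TE W, mod_rcoE D W, tau'_t1, eq_sym (TE W)).
Qed.

Lemma t2_coproduct W : (t2 ⊗ ⟨ob W⟩) ∘ (1 ⊗ T W) = (1 ⊗ T W) ∘ (t2 ⊗ ⟨ob W⟩).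
Proof.
apply: (word_epi (left_regular_epi preserved [A; A] (mod_regepi W))).
diagram (TE W, t2_t1 H, eq_sym (TE W)).
Qed.

Definition diag_act V W : whom M [A; ob V; ob W] [ob V; ob W] :=
  (act V ⊗ ⟨ob W⟩) ∘ (1 ⊗ wbraid (ob W) (ob V)) ∘ (T W ⊗ ⟨ob V⟩)
    ∘ (1 ⊗ wbraidV (ob V) (ob W)).
Local Notation Δ := diag_act.

Lemma diag_actE V W : Δ V W = (act V ⊗ ⟨ob W⟩) ∘ (1 ⊗ wbraid (ob W) (ob V))
  ∘ (T W ⊗ ⟨ob V⟩) ∘ (1 ⊗ wbraidV (ob V) (ob W)).
Proof. by []. Qed.

Lemma rd1E : rd1 H = (m ⊗ 1) ∘ (1 ⊗ c) ∘ (t1 ⊗ 1) ∘ (1 ⊗ c').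
Proof. by []. Qed.

(** V and W are quotients of AV and AW; when the action of these two copies of
A comes first, the diagonal action amounts to d1. *)
Lemma diag_act2 V W : Δ V W ∘ (1 ⊗ act2 V W) = act2 V W ∘ (rd1 H ⊗ wid M [ob V; ob W]).
Proof.
rewrite !act2E rd1E diag_actE; diagram (TE W, mod_actA V).
Qed.

Lemma diag_act_mult V W :
  Δ V W ∘ (1 ⊗ Δ V W) = Δ V W ∘ (m ⊗ wid M [ob V; ob W]).
Proof.
apply: (word_epi (left_regular_epi preserved [A; A] (act2_epi V W))).
transitivity (act2 V W ∘ (rd1 H ⊗ wid M [ob V; ob W])
   ∘ (1 ⊗ rd1 H ⊗ wid M [ob V; ob W])).
  diagram (diag_act2 V W, diag_act2 V W).
symmetry; diagram (diag_act2 V W, eq_sym (d1_mult H)).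
Qed.

Local Notation s V W := (cot_idem (module_bic D V) (module_bic D W)).

Lemma cot_idemE V W : s V W = (⟨ob V⟩ ⊗ ε ⊗ ⟨ob W⟩) ∘ (⟨ob V⟩ ⊗ μ ⊗ ⟨ob W⟩)
  ∘ (rco V ⊗ lco W).
Proof. by []. Qed.

(** The coactions of V and W are computed from those of A, so the idempotent
for V and W is the one for A and A, which is e1. *)
Lemma cot_idem_act2 V W : s V W ∘ act2 V W = act2 V W ∘ (e1 ⊗ wid M [ob V; ob W]).
Proof.
rewrite cot_idemE !act2E; diagram (mod_rcoE D V, mod_lcoE D W, cotensor_e1) within 300 extra 2.
Qed.

(** After one more action of AA on VW, the idempotent s becomes e1 on these two
factors, and the statement becomes [e1_e2]. *)
Lemma act2_cot_idem V W : act2 V W ∘ (1 ⊗ 1 ⊗ s V W) = act2 V W ∘ (e2 ⊗ wid M [ob V; ob W]).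
Proof.
apply: (word_epi (left_regular_epi preserved [A; A] (act2_epi V W))).
have E : pair_act m m = (m ⊗ m) ∘ (1 ⊗ c ⊗ 1) by [].
have E' : pair_act m m ∘ (1 ⊗ 1 ⊗ e1) = pair_act m m ∘ (e2 ⊗ 1 ⊗ 1).
  by rewrite E; exact: e1_e2.
diagram (cot_idem_act2 V W, act2_mult V W, E', eq_sym (act2_mult V W)).
Qed.

Lemma diag_act_idem V W : Δ V W ∘ (1 ⊗ s V W) = Δ V W.
Proof.
apply: (word_epi (left_regular_epi preserved [A] (act2_epi V W))).
have E : rd1 H ∘ (1 ⊗ e1) = rd1 H by exact: d1_e1.
diagram (cot_idem_act2 V W, diag_act2 V W, E, eq_sym (diag_act2 V W)).
Qed.

Lemma idem_diag_act V W : s V W ∘ Δ V W = Δ V W.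
Proof.
apply: (word_epi (left_regular_epi preserved [A] (act2_epi V W))).
diagram (diag_act2 V W, cot_idem_act2 V W,
  e1_d1 Y_A m_faithful, eq_sym (diag_act2 V W)).
Qed.

Lemma lco_diag_act V W :
  (lco V ⊗ ⟨ob W⟩) ∘ Δ V W = (⟨L⟩ ⊗ Δ V W) ∘ (τ ⊗ wid M [ob V; ob W]).
Proof.
rewrite diag_actE; diagram (mod_lcoE D V, tau_coproduct W).
Qed.

Lemma rco_diag_act V W :
  (⟨ob V⟩ ⊗ rco W) ∘ Δ V W
  = (Δ V W ⊗ ⟨L⟩) ∘ (1 ⊗ ⟨ob V⟩ ⊗ wbraid L (ob W)) ∘ (1 ⊗ wbraid L (ob V) ⊗ ⟨ob W⟩)
    ∘ (τ' ⊗ wid M [ob V; ob W]).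
Proof.
rewrite diag_actE; diagram (tau'_coproduct W).
Qed.

Lemma diag_act_nat V V' W W' (f : amodule_map V V') (g : amodule_map W W') :
  (mod_map f ⊗ mod_map g) ∘ Δ V W = Δ V' W' ∘ (1 ⊗ mod_map f ⊗ mod_map g).
Proof.
rewrite !diag_actE; diagram (mod_mapP f, coproduct_nat g).
Qed.

Variable split : idempotent_splitting B.
Hypothesis Y_retracts : closed_under_retracts Y.
Hypothesis d1_regular_epi : regular_epi (rd1_hat H split).
Hypothesis d2_regular_epi : regular_epi (rd2_hat H split).

Local Notation P V W := (cot_ob split (module_bic D V) (module_bic D W)).
Local Notation ι V W := (cot_in split (module_bic D V) (module_bic D W)).
Local Notation π V W := (cot_out split (module_bic D V) (module_bic D W)).

Definition tensor_act V W : whom M [A; P V W] [P V W] := π V W ∘ Δ V W ∘ (1 ⊗ ι V W).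
Local Notation ν := tensor_act.

Lemma in_out V W : ι V W ∘ π V W = s V W.
Proof. exact: cot_in_out. Qed.

Lemma out_in V W : π V W ∘ ι V W = ⟨P V W⟩.
Proof. exact: cot_out_in. Qed.

Lemma idem_in V W : s V W ∘ ι V W = ι V W.
Proof. exact: cot_idem_in. Qed.

Lemma out_idem V W : π V W ∘ s V W = π V W.
Proof. exact: cot_out_idem. Qed.

Lemma tensor_act_in V W : ι V W ∘ ν V W = Δ V W ∘ (1 ⊗ ι V W).
Proof.
rewrite /tensor_act; diagram (in_out V W, idem_diag_act V W).
Qed.

Lemma tensor_act_out V W : ν V W ∘ (1 ⊗ π V W) = π V W ∘ Δ V W.
Proof.
rewrite /tensor_act; diagram (in_out V W, diag_act_idem V W).
Qed.

Lemma tensor_actA V W : ν V W ∘ (1 ⊗ ν V W) = ν V W ∘ (m ⊗ ⟨P V W⟩).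
Proof.
apply: (@cot_in_mono _ _ _ K split (module_bic D V) (module_bic D W)).
diagram (tensor_act_in V W, tensor_act_in V W, diag_act_mult V W, eq_sym (tensor_act_in V W)).
Qed.

Local Notation S1 := (split_ob (split (re1K H))).
Let in1 : whom M [S1] [A; A] := split_in (split (re1K H)).
Let out1 : whom M [A; A] [S1] := split_out (split (re1K H)).
Local Notation S2 := (split_ob (split (re2K H))).
Let in2 : whom M [S2] [A; A] := split_in (split (re2K H)).
Let out2 : whom M [A; A] [S2] := split_out (split (re2K H)).
Let in_out1 : in1 ∘ out1 = e1 := split_in_out (split (re1K H)).
Let in_out2 : in2 ∘ out2 = e2 := split_in_out (split (re2K H)).
Let out_in1 : out1 ∘ in1 = ⟨S1⟩ := split_out_in (split (re1K H)).
Let d1h : whom M [A; A; A] [S1] := out1 ∘ rd1 H.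
Let d2h : whom M [A; A; A] [S2] := out2 ∘ rd2 H.

(** Composed with the epimorphisms AAAVW → AVW → A(V∘W), the action becomes the
corestriction of d1 to the splitting of e1, followed by an action of this
splitting on VW.  The former is a regular epimorphism by hypothesis; so is the
latter, since the composite of AA → A∘A with it is the regular epimorphism
AAVW → VW → V∘W. *)
Lemma tensor_act_epi V W : regular_epi (ν V W).
Proof.
have Q1 : regular_epi (π V W ∘ act2 V W).
  apply: (compose (f := act2 V W)); first exact: act2_epi.
  by apply: (split_epi_regular (i := ι V W)); apply: out_in.
have Q2 : regular_epi (π V W ∘ act2 V W ∘ (in1 ⊗ wid M [ob V; ob W])).
  apply: (@regular_epi_cancel _ _ _ _ _ (out1 ⊗ wid M [ob V; ob W])).
    move=> Z a b; apply: regular_epi_epi; apply: right_regular_epi => //.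
    by apply: (split_epi_regular (i := in1)); apply: out_in1.
  have E : π V W ∘ act2 V W = π V W ∘ act2 V W ∘ (in1 ⊗ wid M [ob V; ob W])
     ∘ (out1 ⊗ wid M [ob V; ob W]).
    symmetry; diagram (in_out1, eq_sym (cot_idem_act2 V W), out_idem V W).
  by rewrite E in Q1; exact: Q1.
apply: (@regular_epi_cancel _ _ _ _ _ (1 ⊗ π V W)).
  move=> Z a b; apply: regular_epi_epi; apply: left_regular_epi => //.
  by apply: (split_epi_regular (i := ι V W)); apply: out_in.
apply: (@regular_epi_cancel _ _ _ _ _ (1 ⊗ act2 V W)).
  move=> Z a b; apply: regular_epi_epi; apply: left_regular_epi => //.
  exact: act2_epi.
have E0 : e1 ∘ rd1 H = rd1 H by exact: e1_d1 Y_A m_faithful.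
have d1hE : d1h = out1 ∘ rd1 H by [].
have E : ν V W ∘ (1 ⊗ π V W) ∘ (1 ⊗ act2 V W)
    = π V W ∘ act2 V W ∘ (in1 ⊗ wid M [ob V; ob W]) ∘ (d1h ⊗ wid M [ob V; ob W]).
  transitivity (π V W ∘ act2 V W ∘ (rd1 H ⊗ wid M [ob V; ob W])).
    diagram (tensor_act_out V W, diag_act2 V W).
  symmetry; diagram (d1hE, in_out1, E0).
suff R : regular_epi (ν V W ∘ (1 ⊗ π V W) ∘ (1 ⊗ act2 V W)) by exact: R.
rewrite E; apply: (compose (f := d1h ⊗ wid M [ob V; ob W])) Q2.
exact: (@right_regular_epi _ _ preserved [ob V; ob W] [A; A; A] [S1] d1h d1_regular_epi).
Qed.

(** As t2 describes left multiplication on t1, acting with AA on the left of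
the diagonal action produces d2. *)
Lemma act2_diag_act V W :
  act2 V W ∘ (1 ⊗ 1 ⊗ Δ V W) = act2 V W ∘ (rd2 H ⊗ wid M [ob V; ob W]).
Proof.
have E : rd2 H = (1 ⊗ m) ∘ (c ⊗ 1) ∘ (1 ⊗ t2) ∘ (c' ⊗ 1) by [].
rewrite act2E diag_actE E.
diagram (mod_actA V, coproduct_t2 W, mod_actA W) within 300 extra 2.
Qed.

(** Test with the non-degenerate action of AA.  On V∘W that action factors
through the splitting of e2, so it may be composed with the corestriction of
d2, an epimorphism; by [act2_diag_act] the result depends only on the diagonal
action. *)
Lemma tensor_act_faithful V W : faithful_left Y (ν V W).
Proof.
move=> X Q YQ g h E.
have mono (f : whom M [X] [P V W; Q]) : (π V W ⊗ ⟨Q⟩) ∘ ((ι V W ⊗ ⟨Q⟩) ∘ f) = f.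
  diagram (out_in V W).
rewrite -(mono g) -(mono h); congr (_ ∘ _).
apply: (pair_act_faithful1 Y_tens (mod_class V) (mod_class W)
  (@act_faithful _ _ H Y V) (@act_faithful _ _ H Y W) YQ).
have F (f : whom M [X] [P V W; Q]) :
    (act2 V W ⊗ ⟨Q⟩) ∘ (wid M [A; A] ⊗ ((ι V W ⊗ ⟨Q⟩) ∘ f))
    = (act2 V W ⊗ ⟨Q⟩) ∘ (in2 ⊗ ((ι V W ⊗ ⟨Q⟩) ∘ f)) ∘ (out2 ⊗ ⟨X⟩).
  symmetry; diagram (in_out2, eq_sym (act2_cot_idem V W), idem_in V W).
rewrite !F; congr (_ ∘ _).
apply: (word_epi (right_regular_epi preserved [X] (d2_regular_epi : regular_epi d2h))).
have G (f : whom M [X] [P V W; Q]) :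
    (act2 V W ⊗ ⟨Q⟩) ∘ (in2 ⊗ ((ι V W ⊗ ⟨Q⟩) ∘ f)) ∘ (d2h ⊗ ⟨X⟩)
    = (act2 V W ⊗ ⟨Q⟩) ∘ (1 ⊗ 1 ⊗ ι V W ⊗ ⟨Q⟩)
      ∘ (1 ⊗ 1 ⊗ ((ν V W ⊗ ⟨Q⟩) ∘ (1 ⊗ f))).
  have d2hE : d2h = out2 ∘ rd2 H by [].
  transitivity ((act2 V W ⊗ ⟨Q⟩) ∘ (rd2 H ⊗ ((ι V W ⊗ ⟨Q⟩) ∘ f))).
    diagram (d2hE, in_out2, eq_sym (act2_cot_idem V W), idem_in V W).
  symmetry; diagram (tensor_act_in V W, act2_diag_act V W).
by rewrite !G E.
Qed.

Lemma tensor_class V W : Y (P V W).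
Proof.
apply: (Y_retracts (i := ι V W) (r := π V W)); first exact: out_in.
exact: Y_tens (mod_class V) (mod_class W).
Qed.

Definition tensor_module V W : modT :=
  Amodule (tensor_class V W) (tensor_actA V W) (tensor_act_epi V W)
    (tensor_act_faithful (V := V) (W := W)).
Local Notation TM := tensor_module.

Lemma tensor_map_linear V V' W W' (f : amodule_map V V') (g : amodule_map W W') :
  let h := cotm split (module_bic_map D f) (module_bic_map D g) in
  h ∘ ν V W = ν V' W' ∘ (1 ⊗ h).
Proof.
move=> h.
have E : ι V' W' ∘ h = (mod_map f ⊗ mod_map g) ∘ ι V W.
  exact: (cot_in_cotm split (module_bic_map D f) (module_bic_map D g)).
apply: (@cot_in_mono _ _ _ K split (module_bic D V') (module_bic D W')).
diagram (E, tensor_act_in V W, diag_act_nat f g, eq_sym E, eq_sym (tensor_act_in V' W')).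
Qed.

(** The coactions on a module are determined by the action, so it suffices that
those of the product of bicomodules are compatible with the diagonal action. *)
Lemma tensor_lco V W :
  mod_lco D (TM V W) = cot_lco split (module_bic D V) (module_bic D W).
Proof.
apply: (word_epi (tensor_act_epi V W)).
have E : mod_lco D (TM V W) ∘ ν V W = (⟨L⟩ ⊗ ν V W) ∘ (τ ⊗ ⟨P V W⟩).
  exact: (mod_lcoE D (TM V W)).
rewrite E; symmetry.
apply: (@wl_cot_in_mono _ _ _ K split (module_bic D V) (module_bic D W) [L] _ []).
have F : (⟨L⟩ ⊗ ι V W) ∘ cot_lco split (module_bic D V) (module_bic D W)
   = (lco V ⊗ ⟨ob W⟩) ∘ ι V W by exact: cot_in_lco.
transitivity ((⟨L⟩ ⊗ Δ V W) ∘ (τ ⊗ ι V W)).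
  diagram (F, tensor_act_in V W, lco_diag_act V W).
symmetry; diagram (tensor_act_in V W).
Qed.

Lemma tensor_rco V W :
  mod_rco D (TM V W) = cot_rco split (module_bic D V) (module_bic D W).
Proof.
apply: (word_epi (tensor_act_epi V W)).
have E : mod_rco D (TM V W) ∘ ν V W
    = (ν V W ⊗ ⟨L⟩) ∘ (1 ⊗ wbraid L (P V W)) ∘ (τ' ⊗ ⟨P V W⟩).
  exact: (mod_rcoE D (TM V W)).
rewrite E; symmetry.
apply: (@wl_cot_in_mono _ _ _ K split (module_bic D V) (module_bic D W) [] _ [L]).
have F : (ι V W ⊗ ⟨L⟩) ∘ cot_rco split (module_bic D V) (module_bic D W)
   = (⟨ob V⟩ ⊗ rco W) ∘ ι V W by exact: cot_in_rco.
transitivity ((Δ V W ⊗ ⟨L⟩) ∘ (1 ⊗ ⟨ob V⟩ ⊗ wbraid L (ob W))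
   ∘ (1 ⊗ wbraid L (ob V) ⊗ ⟨ob W⟩) ∘ (τ' ⊗ ι V W)).
  diagram (F, tensor_act_in V W, rco_diag_act V W).
symmetry; diagram (tensor_act_in V W).
Qed.

(** The fusion map on V∘W is the composite of the fusion maps on V and W: both
are determined by t2 through the non-degeneracy of m. *)
Lemma tensor_coproduct W Z :
  (1 ⊗ ι W Z) ∘ T (TM W Z) = (T W ⊗ ⟨ob Z⟩) ∘ (1 ⊗ wbraid (ob Z) (ob W))
    ∘ (T Z ⊗ ⟨ob W⟩) ∘ (1 ⊗ wbraidV (ob W) (ob Z)) ∘ (1 ⊗ ι W Z).
Proof.
apply: (faithful_left_word m_faithful (w := [ob W; ob Z])).
  exact: Y_tens (mod_class W) (mod_class Z).
have E : (m ⊗ ⟨P W Z⟩) ∘ (1 ⊗ T (TM W Z)) = (1 ⊗ ν W Z) ∘ (t2 ⊗ ⟨P W Z⟩).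
  exact: (coproduct_t2 (TM W Z)).
transitivity ((1 ⊗ Δ W Z) ∘ (t2 ⊗ ι W Z)).
  diagram (E, tensor_act_in W Z).
rewrite diag_actE; symmetry; diagram (coproduct_t2 W, t2_coproduct Z).
Qed.

(** Both products of three modules embed in VWZ, and there each action becomes
the threefold diagonal action, by [tensor_act_in] on one side and by
[tensor_coproduct] on the other. *)
Lemma assoc_linear V W Z
    (α : whom M [P (TM V W) Z] [P V (TM W Z)]) :
  (⟨ob V⟩ ⊗ ι W Z) ∘ ι V (TM W Z) ∘ α = (ι V W ⊗ ⟨ob Z⟩) ∘ ι (TM V W) Z ->
  α ∘ ν (TM V W) Z = ν V (TM W Z) ∘ (1 ⊗ α).
Proof.
move=> αE.
apply: (@cot_in_mono _ _ _ K split (module_bic D V) (module_bic D (TM W Z))).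
apply: (@wl_cot_in_mono _ _ _ K split (module_bic D W) (module_bic D Z) [ob V] _ []).
have E1 : Δ (TM V W) Z = (ν V W ⊗ ⟨ob Z⟩) ∘ (1 ⊗ wbraid (ob Z) (P V W))
  ∘ (T Z ⊗ ⟨P V W⟩) ∘ (1 ⊗ wbraidV (P V W) (ob Z)) by [].
have E2 : Δ V (TM W Z) = (act V ⊗ ⟨P W Z⟩) ∘ (1 ⊗ wbraid (P W Z) (ob V))
  ∘ (T (TM W Z) ⊗ ⟨ob V⟩) ∘ (1 ⊗ wbraidV (ob V) (P W Z)) by [].
transitivity ((Δ V W ⊗ ⟨ob Z⟩) ∘ (1 ⊗ ⟨ob V⟩ ⊗ wbraid (ob Z) (ob W))
  ∘ (1 ⊗ wbraid (ob Z) (ob V) ⊗ ⟨ob W⟩) ∘ (T Z ⊗ wid M [ob V; ob W])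
  ∘ (1 ⊗ wbraidV (ob V) (ob Z) ⊗ ⟨ob W⟩) ∘ (1 ⊗ ⟨ob V⟩ ⊗ wbraidV (ob W) (ob Z))
  ∘ (1 ⊗ ((ι V W ⊗ ⟨ob Z⟩) ∘ ι (TM V W) Z))).
  diagram (αE, tensor_act_in (TM V W) Z, E1, tensor_act_in V W).
rewrite diag_actE; symmetry.
diagram (tensor_act_in V (TM W Z), E2, tensor_coproduct W Z, αE) within 300 extra 3.
Qed.

Variables (p : whom M [A] [L]) (β : whom M [A; L] []).
Hypothesis Y_L : Y L.
Hypothesis p_regular_epi : regular_epi p.
Hypothesis pairingE : β ∘ (1 ⊗ p) = j ∘ m.
Hypothesis pairing_faithful : faithful_left Y β.
Hypothesis εE : ε ∘ p = j.
Hypothesis τE : τ ∘ m = (p ⊗ 1) ∘ t1.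
Hypothesis delta_tau : δ ∘ p = (⟨L⟩ ⊗ p) ∘ τ.
Hypothesis delta_tau' : δ ∘ p = (p ⊗ ⟨L⟩) ∘ τ'.
Hypothesis tau'_linear : τ' ∘ m = (m ⊗ ⟨L⟩) ∘ (1 ⊗ wbraid L A) ∘ (τ' ⊗ 1).
Local Notation β' := (pairing_r β).
Hypothesis tau_pairing' : (1 ⊗ β') ∘ (τ' ⊗ 1) = (1 ⊗ j) ∘ rt3 H.
Local Notation t3 := (rt3 H).

(** Paired with A, the morphism p.m becomes β.(m1).(11p), which depends only on
the image of its argument under 1p. *)
Lemma base_module_exists : exists λ : whom M [A; L] [L], λ ∘ (1 ⊗ p) = p ∘ m.
Proof.
apply: (word_factor (left_regular_epi preserved [A] p_regular_epi)) => X a b E.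
apply: (faithful_left_word pairing_faithful (w := [])) => //.
have F (f : whom M [X] [A; A]) :
  (β ⊗ wid M []) ∘ (1 ⊗ (p ∘ m ∘ f)) = β ∘ (m ⊗ ⟨L⟩) ∘ (1 ⊗ ((1 ⊗ p) ∘ f)).
  diagram (pairingE, eq_sym (m_assoc H), eq_sym pairingE).
by rewrite !F E.
Qed.

Variable λ : whom M [A; L] [L].
Hypothesis λE : λ ∘ (1 ⊗ p) = p ∘ m.

Lemma counit_base_act : ε ∘ λ = β.
Proof.
apply: (word_epi (left_regular_epi preserved [A] p_regular_epi)).
diagram (λE, εE, eq_sym pairingE).
Qed.

Lemma base_actA : λ ∘ (1 ⊗ λ) = λ ∘ (m ⊗ ⟨L⟩).
Proof.
apply: (word_epi (left_regular_epi preserved [A; A] p_regular_epi)).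
diagram (λE, λE, eq_sym (m_assoc H), eq_sym λE).
Qed.

Lemma base_act_epi : regular_epi λ.
Proof.
apply: (@regular_epi_cancel _ _ _ _ _ (1 ⊗ p)).
  move=> Z a b; apply: regular_epi_epi; exact: left_regular_epi.
have R : regular_epi (λ ∘ (1 ⊗ p)) by rewrite λE; apply: (compose (f := m)).
exact: R.
Qed.

(** λ is at least as fine as ε.λ, which is the pairing. *)
Lemma base_act_faithful : faithful_left Y λ.
Proof.
move=> X Q YQ g h E; apply: (pairing_faithful YQ).
have F (f : whom M [X] [L; Q]) :
    (β ⊗ ⟨Q⟩) ∘ (1 ⊗ f) = (ε ⊗ ⟨Q⟩) ∘ ((λ ⊗ ⟨Q⟩) ∘ (1 ⊗ f)).
  diagram (eq_sym counit_base_act).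
by rewrite !F E.
Qed.

Definition base_module : modT :=
  Amodule Y_L base_actA base_act_epi base_act_faithful.
Local Notation U := base_module.
Local Notation TU := (T U : whom M [A; L] [A; L]).

Lemma base_lco : mod_lco D U = δ.
Proof.
apply: (word_epi base_act_epi).
have E : mod_lco D U ∘ λ = (⟨L⟩ ⊗ λ) ∘ (τ ⊗ ⟨L⟩) by exact: (mod_lcoE D U).
rewrite E; symmetry.
apply: (word_epi (left_regular_epi preserved [A] p_regular_epi)).
transitivity ((⟨L⟩ ⊗ (p ∘ m)) ∘ (τ ⊗ 1)); first by diagram (λE, delta_tau, tau_linear).
symmetry; diagram λE.
Qed.

Lemma base_rco : mod_rco D U = δ.
Proof.
apply: (word_epi base_act_epi).
have E : mod_rco D U ∘ λ = (λ ⊗ ⟨L⟩) ∘ (1 ⊗ wbraid L L) ∘ (τ' ⊗ ⟨L⟩).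
  exact: (mod_rcoE D U).
rewrite E; symmetry.
apply: (word_epi (left_regular_epi preserved [A] p_regular_epi)).
transitivity (((p ∘ m) ⊗ ⟨L⟩) ∘ (1 ⊗ wbraid L A) ∘ (τ' ⊗ 1)).
  diagram (λE, delta_tau', tau'_linear).
symmetry; diagram λE.
Qed.

Lemma base_coproduct : TU ∘ (1 ⊗ p) = (1 ⊗ p) ∘ t1.
Proof.
have E : TU ∘ (1 ⊗ λ) = (1 ⊗ λ) ∘ (t1 ⊗ ⟨L⟩) by exact: (TE U).
apply: (word_epi (left_regular_epi preserved [A] m_regular_epi)).
diagram (eq_sym λE, E, λE, eq_sym (t1_linear Y_A m_faithful)).
Qed.

(** Composed with m on the last two factors, this is [t1_mult]. *)
Lemma diag_tau : (λ ⊗ 1) ∘ (1 ⊗ wbraid A L) ∘ (t1 ⊗ ⟨L⟩) ∘ (1 ⊗ wbraidV L A) ∘ (1 ⊗ τ)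
  = τ ∘ m.
Proof.
apply: (word_epi (left_regular_epi preserved [A] m_regular_epi)).
transitivity ((p ⊗ 1) ∘ t1 ∘ (m ⊗ 1)).
  symmetry; diagram (t1_mult H, eq_sym λE, eq_sym τE).
symmetry; diagram (eq_sym (m_assoc H), τE).
Qed.

(** W being a quotient of AW, the statement reduces to [diag_tau]. *)
Lemma lun_inv_linear W : lco W ∘ act W = Δ U W ∘ (1 ⊗ lco W).
Proof.
apply: (word_epi (left_regular_epi preserved [A] (mod_regepi W))).
have E : Δ U W = (λ ⊗ ⟨ob W⟩) ∘ (1 ⊗ wbraid (ob W) L)
  ∘ (T W ⊗ ⟨L⟩) ∘ (1 ⊗ wbraidV L (ob W)) by [].
transitivity ((⟨L⟩ ⊗ act W) ∘ ((τ ∘ m) ⊗ ⟨ob W⟩)).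
  diagram (mod_actA W, mod_lcoE D W).
rewrite -diag_tau E; symmetry; diagram (mod_lcoE D W, TE W).
Qed.

Lemma base_coproduct_pairing :
  (1 ⊗ β') ∘ (TU ⊗ 1) = (1 ⊗ β) ∘ (t3 ⊗ ⟨L⟩) ∘ (1 ⊗ wbraidV L A).
Proof.
apply: (word_epi (right_regular_epi preserved [A]
  (left_regular_epi preserved [A] p_regular_epi))).
transitivity ((1 ⊗ (j ∘ m ∘ c')) ∘ (t1 ⊗ 1)).
  diagram (base_coproduct, pairing_rE pairingE).
symmetry; diagram (pairingE, eq_sym (m_13 H)).
Qed.

(** Tested with the pairing on the right, this is multiplicativity of t3. *)
Lemma diag_tau' : (m ⊗ ⟨L⟩) ∘ (1 ⊗ wbraid L A) ∘ (TU ⊗ 1) ∘ (1 ⊗ wbraidV A L) ∘ (1 ⊗ τ')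
  = τ' ∘ m.
Proof.
apply: (faithful_right_word (pairing_r_faithful pairing_faithful)) => //.
transitivity (((1 ⊗ j) ∘ t3) ∘ (m ⊗ 1)); last by symmetry; diagram tau_pairing'.
transitivity (m ∘ (1 ⊗ ((1 ⊗ j) ∘ t3)) ∘ (c' ⊗ 1) ∘ (1 ⊗ t3) ∘ (c ⊗ 1)).
  have E' : β = β' ∘ wbraid A L.
    have E : β' = β ∘ wbraidV L A by [].
    symmetry; diagram E.
  diagram (base_coproduct_pairing, E', tau_pairing') within 300 extra 3.
symmetry; diagram (t3_mult H) within 300 extra 3.
Qed.

(** V being a quotient of AV, the statement reduces to [diag_tau']. *)
Lemma run_inv_linear V : rco V ∘ act V = Δ V U ∘ (1 ⊗ rco V).
Proof.
apply: (word_epi (left_regular_epi preserved [A] (mod_regepi V))).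
have E : Δ V U = (act V ⊗ ⟨L⟩) ∘ (1 ⊗ wbraid L (ob V))
  ∘ (TU ⊗ ⟨ob V⟩) ∘ (1 ⊗ wbraidV (ob V) L) by [].
transitivity ((act V ⊗ ⟨L⟩) ∘ (1 ⊗ wbraid L (ob V)) ∘ ((τ' ∘ m) ⊗ ⟨ob V⟩)).
  diagram (mod_actA V, mod_rcoE D V).
rewrite -diag_tau' E; symmetry; diagram (mod_rcoE D V, mod_actA V) within 300 extra 2.
Qed.

Definition linear V W (h : whom M [ob V] [ob W]) := h ∘ act V = act W ∘ (1 ⊗ h).

Lemma linear_inv V W (h : whom M [ob V] [ob W]) (k : whom M [ob W] [ob V]) :
  k ∘ h = ⟨ob V⟩ -> h ∘ k = ⟨ob W⟩ -> linear h -> linear k.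
Proof.
rewrite /linear => kh hk hE.
transitivity (k ∘ h ∘ act V ∘ (1 ⊗ k)); first by symmetry; diagram (hE, hk).
diagram kh.
Qed.

Local Notation MD := (bicomodule_monoidal K split).
Local Notation F := (module_functor D).

Lemma tensor_eq V W : tens MD (F V) (F W) = F (TM V W).
Proof. by apply: bicomodule_eq; rewrite ?tensor_lco ?tensor_rco. Qed.

Lemma unit_eq : munit MD = F U.
Proof. by apply: bicomodule_eq; rewrite ?base_lco ?base_rco. Qed.

Local Notation bic h := (bic_map (h : bicomodule_map _ _)).

Lemma tensor_eq_hom V W : bic (eq_hom (tensor_eq V W)) = ⟨P V W⟩.
Proof. by apply: eq_hom_bicomodule; rewrite ?tensor_lco ?tensor_rco. Qed.

Lemma tensor_eq_homV V W : bic (eq_hom (eq_sym (tensor_eq V W))) = ⟨P V W⟩.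
Proof. by apply: eq_hom_bicomodule; rewrite ?tensor_lco ?tensor_rco. Qed.

Lemma unit_eq_hom : bic (eq_hom unit_eq) = ⟨L⟩.
Proof. by apply: eq_hom_bicomodule; rewrite ?base_lco ?base_rco. Qed.

Lemma linear_lifts V W (h : hom (F V) (F W)) : linear (bic h) -> lifts h.
Proof.
move=> hE; exists (AmoduleMap hE : hom (V : amodule_cat Y m) W).
exact: bicomodule_map_eq.
Qed.

Lemma lifts_linear V W (h : hom (F V) (F W)) : lifts h -> linear (bic h).
Proof. by case=> f <-; apply: mod_mapP. Qed.

Local Notation modC := (amodule_cat Y m).

Lemma module_monoidal_exists :
  exists MA : monoidal modC, strict_monoidal MA MD F.
Proof.
apply: (@transport_monoidal modC (bicomodule_cat K) MD F _ tensor_module base_module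
  unit_eq tensor_eq).
- by move=> V W f g E; apply: amodule_map_eq; exact: (congr1 (fun h => bic h) E).
- move=> V W h k kh hk /lifts_linear hE; apply: linear_lifts.
  by apply: linear_inv hE; [exact: (congr1 (fun h => bic h) kh)
    | exact: (congr1 (fun h => bic h) hk)].
- move=> V V' W W' f g; apply: linear_lifts.
  rewrite /linear; set h := bic_map _.
  have -> : h = cotm split (module_bic_map D f) (module_bic_map D g).
    transitivity (bic (eq_hom (tensor_eq V' W'))
      ∘ cotm split (module_bic_map D f) (module_bic_map D g)
      ∘ bic (eq_hom (eq_sym (tensor_eq V W)))) => //.
    by rewrite tensor_eq_hom tensor_eq_homV wcomp1m wcompm1.
  exact: tensor_map_linear.
- move=> V W Z; apply: linear_lifts.
  rewrite /linear; set h := bic_map _.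
  pose g1 := cotm split (bicomodule_id (module_bic D V)) (eq_hom (tensor_eq W Z)).
  pose g2 := cotm split (eq_hom (eq_sym (tensor_eq V W))) (bicomodule_id (module_bic D Z)).
  have hE : h = g1 ∘ cot_assoc split (module_bic D V) (module_bic D W) (module_bic D Z) ∘ g2.
    transitivity (bic (eq_hom (tensor_eq V (TM W Z))) ∘ g1
      ∘ cot_assoc split (module_bic D V) (module_bic D W) (module_bic D Z) ∘ g2
      ∘ bic (eq_hom (eq_sym (tensor_eq (TM V W) Z)))) => //.
    by rewrite tensor_eq_hom tensor_eq_homV wcomp1m wcompm1.
  apply: assoc_linear; rewrite hE.
  have E1 : ι V (TM W Z) ∘ g1
      = cot_in split (module_bic D V) (cot split (module_bic D W) (module_bic D Z)).
    rewrite /g1 (cot_in_cotm split (bicomodule_id (module_bic D V)) (eq_hom (tensor_eq W Z))).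
    by rewrite tensor_eq_hom /= wtens1 wcomp1m.
  have E2 : cot_in split (cot split (module_bic D V) (module_bic D W)) (module_bic D Z) ∘ g2
      = ι (TM V W) Z.
    rewrite /g2 (cot_in_cotm split (eq_hom (eq_sym (tensor_eq V W)))
      (bicomodule_id (module_bic D Z))).
    by rewrite tensor_eq_homV /= wtens1 wcomp1m.
  have E3 := cot3_in_assocE split (module_bic D V) (module_bic D W) (module_bic D Z).
  transitivity ((⟨ob V⟩ ⊗ ι W Z) ∘ ((ι V (TM W Z) ∘ g1)
      ∘ cot_assoc split (module_bic D V) (module_bic D W) (module_bic D Z)) ∘ g2).
    by rewrite !wcompA.
  by rewrite E1 E3 -wcompA E2.
- move=> W; apply: linear_lifts.
  rewrite /linear; set h := bic_map _.
  pose g := cotm split (eq_hom unit_eq) (bicomodule_id (module_bic D W)).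
  have hE : h = g ∘ cot_lunV split (module_bic D W).
    transitivity (bic (eq_hom (tensor_eq U W)) ∘ g ∘ cot_lunV split (module_bic D W)) => //.
    by rewrite tensor_eq_hom wcomp1m.
  have ιh : ι U W ∘ h = lco W.
    rewrite hE wcompA /g (cot_in_cotm split (eq_hom unit_eq) (bicomodule_id (module_bic D W))).
    rewrite unit_eq_hom /= wtens1 wcomp1m /cot_lunV wcompA cot_in_out.
    exact: (cot_idem_unitl (module_bic D W)).
  (* The target of h is stated as the carrier of the product of bicomodules. *)
  suff : (h : whom M [ob W] [P U W]) ∘ act W = ν U W ∘ (1 ⊗ h) by [].
  apply: (@cot_in_mono _ _ _ K split (module_bic D U) (module_bic D W)).
  diagram (ιh, lun_inv_linear W, eq_sym ιh, eq_sym (tensor_act_in U W)).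
- move=> W; apply: linear_lifts.
  rewrite /linear; set h := bic_map _.
  pose g := cotm split (bicomodule_id (module_bic D W)) (eq_hom unit_eq).
  have hE : h = g ∘ cot_runV split (module_bic D W).
    transitivity (bic (eq_hom (tensor_eq W U)) ∘ g ∘ cot_runV split (module_bic D W)) => //.
    by rewrite tensor_eq_hom wcomp1m.
  have ιh : ι W U ∘ h = rco W.
    rewrite hE wcompA /g (cot_in_cotm split (bicomodule_id (module_bic D W)) (eq_hom unit_eq)).
    rewrite unit_eq_hom /= wtens1 wcomp1m /cot_runV wcompA cot_in_out.
    exact: (cot_idem_unitr (module_bic D W)).
  suff : (h : whom M [ob W] [P W U]) ∘ act W = ν W U ∘ (1 ⊗ h) by [].
  apply: (@cot_in_mono _ _ _ K split (module_bic D W) (module_bic D U)).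
  diagram (ιh, run_inv_linear W, eq_sym ιh, eq_sym (tensor_act_in W U)).
Qed.

End MonoidalModules.

(** * The strict monoidal functor to bicomodules *)

Theorem theorem4p12
    (B : bmcat)
    (coequalizers_exist : has_coequalizers B)
    (coequalizers_preserved : tensor_preserves_coequalizers (bmon B))
    (regular_epis_closed : regular_epis_compose B)
    (split : idempotent_splitting B)
    (A : B) (H : regular_wmb A)
    (m_regular_epi : regular_epi (rm H))
    (L : B) (p : whom (bmon B) [A] [L]) (p_base : is_base_object H p)
    (Y : B -> Prop)
    (Y_A : Y A) (Y_unit : Y (munit (bmon B))) (Y_L : Y L)
    (Y_tens : forall V W : B, Y V -> Y W -> Y (tens (bmon B) V W))
    (Y_retracts : closed_under_retracts Y)
    (m_nondeg : nondegenerate Y (rm H))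
    (n1 : whom (bmon B) [L; A] [A])
    (n1_def : n1 ∘ (p ⊗ ⟨A⟩) = (rj H ⊗ ⟨A⟩) ∘ re1 H)
    (n1_nondeg : nondegenerate_right Y n1)
    (d1_regular_epi : regular_epi (rd1_hat H split))
    (d2_regular_epi : regular_epi (rd2_hat H split)) :
  exists K : sf_comonoid (bmon B) L,
    is_base_comonoid H p n1 K /\
  exists (τA : whom (bmon B) [A] [L; A]) (τA' : whom (bmon B) [A] [A; L]),
    is_base_coactions H p K τA τA' /\
  exists (D : module_coactions Y (rm H) K τA τA')
         (MA : monoidal (amodule_cat Y (rm H))),
    strict_monoidal MA (bicomodule_monoidal K split) (module_functor D).
Proof.
have m_faithful : faithful_left Y (rm H) := proj1 m_nondeg.
have p_epi := base_regular_epi p_base.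
have [β βE] := pairing_exists coequalizers_preserved p_base.
have β_faithful : faithful_left Y β.
  exact: (pairing_faithful coequalizers_preserved p_base βE m_faithful n1_def n1_nondeg).
have [ε εE] := counit_exists p_base.
have [μ μE] := mult_exists coequalizers_preserved p_base Y_unit βE β_faithful n1_def.
have [δ δE] := comult_exists regular_epis_closed p_base m_regular_epi Y_L Y_unit βE β_faithful.
have [τ τE] := coaction_exists m_regular_epi Y_A Y_unit m_faithful βE β_faithful.
have [τ' τ'E] :=
  coaction_r_exists regular_epis_closed m_regular_epi Y_A Y_unit m_faithful βE β_faithful.
have K_coassoc : (δ ⊗ ⟨L⟩) ∘ δ = (⟨L⟩ ⊗ δ) ∘ δ by eapply comul_coassoc; eassumption.
have K_counitl : (ε ⊗ ⟨L⟩) ∘ δ = ⟨L⟩ by eapply comul_counitl; eassumption.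
have K_counitr : (⟨L⟩ ⊗ ε) ∘ δ = ⟨L⟩ by eapply comul_counitr; eassumption.
have K_assoc : μ ∘ (μ ⊗ ⟨L⟩) = μ ∘ (⟨L⟩ ⊗ μ) by eapply mult_assoc; eassumption.
have K_split : μ ∘ δ = ⟨L⟩ by eapply mult_comult; eassumption.
have K_frobl : (μ ⊗ ⟨L⟩) ∘ (⟨L⟩ ⊗ δ) = δ ∘ μ by eapply frobenius_l; eassumption.
have K_frobr : (⟨L⟩ ⊗ μ) ∘ (δ ⊗ ⟨L⟩) = δ ∘ μ by eapply frobenius_r; eassumption.
pose K := SfComonoid K_coassoc K_counitl K_counitr K_assoc K_split K_frobl K_frobr.
have bicA : is_bicomodule K τ τ'.
  by split; [eapply tau_coassoc | eapply tau_counit | eapply tau'_coassoc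
    | eapply tau'_counit | eapply tau_tau']; eassumption.
have β_tau : (β ⊗ ⟨A⟩) ∘ (⟨A⟩ ⊗ τ) = (rj H ⊗ ⟨A⟩) ∘ rt2 H.
  by eapply tau_pairing; eassumption.
have β_tau' : (⟨A⟩ ⊗ pairing_r β) ∘ (τ' ⊗ ⟨A⟩) = (⟨A⟩ ⊗ rj H) ∘ rt3 H.
  by eapply tau_pairing'; eassumption.
exists K; split.
  by split => //; rewrite -δE wcompA.
exists τ, τ'; split.
  split => //; symmetry; diagram (eq_sym τ'E).
have [D _] := module_coactions_exist Y_unit β_faithful β_tau β_tau' bicA.
exists D.
pose T W := constructive_indefinite_description _
  (@coproduct_exists _ _ H coequalizers_preserved _ m_faithful W).
(* The action of A on L; it makes the unit bicomodule a module. *)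
have [λ λE] := base_module_exists coequalizers_preserved Y_unit p_epi βE β_faithful.
eapply module_monoidal_exists with (T := fun W => proj1_sig (T W)); try eassumption.
- by eapply tau_linear; eassumption.
- by eapply tau_t1; eassumption.
- by eapply tau'_t1; eassumption.
- eapply cotensor_idem; try eassumption.
  exact: m'_regular_epi.
- by move=> W; exact: proj2_sig (T W).
- by eapply delta_tau; eassumption.
- by eapply delta_tau'; eassumption.
- by eapply tau'_linear; eassumption.
Qed.
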